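(* Let $A$ be one of the mesh algebras (1) $P(\mathbb{B}_k)$ for $k\ge2$; (2) $P(\mathbb{C}_n)$ for $n\ge3$; (3) $P(\mathbb{F}_4)$, with automorphism $\gamma=\eta^{-1}\circ\mu$. Then every basic maximal rigid module $T$ in $\mathrm{mod}\,A$ is $\gamma$-equivariant, i.e. ${}_\gamma T\cong T$.
   Context: $\mathbb{K}$ is an algebraically closed field; modules are finite-dimensional left modules. $T$ is rigid if $\mathrm{Ext}^1_A(T,T)=0$, and maximal rigid if moreover whenever $X\oplus T$ is rigid then $X\in\mathrm{add}(T)$. Basic means the indecomposable direct summands are pairwise non-isomorphic. Mesh algebras. Let $\Delta$ be an orientation of a simply laced Dynkin diagram with vertex set $\Delta_0$. The translation quiver $\mathbb{Z}\Delta$ has vertices $q_i$ ($i\in\mathbb{Z}$, $q\in\Delta_0$), and for every arrow $\alpha:v\to w$ of $\Delta$ and every $i\in\mathbb{Z}$ arrows $\alpha_i:v_i\to w_i$ and $\alpha_i':w_i\to v_{i-1}$; the translation is $\tau(q_i)=q_{i+1}$. For each arrow $b:y\to x$ of $\mathbb{Z}\Delta$ there is a unique arrow $b':\tau(x)\to y$. The mesh category $\mathcal{C}=\mathbb{K}(\mathbb{Z}\Delta)$ is the $\mathbb{K}$-linear path category of $\mathbb{Z}\Delta$ modulo the mesh relations $\sum_{b:y\to x} b\,b'=0$, one for each vertex $x$ (sum over all arrows ending in $x$). If $\sigma$ is a graph automorphism of the Dynkin diagram leaving the orientation $\Delta$ invariant, it induces an automorphism $\sigma$ of $\mathbb{Z}\Delta$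 and of $\mathcal{C}$ by $q_i\mapsto\sigma(q)_i$ (similarly on arrows); it commutes with $\tau$. For $G=\langle\sigma\tau\rangle$ the orbit category $\mathcal{C}/G$ is identified with the finite-dimensional algebra given by the orbit quiver $\mathbb{Z}\Delta/G$ modulo the relations induced by the mesh relations. The algebras in question are $\mathcal{C}/\langle\sigma\tau\rangle$ for: - $P(\mathbb{B}_k)$, $k\ge2$: $\Delta$ of type $\mathbb{A}_{2k-1}$ with orientation $2k-3\to 2k-5\to\cdots\to1\to0\leftarrow2\leftarrow\cdots\leftarrow2k-4\leftarrow2k-2$ and $\sigma=(1,2)(3,4)\cdots(2k-3,2k-2)$; - $P(\mathbb{C}_n)$, $n\ge3$: $\Delta$ of type $\mathbb{D}_{n+1}$ with arrows $0\to2$, $1\to2$, and $j+1\to j$ for $2\le j\le n-1$, and $\sigma=(0,1)$; - $P(\mathbb{F}_4)$: $\Delta$ of type $\mathbb{E}_6$ with arrows $4\to2\to0\leftarrow1\leftarrow3$ and $0\to5$, and $\sigma=(1,2)(3,4)$. These algebras are self-injective. Twists and $\gamma$. For an algebra automorphism $\varphi$ of $A$ and a left module $M$, ${}_\varphi M$ is the twist of $M$ by $\varphi$ ($a$ acts on ${}_\varphi M$ as $\varphi^{-1}(a)$ acts on $M$); the left action on bimodules ${}_\varphi A_{\mathrm{id}}$ is twisted in the same way. $\eta$ is a Nakayama automorphism, i.e. $\mathrm{Hom}_{\mathbb{K}}(A,\mathbb{K})\cong{}_{\eta^{-1}}A_{\mathrm{id}}$ as bimodules, and $\mu$ is an algebra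 automorphism with $\Omega^3_{A^e}(A)\cong{}_\mu A_{\mathrm{id}}$ as bimodules, where $A^e$ is the enveloping algebra and $\Omega_{A^e}$ the syzygy of bimodules (such $\mu$ is known to exist); $\gamma=\eta^{-1}\circ\mu$. These automorphisms are determined up to inner automorphisms. *)

(* Defs.v *)
From HB Require Import structures.
From mathcomp Require Import all_boot all_order all_fingroup all_algebra.
From mathcomp Require Import boolp functions.
From mathcomp Require Import finmap monalg zify.

Set Implicit Arguments.
Unset Strict Implicit.
Unset Printing Implicit Defensive.

Import GRing.Theory.
Local Open Scope ring_scope.

Record quiver (V E : Type) := Quiver { src : E -> V; tgt : E -> V }.

Section PathAlgebra.
Variables (n : nat) (E : choiceType) (Q : quiver 'I_n.+1 E).

(* The pair (v, [:: a1; ...; am]) stands for the path a1 a2 ... am ending in v,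
   where paths are composed like functions: first am, last a1.  The pair
   (v, [::]) is the path of length 0 at v. *)
Fixpoint is_path (v : 'I_n.+1) (s : seq E) : bool :=
  if s is a :: s' then (tgt Q a == v) && is_path (src Q a) s' else true.

Definition qpath : Type := {p : 'I_n.+1 * seq E | is_path p.1 p.2}.
HB.instance Definition _ := SubChoice.on qpath.

Definition path_tgt (p : qpath) : 'I_n.+1 := (val p).1.
Definition path_src (p : qpath) : 'I_n.+1 :=
  last (path_tgt p) [seq src Q a | a <- (val p).2].

Definition path0 (v : 'I_n.+1) : qpath := exist _ (v, [::]) isT.

Fact path1_subproof a : is_path (tgt Q a, [:: a]).1 (tgt Q a, [:: a]).2.
Proof. by rewrite /= eqxx. Qed.
Definition path1 (a : E) : qpath := exist _ (tgt Q a, [:: a]) (path1_subproof a).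

Lemma is_path_cat v s t :
  is_path v (s ++ t) = is_path v s && is_path (last v [seq src Q a | a <- s]) t.
Proof. by elim: s v => [//|a s IH] v /=; rewrite IH andbA. Qed.

Definition path_cat (p q : qpath) : option qpath :=
  if path_src p == path_tgt q
  then insub ((val p).1, (val p).2 ++ (val q).2) else None.

Variant path_cat_spec (p q : qpath) : option qpath -> Prop :=
| PathCat r of path_src p = path_tgt q
    & val r = ((val p).1, (val p).2 ++ (val q).2) : path_cat_spec p q (Some r)
| PathNoCat of path_src p != path_tgt q : path_cat_spec p q None.

Lemma path_catP p q : path_cat_spec p q (path_cat p q).
Proof.
rewrite /path_cat; case: eqP => [e|/eqP]; last by constructor.
case: insubP => [r _ e'|]; first by constructor.
rewrite /= is_path_cat (valP p) /=.
by rewrite -[last _ _]/(path_src p) e (valP q).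
Qed.

Lemma path_src_cat p q r : path_src p = path_tgt q ->
  val r = ((val p).1, (val p).2 ++ (val q).2) -> path_src r = path_src q.
Proof.
by move=> e er; rewrite {1}/path_src /path_tgt er /= map_cat last_cat
  -[last (val p).1 _]/(path_src p) e.
Qed.

Variable K : fieldType.

Definition path_alg : Type := {malg K[qpath]}.
HB.instance Definition _ := GRing.Lmodule.on path_alg.

Implicit Types (f g h : path_alg) (p q r : qpath).

(* Locked, since deciding conversion of two values << p >> is very slow. *)
Definition path_basis : qpath -> path_alg := locked (fun p => << p >>).

Lemma path_basisE p : path_basis p = << p >>.
Proof. by rewrite /path_basis; unlock. Qed.

Definition basis_mul p q : path_alg :=
  if path_cat p q is Some r then path_basis r else 0.

Definition path_mul f g : path_alg :=
  \sum_(p <- msupp f) \sum_(q <- msupp g) (f@_p * g@_q) *: basis_mul p q.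

Definition path_one : path_alg := \sum_v path_basis (path0 v).

Lemma path_mulw (d1 d2 : {fset qpath}) f g :
  (msupp f `<=` d1)%fset -> (msupp g `<=` d2)%fset ->
  path_mul f g = \sum_(p <- d1) \sum_(q <- d2) (f@_p * g@_q) *: basis_mul p q.
Proof.
move=> le1 le2; rewrite /path_mul (big_fset_incl _ le1) /=.
  apply: eq_bigr => p _; apply: big_fset_incl => // q _ /mcoeff_outdom ->.
  by rewrite mulr0 scale0r.
move=> p _ /mcoeff_outdom fp; rewrite big1 // => q _.
by rewrite fp mul0r scale0r.
Qed.

Lemma path_mulDl : left_distributive path_mul +%R.
Proof.
move=> f g h; rewrite (path_mulw (msuppD_le _ _) (fsubset_refl _)).
rewrite [path_mul f h](path_mulw (fsubsetUl _ (msupp g)) (fsubset_refl _)).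
rewrite [path_mul g h](path_mulw (fsubsetUr (msupp f) _) (fsubset_refl _)).
rewrite -big_split /=; apply: eq_bigr => p _.
rewrite -big_split /=; apply: eq_bigr => q _.
by rewrite mcoeffD mulrDl scalerDl.
Qed.

Lemma path_mulDr : right_distributive path_mul +%R.
Proof.
move=> h f g; rewrite (path_mulw (fsubset_refl _) (msuppD_le _ _)).
rewrite [path_mul h f](path_mulw (fsubset_refl _) (fsubsetUl _ (msupp g))).
rewrite [path_mul h g](path_mulw (fsubset_refl _) (fsubsetUr (msupp f) _)).
rewrite -big_split /=; apply: eq_bigr => p _.
rewrite -big_split /=; apply: eq_bigr => q _.
by rewrite mcoeffD mulrDr scalerDl.
Qed.

Lemma path_mulZl c f g : path_mul (c *: f) g = c *: path_mul f g.
Proof.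
rewrite (path_mulw (msuppZ_le _ _) (fsubset_refl _)) scaler_sumr.
apply: eq_bigr => p _; rewrite scaler_sumr; apply: eq_bigr => q _.
by rewrite mcoeffZ scalerA mulrA.
Qed.

Lemma path_mulZr c f g : path_mul f (c *: g) = c *: path_mul f g.
Proof.
rewrite (path_mulw (fsubset_refl _) (msuppZ_le _ _)) scaler_sumr.
apply: eq_bigr => p _; rewrite scaler_sumr; apply: eq_bigr => q _.
by rewrite mcoeffZ scalerA mulrCA mulrA.
Qed.

Lemma path_mul0l g : path_mul 0 g = 0.
Proof. by have := path_mulZl 0 0 g; rewrite !scale0r. Qed.

Lemma path_mul0r g : path_mul g 0 = 0.
Proof. by have := path_mulZr 0 g 0; rewrite !scale0r. Qed.

Lemma path_mul_suml (I : Type) (s : seq I) (P : pred I) (F : I -> path_alg) g :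
  path_mul (\sum_(i <- s | P i) F i) g = \sum_(i <- s | P i) path_mul (F i) g.
Proof.
by apply: (big_morph (path_mul^~ g)) => [x y|]; rewrite ?path_mulDl ?path_mul0l.
Qed.

Lemma path_mul_sumr (I : Type) (s : seq I) (P : pred I) (F : I -> path_alg) g :
  path_mul g (\sum_(i <- s | P i) F i) = \sum_(i <- s | P i) path_mul g (F i).
Proof.
by apply: (big_morph (path_mul g)) => [x y|]; rewrite ?path_mulDr ?path_mul0r.
Qed.

Lemma path_algE f : f = \sum_(p <- msupp f) f@_p *: path_basis p.
Proof.
rewrite {1}[f]monalgE; apply: eq_bigr => p _; apply/malgP => q.
by rewrite path_basisE mcoeffZ !mcoeffU mulrnAr mulr1.
Qed.

Lemma path_mulUU p q : path_mul (path_basis p) (path_basis q) = basis_mul p q.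
Proof.
rewrite !path_basisE (path_mulw msuppU_le msuppU_le) !big_seq_fset1 !mcoeffUU.
by rewrite mulr1 scale1r.
Qed.

Lemma basis_mulA p q r :
  path_mul (path_basis p) (basis_mul q r) =
  path_mul (basis_mul p q) (path_basis r).
Proof.
rewrite /basis_mul; case: path_catP => [qr e1 v1|n1];
  case: path_catP => [pq e2 v2|n2]; rewrite ?path_mul0l ?path_mul0r ?path_mulUU //.
- have e3 : path_src p = path_tgt qr by rewrite e2 /path_tgt v1.
  have e4 : path_src pq = path_tgt r by rewrite (path_src_cat e2 v2).
  rewrite /basis_mul; case: path_catP => [x _ vx|]; last by rewrite e3 eqxx.
  case: path_catP => [y _ vy|]; last by rewrite e4 eqxx.
  by congr path_basis; apply: val_inj; rewrite vx vy v1 v2 /= catA.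
- rewrite /basis_mul; case: path_catP => // x ex _.
  by move: n2; rewrite ex /path_tgt v1 eqxx.
- rewrite /basis_mul; case: path_catP => // x ex _.
  by move: n1; rewrite -ex (path_src_cat e2 v2) eqxx.
Qed.

Lemma path_mulA : associative path_mul.
Proof.
move=> f g h; rewrite [f]path_algE.
rewrite (path_mul_suml _ _ _ (path_mul g h)) (path_mul_suml _ _ _ g).
rewrite (path_mul_suml _ _ _ h); apply: eq_bigr => p _.
rewrite !path_mulZl; congr (_ *: _); rewrite [g]path_algE.
rewrite (path_mul_suml _ _ _ h) 2!(path_mul_sumr _ _ _ (path_basis p)).
rewrite (path_mul_suml _ _ _ h); apply: eq_bigr => q _.
rewrite !(path_mulZl, path_mulZr); congr (_ *: _); rewrite [h]path_algE.
rewrite (path_mul_sumr _ _ _ (path_basis q)) (path_mul_sumr _ _ _ (path_basis p)).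
rewrite (path_mul_sumr _ _ _ (path_mul _ _)); apply: eq_bigr => r _.
by rewrite !path_mulZr; congr (_ *: _); rewrite !path_mulUU basis_mulA.
Qed.

Lemma path_mul1l : left_id path_one path_mul.
Proof.
move=> f; rewrite [f]path_algE (path_mul_sumr _ _ _ path_one); apply: eq_bigr => p _.
rewrite path_mulZr; congr (_ *: _).
rewrite /path_one path_mul_suml (bigD1 (path_tgt p)) //= big1 ?addr0.
  rewrite path_mulUU /basis_mul; case: path_catP => [r _ vr|]; last first.
    by case/eqP.
  by congr path_basis; apply: val_inj; rewrite vr /path_tgt /=; case: (sval p).
move=> v nv; rewrite path_mulUU /basis_mul; case: path_catP => // r e _.
by rewrite -e eqxx in nv.
Qed.

Lemma path_mul1r : right_id path_one path_mul.
Proof.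
move=> f; rewrite [f]path_algE (path_mul_suml _ _ _ path_one); apply: eq_bigr => p _.
rewrite path_mulZl; congr (_ *: _).
rewrite /path_one path_mul_sumr (bigD1 (path_src p)) //= big1 ?addr0.
  rewrite path_mulUU /basis_mul; case: path_catP => [r _ vr|]; last first.
    by case/eqP.
  by congr path_basis; apply: val_inj; rewrite vr /= cats0; case: (sval p).
move=> v nv; rewrite path_mulUU /basis_mul; case: path_catP => // r e _.
by rewrite e eqxx in nv.
Qed.

(* The multiplicative functional killing all paths except the one of length 0
   at vertex 0; it shows that path algebras and their quotients by relations
   of positive length are nonzero. *)
Definition path_char f : K := f@_(path0 ord0).

Lemma path_char_basis p : path_char (path_basis p) = (p == path0 ord0)%:R.
Proof. by rewrite /path_char path_basisE mcoeffU. Qed.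

Lemma path_charB : {morph path_char : f g / f - g}.
Proof. by move=> f g; rewrite /path_char mcoeffB. Qed.

Lemma path_charZ c f : path_char (c *: f) = c * path_char f.
Proof. by rewrite /path_char mcoeffZ. Qed.

Lemma path_char_sum (I : Type) (s : seq I) (P : pred I) (F : I -> path_alg) :
  path_char (\sum_(i <- s | P i) F i) = \sum_(i <- s | P i) path_char (F i).
Proof. exact: (raddf_sum (mcoeff (path0 ord0))). Qed.

Lemma path_char_arr a : path_char (path_basis (path1 a)) = 0.
Proof. by rewrite path_char_basis -val_eqE /= xpair_eqE andbF. Qed.

Lemma path_char_path_one : path_char path_one = 1.
Proof.
rewrite /path_one path_char_sum (eq_bigr (fun v => (v == ord0)%:R)) => [|v _].
  by rewrite (bigD1 ord0) //= big1 ?addr0 // => v /negPf ->.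
by rewrite path_char_basis -val_eqE /= xpair_eqE andbT.
Qed.

Lemma path_char_path_mul f g :
  path_char (path_mul f g) = path_char f * path_char g.
Proof.
rewrite {1}/path_mul path_char_sum.
rewrite [in RHS](path_algE f) [in RHS](path_algE g).
rewrite !path_char_sum mulr_suml; apply: eq_bigr => p _.
rewrite path_char_sum mulr_sumr; apply: eq_bigr => q _.
rewrite !path_charZ !path_char_basis mulrACA; congr (_ * _).
rewrite /basis_mul; case: path_catP => [r e vr|ne].
  rewrite path_char_basis.
  suff -> : (r == path0 ord0) = (p == path0 ord0) && (q == path0 ord0).
    by rewrite -mulnb natrM.
  apply/eqP/andP => [er|[/eqP ep /eqP eq]]; last first.
    by apply: val_inj; rewrite vr ep eq.
  move: vr e; rewrite er /path_src /path_tgt.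
  case: p q => [[v [|a s]] hp] [[w [|b t]] hq] //= [<-] e.
  by split; apply/eqP/val_inj; rewrite //= -e.
rewrite /path_char mcoeff0 -natrM mulnb; case: andP => // -[/eqP ep /eqP eq].
by rewrite ep eq eqxx in ne.
Qed.

Lemma path_one_neq0 : path_one != 0.
Proof.
by apply/eqP => /(congr1 path_char)/eqP; rewrite path_char_path_one /path_char mcoeff0 oner_eq0.
Qed.

HB.instance Definition _ := GRing.Zmodule_isNzRing.Build path_alg
  path_mulA path_mul1l path_mul1r path_mulDl path_mulDr path_one_neq0.
HB.instance Definition _ := GRing.Lmodule_isLalgebra.Build K path_alg
  (fun c f g => esym (path_mulZl c f g)).
HB.instance Definition _ := GRing.Lalgebra_isAlgebra.Build K path_alg
  (fun c f g => esym (path_mulZr c f g)).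

Lemma path_char_one : path_char 1 = 1.
Proof. exact: path_char_path_one. Qed.

Lemma path_char_mul f g : path_char (f * g) = path_char f * path_char g.
Proof. exact: path_char_path_mul. Qed.

End PathAlgebra.

Definition two_sided (B : nzRingType) (J : {pred B}) : Prop :=
  [/\ zmod_closed J, forall a x, x \in J -> a * x \in J
    & forall a x, x \in J -> x * a \in J].

Record proper_ideal (B : nzRingType) := ProperIdeal {
  ideal_pred :> {pred B};
  ideal_two_sided : two_sided ideal_pred;
  ideal1 : 1 \notin ideal_pred }.

HB.instance Definition _ (B : nzRingType) (I : proper_ideal B) :=
  GRing.isZmodClosed.Build B (ideal_pred I)
    (let: And3 h _ _ := ideal_two_sided I in h).

Section AlgebraQuotient.
Local Open Scope quotient_scope.
Variables (K : fieldType) (B : algType K) (I : proper_ideal B).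

Definition alg_quot : Type := Quotient.quot (ideal_pred I).
HB.instance Definition _ := GRing.Zmodule.on alg_quot.

Definition quot_pi (x : B) : alg_quot := \pi_(Quotient.quot (ideal_pred I)) x.
Definition quot_repr (x : alg_quot) : B :=
  generic_quotient.repr (x : Quotient.quot (ideal_pred I)).

Lemma quot_reprK x : quot_pi (quot_repr x) = x.
Proof. exact: reprK. Qed.

Lemma quot_piP x y : reflect (quot_pi x = quot_pi y) (x - y \in ideal_pred I).
Proof. by rewrite Quotient.idealrBE; apply: eqP. Qed.

Lemma quot_piB : {morph quot_pi : x y / x - y}.
Proof. by move=> x y; rewrite /quot_pi !raddfB. Qed.

Lemma quot_piD : {morph quot_pi : x y / x + y}.
Proof. by move=> x y; rewrite /quot_pi !raddfD. Qed.

Lemma quot_reprB x : quot_repr (quot_pi x) - x \in ideal_pred I.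
Proof. by apply/quot_piP; rewrite quot_reprK. Qed.

Definition quot_one : alg_quot := quot_pi 1.
Definition quot_mul (x y : alg_quot) : alg_quot :=
  quot_pi (quot_repr x * quot_repr y).
Definition quot_scale (c : K) (x : alg_quot) : alg_quot :=
  quot_pi (c *: quot_repr x).

Lemma quot_piM x y : quot_pi (x * y) = quot_mul (quot_pi x) (quot_pi y).
Proof.
have [_ idl idr] := ideal_two_sided I.
apply/esym/quot_piP; set x' := quot_repr _; set y' := quot_repr _.
have -> : x' * y' - x * y = (x' - x) * y' + x * (y' - y).
  by rewrite mulrBl mulrBr addrA subrK.
by apply: rpredD; [apply: idr|apply: idl]; apply: quot_reprB.
Qed.

Lemma quot_piZ c x : quot_pi (c *: x) = quot_scale c (quot_pi x).
Proof.
have [_ idl _] := ideal_two_sided I.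
apply/esym/quot_piP; rewrite -scalerBr -[_ - x]mul1r scalerAl.
exact: idl (quot_reprB x).
Qed.

Lemma quot_mulA : associative quot_mul.
Proof.
move=> x y z; rewrite -[x]quot_reprK -[y]quot_reprK -[z]quot_reprK.
by rewrite -!quot_piM mulrA.
Qed.

Lemma quot_mul1l : left_id quot_one quot_mul.
Proof. by move=> x; rewrite -[x]quot_reprK -quot_piM mul1r. Qed.

Lemma quot_mul1r : right_id quot_one quot_mul.
Proof. by move=> x; rewrite -[x]quot_reprK -quot_piM mulr1. Qed.

Lemma quot_mulDl : left_distributive quot_mul +%R.
Proof.
move=> x y z; rewrite -[x]quot_reprK -[y]quot_reprK -[z]quot_reprK.
by rewrite -quot_piD -!quot_piM mulrDl quot_piD.
Qed.

Lemma quot_mulDr : right_distributive quot_mul +%R.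
Proof.
move=> x y z; rewrite -[x]quot_reprK -[y]quot_reprK -[z]quot_reprK.
by rewrite -quot_piD -!quot_piM mulrDr quot_piD.
Qed.

Lemma quot_one_neq0 : quot_one != 0.
Proof.
have -> : 0 = quot_pi 0 by rewrite /quot_pi raddf0.
by apply/eqP => /quot_piP; rewrite subr0; apply/negP/ideal1.
Qed.

HB.instance Definition _ := GRing.Zmodule_isNzRing.Build alg_quot
  quot_mulA quot_mul1l quot_mul1r quot_mulDl quot_mulDr quot_one_neq0.

Lemma quot_scaleA a b x : quot_scale a (quot_scale b x) = quot_scale (a * b) x.
Proof. by rewrite -[x]quot_reprK -!quot_piZ scalerA. Qed.

Lemma quot_scale1 : left_id 1 quot_scale.
Proof. by move=> x; rewrite -[x]quot_reprK -quot_piZ scale1r. Qed.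

Lemma quot_scaleDr : right_distributive quot_scale +%R.
Proof.
move=> a x y; rewrite -[x]quot_reprK -[y]quot_reprK.
by rewrite -quot_piD -!quot_piZ scalerDr quot_piD.
Qed.

Lemma quot_scaleDl x : {morph quot_scale^~ x : a b / a + b}.
Proof.
by move=> a b; rewrite -[x]quot_reprK -!quot_piZ scalerDl quot_piD.
Qed.

HB.instance Definition _ := GRing.Zmodule_isLmodule.Build K alg_quot
  quot_scaleA quot_scale1 quot_scaleDr quot_scaleDl.

Lemma quot_scaleAl (c : K) (x y : alg_quot) : c *: (x * y) = (c *: x) * y.
Proof.
rewrite -[x]quot_reprK -[y]quot_reprK.
by rewrite -[LHS]/(quot_scale _ (quot_mul _ _)) -[RHS]/(quot_mul (quot_scale _ _) _)
  -quot_piM -!quot_piZ -quot_piM scalerAl.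
Qed.

Lemma quot_scaleAr (c : K) (x y : alg_quot) : c *: (x * y) = x * (c *: y).
Proof.
rewrite -[x]quot_reprK -[y]quot_reprK.
by rewrite -[LHS]/(quot_scale _ (quot_mul _ _)) -[RHS]/(quot_mul _ (quot_scale _ _))
  -quot_piM -!quot_piZ -quot_piM scalerAr.
Qed.

HB.instance Definition _ := GRing.Lmodule_isLalgebra.Build K alg_quot quot_scaleAl.
HB.instance Definition _ := GRing.Lalgebra_isAlgebra.Build K alg_quot quot_scaleAr.

End AlgebraQuotient.

Definition generated_ideal (B : nzRingType) (S : B -> Prop) : {pred B} :=
  fun x => `[< forall J : {pred B}, two_sided J ->
                 (forall y, S y -> y \in J) -> x \in J >].

Lemma generated_idealP (B : nzRingType) (S : B -> Prop) x :
  reflect (forall J : {pred B}, two_sided J ->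
             (forall y, S y -> y \in J) -> x \in J) (x \in generated_ideal S).
Proof. exact: asboolP. Qed.

Lemma generated_ideal_two_sided (B : nzRingType) (S : B -> Prop) :
  two_sided (generated_ideal S).
Proof.
split; first split.
- by apply/generated_idealP => J [[]].
- move=> x y /generated_idealP hx /generated_idealP hy.
  apply/generated_idealP => J tJ sJ; have [[_ hB] _ _] := tJ.
  by apply: hB; [apply: hx | apply: hy].
- move=> a x /generated_idealP hx; apply/generated_idealP => J tJ sJ.
  by have [_ h _] := tJ; apply: h; apply: hx.
- move=> a x /generated_idealP hx; apply/generated_idealP => J tJ sJ.
  by have [_ _ h] := tJ; apply: h; apply: hx.
Qed.

(* An orientation of a diagram without multiple edges, together with a graph
   automorphism leaving the orientation invariant. *)
Record oriented_diagram := OrientedDiagram {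
  rk : nat;
  edge : rel 'I_rk.+1;
  sigma : {perm 'I_rk.+1};
  sigma_edge : forall v w, edge (sigma v) (sigma w) = edge v w }.

Definition perm_expz (T : finType) (s : {perm T}) (i : int) : {perm T} :=
  match i with Posz n => s ^+ n | Negz n => s ^- n.+1 end%g.

Lemma perm_expzS (T : finType) (s : {perm T}) i :
  perm_expz s (i + 1) = (perm_expz s i * s)%g.
Proof.
case: i => [n|[|n]].
- by rewrite -PoszD addn1 /= expgSr.
- by rewrite /= expg1 mulVg.
- have -> : Negz n.+1 + 1 = Negz n.
    by rewrite !NegzE (intS n.+1) opprD addrAC addNr add0r.
  by rewrite /= (expgS _ n.+1) invMg mulgKV.
Qed.

(* An automorphism s of Z and the translation generate the group G acting on
   int * Z whose generator is (i, z) |-> (i + 1, s z).  Every G-orbit contains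
   exactly one element of the form (0, z); orbit_rep maps an element to this z. *)
Section Orbits.
Variables (Z : finType) (s : {perm Z}).

Definition shift (x : int * Z) : int * Z := (x.1 + 1, s x.2).
Definition orbit_rep (x : int * Z) : Z := ((perm_expz s x.1)^-1)%g x.2.

Lemma orbit_rep0 z : orbit_rep (0, z) = z.
Proof. by rewrite /orbit_rep /= expg0 invg1 perm1. Qed.

Lemma orbit_rep_iter n x : orbit_rep (iter n shift x) = orbit_rep x.
Proof.
by elim: n => //= n <-; rewrite /orbit_rep /= perm_expzS invMg permM permK.
Qed.

Lemma iter_shift n x : iter n shift x = (x.1 + n%:Z, (s ^+ n)%g x.2).
Proof.
elim: n => [|n IH]; first by rewrite addr0 expg0 perm1; case: x.
by rewrite iterS IH /shift /= expgSr permM intS -addrA [1 + _]addrC.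
Qed.

Lemma orbit_repE x : exists m n, iter m shift x = iter n shift (0, orbit_rep x).
Proof.
case: x => -[n|n] z; rewrite /orbit_rep /=.
  by exists 0%N, n; rewrite [RHS]iter_shift /= permKV.
exists n.+1, 0%N; rewrite iter_shift /= invgK; congr (_, _).
by rewrite NegzE addNr.
Qed.

Lemma orbit_repP x y :
  orbit_rep x = orbit_rep y <-> exists m n, iter m shift x = iter n shift y.
Proof.
split=> [exy|[m [n e]]]; last first.
  by rewrite -(orbit_rep_iter m) e orbit_rep_iter.
have [a [b ex]] := orbit_repE x; have [c [d ey]] := orbit_repE y.
exists (d + a)%N, (b + c)%N.
by rewrite !iterD ex ey exy -!iterD addnC.
Qed.

End Orbits.

Section MeshAlgebra.
Variable D : oriented_diagram.

Local Notation vtx := 'I_(rk D).+1.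

Definition arr : Type := {p : vtx * vtx | edge p.1 p.2}.
HB.instance Definition _ := SubFinite.on arr.

Definition arr_src (a : arr) : vtx := (val a).1.
Definition arr_tgt (a : arr) : vtx := (val a).2.

Fact sigma_arr_subproof (a : arr) :
  edge (sigma D (arr_src a), sigma D (arr_tgt a)).1
       (sigma D (arr_src a), sigma D (arr_tgt a)).2.
Proof. by rewrite /= sigma_edge; apply: (valP a). Qed.

Definition sigma_arr (a : arr) : arr :=
  Sub (sigma D (arr_src a), sigma D (arr_tgt a)) (sigma_arr_subproof a).

Lemma sigma_arr_inj : injective sigma_arr.
Proof.
move=> a b /(congr1 val) [/perm_inj e1 /perm_inj e2]; apply: val_inj.
by move: e1 e2; rewrite /arr_src /arr_tgt; case: (val a) (val b) => ? ? [? ?] /= -> ->.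
Qed.

(* The translation quiver Z Delta: the vertex (i, q) is q_i, the arrow
   (i, inl alpha) is alpha_i and the arrow (i, inr alpha) is alpha_i'. *)
Definition ZD : quiver (int * vtx) (int * (arr + arr)) := {|
  src b := match b with
           | (i, inl a) => (i, arr_src a)
           | (i, inr a) => (i, arr_tgt a)
           end;
  tgt b := match b with
           | (i, inl a) => (i, arr_tgt a)
           | (i, inr a) => (i - 1, arr_src a)
           end |}.

Definition tau (x : int * vtx) : int * vtx := (x.1 + 1, x.2).

(* For b : y -> x this is the arrow b' : tau x -> y. *)
Definition mesh_arr (b : int * (arr + arr)) : int * (arr + arr) :=
  match b with
  | (i, inl a) => (i + 1, inr a)
  | (i, inr a) => (i, inl a)
  end.

Lemma src_mesh_arr b : src ZD (mesh_arr b) = tau (tgt ZD b).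
Proof. by case: b => i [a|a] //=; rewrite /tau /= subrK. Qed.

Lemma tgt_mesh_arr b : tgt ZD (mesh_arr b) = src ZD b.
Proof. by case: b => i [a|a] //=; rewrite addrK. Qed.

Definition sigma_dbl_fun (c : arr + arr) : arr + arr :=
  match c with inl a => inl (sigma_arr a) | inr a => inr (sigma_arr a) end.

Lemma sigma_dbl_inj : injective sigma_dbl_fun.
Proof.
move=> [a|a] [b|b] // h; congr (_ _); apply: sigma_arr_inj.
- exact: (congr1 (fun c : arr + arr => if c is inl x then x else sigma_arr a) h).
- exact: (congr1 (fun c : arr + arr => if c is inr x then x else sigma_arr a) h).
Qed.

Definition sigma_dbl : {perm arr + arr} := perm sigma_dbl_inj.

(* The generator sigma tau of G, on the vertices and on the arrows of Z Delta. *)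
Definition sigma_tau_vtx := shift (sigma D).
Definition sigma_tau_arr := shift sigma_dbl.

Lemma sigma_tau_src b : src ZD (sigma_tau_arr b) = sigma_tau_vtx (src ZD b).
Proof. by case: b => i [a|a]; rewrite /sigma_tau_vtx /shift /= permE. Qed.

Lemma sigma_tau_tgt b : tgt ZD (sigma_tau_arr b) = sigma_tau_vtx (tgt ZD b).
Proof.
by case: b => i [a|a]; rewrite /sigma_tau_vtx /shift /= permE //= addrAC.
Qed.

Lemma sigma_tau_mesh b : mesh_arr (sigma_tau_arr b) = sigma_tau_arr (mesh_arr b).
Proof. by case: b => i [a|a]; rewrite /sigma_tau_arr /shift /= !permE. Qed.

(* The orbit quiver Z Delta / G, every orbit being represented by its element
   with index 0. *)
Definition orbit_vtx : int * vtx -> vtx := orbit_rep (sigma D).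
Definition orbit_arr : int * (arr + arr) -> arr + arr := orbit_rep sigma_dbl.

Definition orbit_quiver : quiver vtx (arr + arr)%type := {|
  src c := orbit_vtx (src ZD (0, c));
  tgt c := orbit_vtx (tgt ZD (0, c)) |}.

Lemma orbit_src b : src orbit_quiver (orbit_arr b) = orbit_vtx (src ZD b).
Proof.
have [m [n e]] := orbit_repE sigma_dbl b; apply/esym/orbit_repP; exists m, n.
have h k x : iter k sigma_tau_vtx (src ZD x) = src ZD (iter k sigma_tau_arr x).
  by elim: k => //= k ->; rewrite -sigma_tau_src.
by rewrite -!/sigma_tau_vtx !h /sigma_tau_arr e.
Qed.

Lemma orbit_tgt b : tgt orbit_quiver (orbit_arr b) = orbit_vtx (tgt ZD b).
Proof.
have [m [n e]] := orbit_repE sigma_dbl b; apply/esym/orbit_repP; exists m, n.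
have h k x : iter k sigma_tau_vtx (tgt ZD x) = tgt ZD (iter k sigma_tau_arr x).
  by elim: k => //= k ->; rewrite -sigma_tau_tgt.
by rewrite -!/sigma_tau_vtx !h /sigma_tau_arr e.
Qed.

Lemma orbit_mesh b :
  orbit_arr (mesh_arr (0, orbit_arr b)) = orbit_arr (mesh_arr b).
Proof.
have [m [n e]] := orbit_repE sigma_dbl b; apply/esym/orbit_repP; exists m, n.
have h k x : iter k sigma_tau_arr (mesh_arr x) = mesh_arr (iter k sigma_tau_arr x).
  by elim: k => //= k ->; rewrite -sigma_tau_mesh.
by rewrite -!/sigma_tau_arr !h /sigma_tau_arr e.
Qed.

Variable K : fieldType.

Local Notation KQ := (path_alg orbit_quiver K).

Definition arr_elt (c : arr + arr) : KQ := path_basis K (path1 orbit_quiver c).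

(* The element induced by the mesh relation sum_(b : y -> x) b b'.  The arrows
   of the orbit quiver ending in v are in bijection with the arrows of Z Delta
   ending in any fixed vertex of the orbit v. *)
Definition mesh_rel (v : vtx) : KQ :=
  \sum_(c | tgt orbit_quiver c == v)
     arr_elt c * arr_elt (orbit_arr (mesh_arr (0, c))).

Definition mesh_ideal_pred : {pred KQ} :=
  generated_ideal (fun y => exists v, y = mesh_rel v).

Lemma path_char_mesh_rel v : path_char (mesh_rel v) = 0.
Proof.
rewrite /mesh_rel path_char_sum big1 // => c _.
by rewrite path_char_mul path_char_arr mul0r.
Qed.

Lemma mesh_ideal1 : 1 \notin mesh_ideal_pred.
Proof.
apply/negP => /generated_idealP h.
pose J : {pred KQ} := fun f => path_char f == 0.
have JE f : (f \in J) = (path_char f == 0) by [].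
suff : 1 \in J by rewrite JE path_char_one oner_eq0.
apply: h => [|_ [v ->]]; last by rewrite JE path_char_mesh_rel.
split; first split.
- by rewrite JE -[0](subrr 1) path_charB subrr.
- by move=> f g; rewrite !JE path_charB => /eqP -> /eqP ->; rewrite subrr.
- by move=> f g; rewrite !JE path_char_mul => /eqP ->; rewrite mulr0.
- by move=> f g; rewrite !JE path_char_mul => /eqP ->; rewrite mul0r.
Qed.

Definition mesh_ideal : proper_ideal KQ :=
  ProperIdeal (generated_ideal_two_sided _) mesh_ideal1.

(* The algebra identified with the orbit category C / <sigma tau>. *)
Definition mesh_alg : Type := alg_quot mesh_ideal.
HB.instance Definition _ := GRing.Algebra.on mesh_alg.

End MeshAlgebra.

(* Diagrams with vertex set {0, ..., n} whose orientation and automorphism are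
   given by a relation and an involution on natural numbers. *)
Section Diagrams.
Local Open Scope nat_scope.

Section NatDiagram.
Variables (n : nat) (e : rel nat) (s : nat -> nat).
Hypotheses (s_le : forall v, (v <= n) -> (s v <= n)) (sK : involutive s)
  (s_e : forall v w, e (s v) (s w) = e v w).

Definition nat_sigma_fun (v : 'I_n.+1) : 'I_n.+1 :=
  Ordinal (s_le (ltn_ord v) : (s v < n.+1)).

Lemma nat_sigma_inj : injective nat_sigma_fun.
Proof. by move=> v w /(congr1 val) /(inv_inj sK) /val_inj. Qed.

Definition nat_edge : rel 'I_n.+1 := fun v w => e v w.

Lemma nat_sigma_edge v w :
  nat_edge (perm nat_sigma_inj v) (perm nat_sigma_inj w) = nat_edge v w.
Proof. by rewrite !permE; apply: s_e. Qed.

Definition nat_diagram : oriented_diagram := OrientedDiagram nat_sigma_edge.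

End NatDiagram.

(* P(B_k): 2k-3 -> ... -> 3 -> 1 -> 0 <- 2 <- 4 <- ... <- 2k-2 *)
Definition edgeB : rel nat :=
  fun v w => (v == w + 2) || (v == 1) && (w == 0).
Definition sigmaB (v : nat) : nat :=
  if v == 0 then 0 else if odd v then v.+1 else v.-1.

Lemma sigmaB_le k v : v <= (k.-1).*2 -> sigmaB v <= (k.-1).*2.
Proof.
rewrite /sigmaB; case: eqP => // _; case: ifP => [ov|_ h]; last first.
  exact: leq_trans (leq_pred v) h.
by rewrite leq_eqVlt => /predU1P [ev|//]; rewrite ev odd_double in ov.
Qed.

Lemma sigmaBK : involutive sigmaB.
Proof.
case=> [//|v]; rewrite /sigmaB /=; case ov: (odd v) => /=; rewrite ?ov //.
by case: v ov.
Qed.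

Lemma sigmaB_edge v w : edgeB (sigmaB v) (sigmaB w) = edgeB v w.
Proof.
rewrite /edgeB /sigmaB.
by case: (eqVneq v 0) => [->|v0]; case: (eqVneq w 0) => [->|w0];
  case ov: (odd v); case ow: (odd w); lia.
Qed.

Definition diagramB (k : nat) : oriented_diagram :=
  nat_diagram (@sigmaB_le k) sigmaBK sigmaB_edge.

(* P(C_n): 0 -> 2, 1 -> 2, n -> n-1 -> ... -> 3 -> 2 *)
Definition edgeC : rel nat :=
  fun v w => (v < 2) && (w == 2) || (2 <= w) && (v == w + 1).
Definition sigmaC (v : nat) : nat :=
  match v with 0 => 1 | 1 => 0 | _ => v end.

Lemma sigmaC_le n (hn : 3 <= n) v : v <= n -> sigmaC v <= n.
Proof. by case: v => [|[|v]] //= _; apply: leq_trans hn. Qed.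

Lemma sigmaCK : involutive sigmaC.
Proof. by case=> [|[|v]]. Qed.

Lemma sigmaC_edge v w : edgeC (sigmaC v) (sigmaC w) = edgeC v w.
Proof. by case: v w => [|[|v]] [|[|w]]. Qed.

Definition diagramC (n : nat) (hn : 3 <= n) : oriented_diagram :=
  nat_diagram (sigmaC_le hn) sigmaCK sigmaC_edge.

(* P(F_4): 4 -> 2 -> 0 <- 1 <- 3 and 0 -> 5 *)
Definition edgeF : rel nat :=
  fun v w => (v, w) \in [:: (4, 2); (2, 0); (1, 0); (3, 1); (0, 5)].
Definition sigmaF (v : nat) : nat :=
  match v with 1 => 2 | 2 => 1 | 3 => 4 | 4 => 3 | _ => v end.

Lemma sigmaF_le v : v <= 5 -> sigmaF v <= 5.
Proof. by case: v => [|[|[|[|[|v]]]]]. Qed.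

Lemma sigmaFK : involutive sigmaF.
Proof. by case=> [|[|[|[|[|v]]]]]. Qed.

Lemma sigmaF_edge v w : edgeF (sigmaF v) (sigmaF w) = edgeF v w.
Proof.
by case: v w => [|[|[|[|[|v]]]]] [|[|[|[|[|w]]]]]; rewrite /edgeF !inE.
Qed.

Definition diagramF : oriented_diagram :=
  nat_diagram sigmaF_le sigmaFK sigmaF_edge.

Inductive BCF_diagram : oriented_diagram -> Prop :=
| BCF_B k : 2 <= k -> BCF_diagram (diagramB k)
| BCF_C n (hn : 3 <= n) : BCF_diagram (diagramC hn)
| BCF_F4 : BCF_diagram diagramF.

End Diagrams.

(* A left module over a K-algebra A is an lmodType A; the field
   K acts on it through c |-> c%:A. *)

Section Modules.
Variables (K : fieldType) (A : algType K).

Definition fin_dim (M : lmodType A) : Prop :=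
  exists (n : nat) (b : 'I_n -> M), forall m : M,
    exists c : 'I_n -> K, m = \sum_i (c i)%:A *: b i.

Definition mod_iso (M N : lmodType A) : Prop :=
  exists f : {linear M -> N}, bijective f.

(* Extensions 0 -> Y -> E -> X -> 0, representing the elements of Ext^1(X, Y),
   up to the usual equivalence. *)
Record extension (X Y : lmodType A) := Extension {
  ext_mid : lmodType A;
  ext_in : {linear Y -> ext_mid};
  ext_out : {linear ext_mid -> X};
  ext_in_inj : injective ext_in;
  ext_out_surj : forall x, exists e, ext_out e = x;
  ext_exact : forall e, ext_out e = 0 <-> exists y, ext_in y = e }.

Definition ext_equiv X Y (E F : extension X Y) : Prop :=
  exists h : {linear ext_mid E -> ext_mid F},
    (forall y, h (ext_in E y) = ext_in F y) /\
    (forall e, ext_out F (h e) = ext_out E e).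

Section SplitExtension.
Variables X Y : lmodType A.

Definition split_in (y : Y) : (Y * X)%type := (y, 0).
Fact split_in_linear : linear split_in.
Proof. by move=> a y z; congr (_, _); rewrite /= scaler0 addr0. Qed.
HB.instance Definition _ :=
  GRing.isLinear.Build A Y (Y * X)%type _ split_in split_in_linear.

Definition split_out (e : (Y * X)%type) : X := e.2.
Fact split_out_linear : linear split_out. Proof. by []. Qed.
HB.instance Definition _ :=
  GRing.isLinear.Build A (Y * X)%type X _ split_out split_out_linear.

Fact split_in_inj : injective split_in. Proof. by move=> y z []. Qed.
Fact split_out_surj x : exists e, split_out e = x. Proof. by exists (0, x). Qed.
Fact split_exact e : split_out e = 0 <-> exists y, split_in y = e.
Proof.
by split=> [|[y <-]] //; case: e => y x /= ->; exists y.
Qed.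

Definition split_extension : extension X Y :=
  @Extension X Y (Y * X)%type split_in split_out
    split_in_inj split_out_surj split_exact.

End SplitExtension.

Definition Ext1_eq0 (X Y : lmodType A) : Prop :=
  forall E : extension X Y, ext_equiv E (split_extension X Y).

Definition rigid (T : lmodType A) : Prop := Ext1_eq0 T T.

Definition in_add (T X : lmodType A) : Prop :=
  exists (n : nat) (Y : lmodType A),
    mod_iso (X * Y)%type {ffun 'I_n -> T}.

Definition maximal_rigid (T : lmodType A) : Prop :=
  rigid T /\
  forall X : lmodType A, fin_dim X -> rigid (X * T)%type -> in_add T X.

Definition indecomposable (X : lmodType A) : Prop :=
  (exists x : X, x != 0) /\
  forall Y Z : lmodType A, mod_iso X (Y * Z)%type ->
    (forall y : Y, y = 0) \/ (forall z : Z, z = 0).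

(* T is the direct sum of the family Ts, with injections i and projections p. *)
Definition is_direct_sum (n : nat) (Ts : 'I_n -> lmodType A) (T : lmodType A) :
    Prop :=
  exists (i : forall j, {linear Ts j -> T}) (p : forall j, {linear T -> Ts j}),
    [/\ forall j x, p j (i j x) = x,
        forall j k x, j != k -> p k (i j x) = 0
      & forall t, t = \sum_j i j (p j t)].

Definition basic (T : lmodType A) : Prop :=
  exists (n : nat) (Ts : 'I_n -> lmodType A),
    [/\ is_direct_sum Ts T, forall j, indecomposable (Ts j)
      & forall j k, mod_iso (Ts j) (Ts k) -> j = k].

Record alg_aut := AlgAut {
  aut_fun : {lrmorphism A -> A};
  aut_inv_fun : {lrmorphism A -> A};
  aut_funK : cancel aut_fun aut_inv_fun;
  aut_inv_funK : cancel aut_inv_fun aut_fun }.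

Definition aut_inv (phi : alg_aut) : alg_aut :=
  AlgAut (aut_inv_funK phi) (aut_funK phi).

Definition aut_comp (phi psi : alg_aut) : alg_aut :=
  @AlgAut (aut_fun phi \o aut_fun psi) (aut_inv_fun psi \o aut_inv_fun phi)
    (can_comp (aut_funK phi) (aut_funK psi))
    (can_comp (aut_inv_funK psi) (aut_inv_funK phi)).

(* The twisted module: a acts as phi^-1(a) acts on M. *)
Definition twist (phi : alg_aut) (M : lmodType A) : Type := M.

Section Twist.
Variables (phi : alg_aut) (M : lmodType A).

HB.instance Definition _ := GRing.Zmodule.on (twist phi M).

Definition twist_scale (a : A) (m : twist phi M) : twist phi M :=
  aut_inv_fun phi a *: (m : M).

Fact twist_scaleA a b m :
  twist_scale a (twist_scale b m) = twist_scale (a * b) m.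
Proof. by rewrite /twist_scale scalerA -rmorphM. Qed.
Fact twist_scale1 : left_id 1 twist_scale.
Proof. by move=> m; rewrite /twist_scale rmorph1 scale1r. Qed.
Fact twist_scaleDr : right_distributive twist_scale +%R.
Proof. by move=> a m n; rewrite /twist_scale scalerDr. Qed.
Fact twist_scaleDl m : {morph twist_scale^~ m : a b / a + b}.
Proof. by move=> a b; rewrite /twist_scale rmorphD scalerDl. Qed.
HB.instance Definition _ := GRing.Zmodule_isLmodule.Build A (twist phi M)
  twist_scaleA twist_scale1 twist_scaleDr twist_scaleDl.

End Twist.

Definition equivariant (phi : alg_aut) (T : lmodType A) : Prop :=
  mod_iso (twist phi T) T.

(* A-A-bimodules on which K acts centrally, i.e. modules over A^e *)
Record bimodule := Bimodule {
  bimod_left :> lmodType A;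
  ract : bimod_left -> A -> bimod_left;
  ractDl : forall m n a, ract (m + n) a = ract m a + ract n a;
  ractDr : forall m a b, ract m (a + b) = ract m a + ract m b;
  ract1 : forall m, ract m 1 = m;
  ractM : forall m a b, ract m (a * b) = ract (ract m a) b;
  ractZ : forall a m b, ract (a *: m) b = a *: ract m b;
  ract_scalar : forall m (c : K), ract m c%:A = c%:A *: m }.

Record bimod_hom (M N : bimodule) := BimodHom {
  bimod_fun :> {linear M -> N};
  bimod_fun_ract : forall m a, bimod_fun (ract m a) = ract (bimod_fun m) a }.

Definition bimod_iso (M N : bimodule) : Prop :=
  exists f : bimod_hom M N, bijective f.

Definition surj_fun (U V : Type) (f : U -> V) : Prop :=
  forall v, exists u, f u = v.

Definition projective (P : bimodule) : Prop :=
  forall (M N : bimodule) (p : bimod_hom M N) (f : bimod_hom P N),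
    surj_fun p -> exists g : bimod_hom P M, forall x, p (g x) = f x.

(* A projective cover is a surjection from a projective bimodule which is
   essential, i.e. any homomorphism into P that stays surjective after
   composition with it is already surjective. *)
Definition projective_cover (P M : bimodule) (f : bimod_hom P M) : Prop :=
  [/\ projective P, surj_fun f
    & forall (N : bimodule) (g : bimod_hom N P),
        surj_fun (fun x => f (g x)) -> surj_fun g].

(* N is isomorphic to Omega_{A^e}(M), the kernel of a projective cover of M. *)
Definition is_syzygy (M N : bimodule) : Prop :=
  exists (P : bimodule) (f : bimod_hom P M) (g : bimod_hom N P),
    [/\ projective_cover f, injective g
      & forall x, f x = 0 <-> exists y, g y = x].

(* N is isomorphic to Omega_{A^e}^n(M). *)
Fixpoint is_nth_syzygy (n : nat) (M N : bimodule) : Prop :=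
  if n is n'.+1 then exists2 L, is_syzygy M L & is_nth_syzygy n' L N
  else bimod_iso M N.

Definition regular_bimod : bimodule.
Proof.
refine (@Bimodule A^o (fun x a => (x : A) * a) _ _ _ _ _ _).
- by move=> m n a; rewrite mulrDl.
- by move=> m a b; rewrite mulrDr.
- by move=> m; rewrite mulr1.
- by move=> m a b; rewrite mulrA.
- by move=> a m b; rewrite -[a *: _]/(a * _) -mulrA.
- by move=> m c; rewrite -[RHS]/(c%:A * _) -scalerAl mul1r -scalerAr mulr1.
Defined.

Definition twist_bimod (phi : alg_aut) (M : bimodule) : bimodule.
Proof.
refine (@Bimodule (twist phi M) (@ract M) _ _ _ _ _ _).
- exact: ractDl.
- exact: ractDr.
- exact: ract1.
- exact: ractM.
- by move=> a m b; apply: ractZ.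
- move=> m c; rewrite ract_scalar -[RHS]/(aut_inv_fun phi c%:A *: (m : M)).
  by rewrite linearZ /= rmorph1.
Defined.

Definition linear_form : {pred A -> K^o} := fun f => `[< linear f >].

Fact linear_form_zmod_closed : zmod_closed linear_form.
Proof.
split=> [|f g /asboolP hf /asboolP hg]; apply/asboolP => c x y.
  by rewrite scaler0 addr0.
by rewrite -![(f - g) _]/(f _ - g _) hf hg scalerBr opprD addrACA.
Qed.
HB.instance Definition _ :=
  GRing.isZmodClosed.Build (A -> K^o) linear_form linear_form_zmod_closed.

Definition dual : Type := {f : A -> K^o | f \in linear_form}.
HB.instance Definition _ := SubChoice.on dual.
HB.instance Definition _ := [SubChoice_isSubZmodule of dual by <:].

Lemma dualP (f : dual) : linear (val f).
Proof. exact/asboolP/(valP f). Qed.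

Fact dual_lact_subproof a (f : dual) : (fun x => val f (x * a)) \in linear_form.
Proof.
by apply/asboolP => c x y; rewrite mulrDl -scalerAl; apply: dualP.
Qed.

Fact dual_ract_subproof (f : dual) a : (fun x => val f (a * x)) \in linear_form.
Proof.
by apply/asboolP => c x y; rewrite mulrDr -scalerAr; apply: dualP.
Qed.

(* (a f)(x) = f (x a) and (f a)(x) = f (a x) *)
Definition dual_lact a (f : dual) : dual := 
  exist _ (fun x => val f (x * a)) (dual_lact_subproof a f).
Definition dual_ract (f : dual) a : dual := 
  exist _ (fun x => val f (a * x)) (dual_ract_subproof f a).

Lemma dual_eqP (f g : dual) : (forall x, val f x = val g x) -> f = g.
Proof. by move=> h; apply/val_inj/funext. Qed.

Lemma dualD (f : dual) x y : val f (x + y) = val f x + val f y.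
Proof. by have := dualP f 1 x y; rewrite !scale1r. Qed.

Lemma dualZ (f : dual) c x : val f (c *: x) = c *: val f x.
Proof.
have f0 : val f 0 = 0 by apply: (addrI (val f 0)); rewrite -dualD !addr0.
by have := dualP f c x 0; rewrite f0 !addr0.
Qed.

Fact dual_lactA a b f : dual_lact a (dual_lact b f) = dual_lact (a * b) f.
Proof. by apply: dual_eqP => x; rewrite /= mulrA. Qed.
Fact dual_lact1 : left_id 1 dual_lact.
Proof. by move=> f; apply: dual_eqP => x; rewrite /= mulr1. Qed.
Fact dual_lactDr : right_distributive dual_lact +%R.
Proof. by move=> a f g; apply: dual_eqP. Qed.
Fact dual_lactDl f : {morph dual_lact^~ f : a b / a + b}.
Proof.
move=> a b; apply: dual_eqP => x.
by rewrite -[LHS]/(val f (x * (a + b))) mulrDr dualD.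
Qed.
HB.instance Definition _ := GRing.Zmodule_isLmodule.Build A dual
  dual_lactA dual_lact1 dual_lactDr dual_lactDl.

Definition dual_bimod : bimodule.
Proof.
refine (@Bimodule dual dual_ract _ _ _ _ _ _).
- by move=> f g a; apply: dual_eqP.
- move=> f a b; apply: dual_eqP => x.
  by rewrite -[LHS]/(val f ((a + b) * x)) mulrDl dualD.
- by move=> f; apply: dual_eqP => x; rewrite /= mul1r.
- by move=> f a b; apply: dual_eqP => x; rewrite /= mulrA.
- by move=> a f b; apply: dual_eqP => x; rewrite /= mulrA.
- move=> f c; apply: dual_eqP => x.
  by rewrite /= -scalerAl mul1r -scalerAr mulr1.
Defined.

(* Hom_K(A, K) is isomorphic to A with the left action twisted by eta^-1. *)
Definition is_nakayama (eta : alg_aut) : Prop :=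
  bimod_iso dual_bimod (twist_bimod (aut_inv eta) regular_bimod).

End Modules.

(* Main.v *)
(* Let sigma be the automorphism of the diagram, so that tau = sigma on A, and write c' for
   the arrow of the mesh relation sum c c' = 0; then c'' = sigma c.

   For modules X, Y, the group Ext^1(X, Y) is the middle cohomology of
     (+)_v Hom(X_v, Y_v) -> (+)_c Hom(X_(src c), Y_(tgt c)) -> (+)_v Hom(X_(tau v), Y_v),
   and the trace pairing identifies the dual of this complex with the one for (Y, X'), where
   X' is the twist of X by c |-> - sigma c, an involution.  So if T is rigid then so is
   T' (+) T; if T is maximal rigid then T' lies in add T, and T' is isomorphic to T by
   Krull-Schmidt.

   It remains to see that gamma agrees with c |-> - sigma c up to an inner automorphism.
   A Nakayama automorphism gives a linear form f with f (x a) = f (eta a x).  In the start of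
   the resolution, P2 = (+)_v A e_v (x) e_(tau v) A -> P1 -> P0 -> A, an element of ker d2 is
   seen through f as an operator z with z (c u) = - sigma c * z u.  A generator z of
   Omega^3 = mu A also satisfies z (u * eta^-1 a) = z u * mu^-1 a.  So q = z 1 satisfies
   q * gamma^-1 c = - sigma c * q, and freeness of the generator makes q invertible. *)
Require Import Defs.
From HB Require Import structures.
From mathcomp Require Import all_boot all_algebra fingroup perm.
From mathcomp Require Import boolp functions finmap monalg.

Set Implicit Arguments.
Unset Strict Implicit.
Unset Printing Implicit Defensive.

Import GRing.Theory.
Local Open Scope ring_scope.

(** The three families enter through [sigma] being an involution: then [c |-> - sigma c] squares to
    the identity, which lets the duality lead from (T, T) through (T, T') and (T', T') to (T', T).
    The harder half is to read the generator of the third syzygy. Nondegeneracy of [f] makes a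
    tensor x (x) y the same thing as the finite rank operator [u |-> f (x u) y], so equality of
    tensors is pointwise equality. Since [f (a x) = f (x * eta^-1 a)], left multiplication by [a]
    turns into precomposition with right multiplication by [eta^-1 a]; this couples [eta] with [mu].
    The component of [d2 w] at [c'] becomes [w (c u) + sigma c * w u], and this is the origin of the
    sign. Two facts make [q] a unit. The generator is free, so [q] is left regular. The generator is
    also a finite sum of tensors, so [q A] has finite dimension and [q] is algebraic over [K]; a
    left regular algebraic element is invertible. *)

(** * Linear maps and kernels *)

Section LinearPack.
Variables (R : nzRingType) (M N : lmodType R) (f : M -> N).

(** The linearity proof is an argument, so that one instance declaration turns every function proved
    linear into a bundled linear map. *)
Definition linear_pack_fun of linear f := f.
Variable f_linear : linear f.
HB.instance Definition _ :=
  GRing.isLinear.Build R M N _ (linear_pack_fun f_linear) f_linear.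
Definition linear_pack : {linear M -> N} := linear_pack_fun f_linear.
End LinearPack.

Lemma can_linear (R : nzRingType) (M N : lmodType R) (f : {linear M -> N}) g :
  cancel f g -> cancel g f -> linear g.
Proof. by move=> fK gK a x y; rewrite -{1}[x]gK -{1}[y]gK -linearP fK. Qed.

Section KernelModule.
Variables (R : nzRingType) (M N : lmodType R) (f : {linear M -> N}).

Definition ker_pred : {pred M} := fun x => f x == 0.
Lemma ker_predE x : (x \in ker_pred) = (f x == 0). Proof. by []. Qed.
Fact ker_pred_submod : submod_closed ker_pred.
Proof.
split=> [|a x y]; first by rewrite ker_predE linear0.
by rewrite !ker_predE linearP => /eqP -> /eqP ->; rewrite scaler0 addr0.
Qed.
HB.instance Definition _ := GRing.isSubmodClosed.Build R M ker_pred
  ker_pred_submod.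

Definition ker_mod : Type := {x : M | x \in ker_pred}.
HB.instance Definition _ := SubChoice.on ker_mod.
HB.instance Definition _ := [SubChoice_isSubLmodule of ker_mod by <:].

Lemma ker_modP (x : ker_mod) : f (val x) = 0.
Proof. exact/eqP/(valP x). Qed.

Lemma ker_mod_sub x : f x = 0 -> x \in ker_pred.
Proof. by move=> h; rewrite ker_predE h eqxx. Qed.
End KernelModule.

Section LinearFun.
Variables (R : nzRingType) (M N : lmodType R) (f : M -> N).
Hypothesis lf : linear f.

Lemma linear_fun0 : f 0 = 0.
Proof. exact: (linear0 (linear_pack lf)). Qed.

Lemma linear_funD : {morph f : x y / x + y}.
Proof. exact: (linearD (linear_pack lf)). Qed.

Lemma linear_funB : {morph f : x y / x - y}.
Proof. exact: (linearB (linear_pack lf)). Qed.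

Lemma linear_funZ a x : f (a *: x) = a *: f x.
Proof. by have := lf a x 0; rewrite linear_fun0 !addr0. Qed.

Lemma linear_fun_sum (I : Type) (s : seq I) (P : pred I) (F : I -> M) :
  f (\sum_(i <- s | P i) F i) = \sum_(i <- s | P i) f (F i).
Proof. exact: (big_morph f linear_funD linear_fun0). Qed.
End LinearFun.

(** * Coordinates of finite-dimensional modules *)

Section Coordinates.
Variables (K : fieldType) (A : algType K).

Definition klinear (X Y : lmodType A) (h : X -> Y) : Prop :=
  {morph h : x y / x + y} /\ forall (k : K) x, h (k%:A *: x) = k%:A *: h x.

Record coords (X : lmodType A) (n : nat) := Coords {
  cmap : 'cV[K]_n -> X;
  cinv : X -> 'cV[K]_n;
  cmapD : {morph cmap : u v / u + v};
  cmapZ : forall k u, cmap (k *: u) = k%:A *: cmap u;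
  cmapK : cancel cmap cinv;
  cinvK : cancel cinv cmap }.

Lemma scalarAC (X : lmodType A) (k : K) (a : A) (x : X) :
  a *: (k%:A *: x) = k%:A *: (a *: x).
Proof. by rewrite !scalerA -scalerAl mul1r -scalerAr mulr1. Qed.

Lemma scalarAM (X : lmodType A) (k l : K) (x : X) :
  k%:A *: (l%:A *: x) = (k * l)%:A *: x.
Proof. by rewrite scalerA -scalerAl mul1r scalerA. Qed.

Lemma scalarAZ (X : lmodType A) (k : K) (a : A) (x : X) :
  (k *: a) *: x = k%:A *: (a *: x).
Proof. by rewrite scalerA -scalerAl mul1r. Qed.

Lemma scalarAD (X : lmodType A) (k l : K) (x : X) :
  (k + l)%:A *: x = k%:A *: x + l%:A *: x.
Proof. by rewrite !scalerDl. Qed.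

(* A spanning family of minimal size is a basis. *)
Lemma fin_dim_coords (X : lmodType A) : fin_dim X -> exists n, inhabited (coords X n).
Proof.
move=> fX.
pose P n := exists b : 'I_n -> X, forall m : X,
    exists c : 'I_n -> K, m = \sum_i (c i)%:A *: b i.
have exP : exists n, `[< P n >] by case: fX => n [b hb]; exists n; apply/asboolP;
  exists b.
case: (ex_minnP exP) => n /asboolP [b hb] nmin; exists n.
pose phi (u : 'cV[K]_n) : X := \sum_i (u i 0)%:A *: b i.
have phiD : {morph phi : u v / u + v}.
  by move=> u v; rewrite -big_split; apply: eq_bigr => i _; rewrite mxE scalarAD.
have phiZ k u : phi (k *: u) = k%:A *: phi u.
  by rewrite scaler_sumr; apply: eq_bigr => i _; rewrite mxE scalarAM.
have phi_surj x : exists u, phi u = x.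
  have [c ->] := hb x; exists (\col_i c i).
  by apply: eq_bigr => i _; rewrite mxE.
have phi0 u : phi u = 0 -> u = 0.
  move=> pu; apply/eqP/negPn/negP => /eqP nu.
  have [j nj] : exists j, u j 0 != 0.
    apply/existsP; apply: contrapT => /negP; rewrite negb_exists => /forallP h.
    by apply: nu; apply/colP => j; rewrite mxE; apply/eqP/negPn/h.
  case: n => [|n] in b hb nmin @phi phiD phiZ phi_surj u pu nu j nj *;
    first by case: j nj.
  suff : `[< P n >] by move/nmin; rewrite ltnn.
  apply/asboolP; exists (b \o lift j) => m.
  have [v <-] := phi_surj m.
  (* Subtracting this multiple of the relation [u] clears coordinate [j], so the other [n] vectors
     still span, against minimality. *)
  pose w := v - (v j 0 / u j 0) *: u.
  have -> : phi v = phi w.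
    have {1}-> : v = w + (v j 0 / u j 0) *: u by rewrite subrK.
    by rewrite phiD phiZ pu scaler0 addr0.
  exists (fun i => w (lift j i) 0); rewrite {1}/phi (bigD1_ord j) //=.
  by rewrite !mxE divfK // subrr scale0r scale0r add0r.
have phi_inj : injective phi.
  move=> u v e; apply/eqP; rewrite -subr_eq0; apply/eqP/phi0.
  by rewrite phiD -scaleN1r phiZ e scaleN1r scaleNr scale1r subrr.
have [psi psiK] := choice phi_surj.
constructor; apply: (@Coords X n phi psi phiD phiZ _ psiK) => u.
by apply: phi_inj; rewrite psiK.
Qed.

Section CoordsTheory.
Variables (X : lmodType A) (n : nat) (cX : coords X n).

Lemma cmap_sum (I : Type) (s : seq I) (F : I -> 'cV[K]_n) :
  cmap cX (\sum_(i <- s) F i) = \sum_(i <- s) cmap cX (F i).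
Proof.
apply: (big_morph (cmap cX) (cmapD cX)).
by rewrite -[0](scale0r 0) cmapZ scale0r scale0r.
Qed.

Lemma cmapB : {morph cmap cX : u v / u - v}.
Proof.
move=> u v; rewrite cmapD; congr (_ + _).
by rewrite -[- v]scaleN1r cmapZ !scaleN1r.
Qed.

Lemma cinvD : {morph cinv cX : x y / x + y}.
Proof. by move=> x y; rewrite -{1}[x](cinvK cX) -{1}[y](cinvK cX) -cmapD cmapK. Qed.

Lemma cinvZ (k : K) x : cinv cX (k%:A *: x) = k *: cinv cX x.
Proof. by rewrite -{1}[x](cinvK cX) -cmapZ cmapK. Qed.

Lemma cinv0 : cinv cX 0 = 0.
Proof. by have := cinvZ 0 0; rewrite !scale0r. Qed.
End CoordsTheory.

Section Matrices.
Variables (X Y : lmodType A) (n m : nat) (cX : coords X n) (cY : coords Y m).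

Definition mat_of (h : X -> Y) : 'M[K]_(m, n) :=
  \matrix_(i, j) cinv cY (h (cmap cX (delta_mx j 0))) i 0.

Lemma mat_ofP h : klinear h -> forall u, h (cmap cX u) = cmap cY (mat_of h *m u).
Proof.
move=> [hD hZ] u; have h0 : h 0 = 0 by have := hZ 0 0; rewrite !scale0r.
rewrite -[LHS](cinvK cY); congr cmap.
rewrite [u in LHS]matrix_sum_delta; under eq_bigr do rewrite big_ord1.
rewrite cmap_sum (big_morph h hD h0) (big_morph _ (cinvD cY) (cinv0 cY)).
apply/colP=> i; rewrite mxE summxE; apply: eq_bigr => j _.
by rewrite cmapZ hZ cinvZ !mxE mulrC.
Qed.

Lemma mat_eqP (M N : 'M[K]_(m, n)) :
  (forall u, cmap cY (M *m u) = cmap cY (N *m u)) -> M = N.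
Proof.
move=> h; apply/matrixP => i j.
have /(can_inj (cmapK cY)) /colP /(_ i) := h (delta_mx j 0).
by rewrite -!colE !mxE.
Qed.
End Matrices.

Section MatrixRep.
Variables (X : lmodType A) (n : nat) (cX : coords X n).

Definition crep (a : A) : 'M[K]_n := mat_of cX cX (fun x => a *: x).

Lemma klinear_scale (a : A) : klinear (fun x : X => a *: x).
Proof. by split=> [x y|k x]; rewrite ?scalerDr ?scalarAC. Qed.

Lemma crepE a u : a *: cmap cX u = cmap cX (crep a *m u).
Proof. exact: mat_ofP (klinear_scale a) u. Qed.

Lemma crepM a b : crep (a * b) = crep a *m crep b.
Proof.
by apply: (mat_eqP (cY := cX)) => u; rewrite -crepE -scalerA -mulmxA -!crepE.
Qed.

Lemma crepD a b : crep (a + b) = crep a + crep b.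
Proof.
apply: (mat_eqP (cY := cX)) => u.
by rewrite mulmxDl cmapD -!crepE scalerDl.
Qed.

Lemma crepZ k a : crep (k *: a) = k *: crep a.
Proof.
apply: (mat_eqP (cY := cX)) => u.
by rewrite -scalemxAl cmapZ -!crepE scalarAZ.
Qed.

Lemma crep1 : crep 1 = 1%:M.
Proof. by apply: (mat_eqP (cY := cX)) => u; rewrite -crepE scale1r mul1mx. Qed.
End MatrixRep.

Lemma klinear_linear (X Y : lmodType A) (h : {linear X -> Y}) : klinear h.
Proof. by split=> [x y|k x]; rewrite (linearD, linearZ). Qed.

End Coordinates.

(** * Krull-Schmidt *)

(* Fitting's lemma: split off from the characteristic polynomial the power of 'X dividing it. *)
Lemma fitting_mx (K : fieldType) n (M : 'M[K]_n.+1) :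
  exists p : {poly K}, let E := horner_mx M p in
    [/\ E * E = E, E = 0 -> exists N, N * M = 1
      & E = 1 -> exists k, M ^+ k = 0].
Proof.
have pM := Cayley_Hamilton M.
have p0 : char_poly M != 0 by apply/monic_neq0/char_poly_monic.
have [k [g /implyP/(_ p0) ng def]] := multiplicity_XsubC (char_poly M) 0.
rewrite subr0 in def.
have cop : coprimep g ('X^k) by apply: coprimep_expr; rewrite -['X]subr0 coprimep_XsubC.
have /Bezout_eq1_coprimepP [[u v] /= uv] := cop.
have UV : horner_mx M (u * g) + horner_mx M (v * 'X^k) = 1.
  by rewrite -rmorphD uv rmorph1.
have GX r : horner_mx M (r * (g * 'X^k)) = 0 by rewrite -def rmorphM [X in _ * X]pM mulr0.
exists (u * g); split.
- rewrite -[RHS]mulr1 -[in RHS]UV mulrDr -[X in _ = _ + X]rmorphM.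
  have -> : u * g * (v * 'X^k) = u * v * (g * 'X^k) by rewrite mulrACA.
  by rewrite [X in _ = _ + X]GX addr0.
(* Here [v * 'X^k] takes the value 1 at [M]. For [k > 0] a factor [M] splits off; for [k = 0] one
   has [g (M) = 0] with [g.[0]] nonzero, and solving for the constant term inverts [M]. *)
- move=> E0; move: UV; rewrite E0 add0r rmorphM /= => vX.
  case: k => [|k] in cop uv def GX vX *; last first.
    by exists (horner_mx M (v * 'X^k)); rewrite -vX exprSr !rmorphM /= horner_mx_X mulrA.
  have [h gh] : exists h, g - (g.[0])%:P = h * ('X - 0%:P).
    by apply/factor_theorem; rewrite rootE !hornerE subrr.
  have g0 : g.[0] != 0 by rewrite -rootE.
  exists (- (g.[0])^-1 *: horner_mx M h).
  have := congr1 (horner_mx M) gh.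
  have -> : horner_mx M (g - (g.[0])%:P) = - (g.[0])%:M.
    by rewrite rmorphB /= horner_mx_C; have := GX 1; rewrite mul1r expr0 mulr1 => ->;
      rewrite sub0r.
  rewrite subr0 rmorphM /= horner_mx_X => e.
  by rewrite -scalerAl -e scaleNr scalerN opprK scale_scalar_mx mulVf.
- move=> E1; exists k; have := GX u; rewrite mulrA rmorphM [X in X * _]E1 mul1r.
  by rewrite rmorphXn /= horner_mx_X.
Qed.

Section KrullSchmidt.
Variables (K : fieldType) (A : algType K).
Implicit Types X Y Z : lmodType A.

Lemma mod_iso_sym X Y : mod_iso X Y -> mod_iso Y X.
Proof.
move=> [f [g fK gK]]; exists (linear_pack (can_linear fK gK)).
by exists f.
Qed.

Lemma mod_iso_trans X Y Z : mod_iso X Y -> mod_iso Y Z -> mod_iso X Z.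
Proof.
move=> [f bf] [g bg]; exists (g \o f : {linear _ -> _}); exact: bij_comp bg bf.
Qed.

(** The summands are the kernels of [1 - e] and of [e]; the last two clauses record what becomes of
    [e] when one of them is zero. *)
Lemma split_idempotent X (e : {linear X -> X}) : (forall x, e (e x) = e x) ->
  exists Y Z (f : {linear X -> (Y * Z)%type}), bijective f /\
   (forall x, (f x).1 = 0 -> e x = 0) /\ (forall x, (f x).2 = 0 -> e x = x).
Proof.
move=> ee.
have e'_linear : linear (fun x => x - e x).
  by move=> a x y; rewrite linearP scalerBr opprD addrACA.
pose e' := linear_pack e'_linear.
have e'E x : e' x = x - e x by [].
have ke' x : e x \in ker_pred e' by apply: ker_mod_sub; rewrite e'E ee subrr.
have ke x : e' x \in ker_pred e by apply: ker_mod_sub; rewrite e'E linearB ee subrr.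
pose f x : ker_mod e' * ker_mod e := (Sub (e x) (ke' x), Sub (e' x) (ke x)).
have f_linear : linear f.
  by move=> a x y; congr (_, _); apply: val_inj; rewrite /= linearP.
exists (ker_mod e'), (ker_mod e), (linear_pack f_linear); split.
  exists (fun yz => val yz.1 + val yz.2) => [x|[y z]]; first by rewrite /= addrC subrK.
  have ey : e (val y) = val y by apply/eqP; rewrite eq_sym -subr_eq0 -e'E ker_modP.
  have ez : e (val z) = 0 by apply: ker_modP.
  congr (_, _); apply: val_inj; rewrite /= linearD ?ey ?ez ?addr0 //.
  by rewrite e'E ey subrr add0r e'E ez subr0.
split=> x /(congr1 val) /= h; first exact: h.
by apply/eqP; rewrite eq_sym -subr_eq0; apply/eqP.
Qed.

Lemma indecomposable_idempotent X (e : X -> X) : indecomposable X ->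
  linear e -> (forall x, e (e x) = e x) ->
  (forall x, e x = 0) \/ (forall x, e x = x).
Proof.
move=> [_ iX] le ee.
have [Y [Z [f [bf [f1 f2]]]]] := @split_idempotent X (linear_pack le) ee.
have [|h|h] := iX Y Z; first by exists f.
  by left=> x; apply: f1; apply: h.
by right=> x; apply: f2; apply: h.
Qed.

(** The Fitting idempotent is a polynomial in the matrix of [f], so it commutes with the action of
    [A] and is an endomorphism of the module; indecomposability makes it 0 or 1. *)
Lemma fitting X (f : X -> X) : fin_dim X -> indecomposable X -> linear f ->
  bijective f \/ exists k, forall x, iter k f x = 0.
Proof.
move=> /fin_dim_coords [n [c]] iX lf.
have kf : klinear f by apply: (@klinear_linear _ _ X X (linear_pack lf)).
have [[x nx] _] := iX.
case: n c => [|n] c.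
  by case/eqP: nx; rewrite -(cinvK c x) -[RHS](cinvK c); congr cmap; apply/colP=> -[].
have fE := mat_ofP c c kf; set M := mat_of c c f in fE.
have iterE k u : iter k f (cmap c u) = cmap c (M ^+ k *m u).
  elim: k => [|k IH]; first by rewrite expr0 mul1mx.
  by rewrite iterS IH fE exprS mulmxA.
have [p [EE E0 E1]] := fitting_mx M.
set E := horner_mx M p in EE E0 E1.
have cE a : crep c a *m E = E *m crep c a.
  apply: comm_mx_horner; apply: (mat_eqP (cY := c)) => u.
  by rewrite -!mulmxA -crepE -!fE -crepE (linear_funZ lf).
pose e x := cmap c (E *m cinv c x).
have le : linear e.
  move=> a y z; rewrite /e (cinvD c) mulmxDr cmapD; congr (_ + _).
  by rewrite crepE mulmxA cE -mulmxA -{1}[y](cinvK c) crepE cmapK.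
have ee y : e (e y) = e y by rewrite /e cmapK mulmxA [E *m E]EE.
have eE u : e (cmap c u) = cmap c (E *m u) by rewrite /e cmapK.
have [e0|e1] := indecomposable_idempotent iX le ee.
  left; have [|N NM] := E0.
    apply: (mat_eqP (cY := c)) => u; rewrite -eE e0 mul0mx.
    by rewrite -[0 : 'cV_ _](cinv0 c) cinvK.
  exists (fun y => cmap c (N *m cinv c y)) => y.
    by rewrite -{1}[y](cinvK c) fE cmapK mulmxA [N *m M]NM mul1mx cinvK.
  by rewrite fE mulmxA [M *m N](mulmx1C NM) mul1mx cinvK.
right; have [|k Mk] := E1.
  by apply: (mat_eqP (cY := c)) => u; rewrite -eE e1 mul1mx.
exists k => y; rewrite -[y](cinvK c) iterE Mk mul0mx.
by rewrite -[0 : 'cV_ _](cinv0 c) cinvK.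
Qed.

(** The inverse is the geometric series of [f], cut off at [k]. *)
Lemma nilpotent_sub_bij X (f : X -> X) k : linear f ->
  (forall x, iter k f x = 0) -> bijective (fun x => x - f x).
Proof.
move=> lf nf.
have sumE n x : \sum_(i < n) (iter i f x) - f (\sum_(i < n) iter i f x) = x - iter n f x.
  have -> : f (\sum_(i < n) iter i f x) = \sum_(i < n) iter i.+1 f x by exact:
    (linear_fun_sum lf).
  rewrite -sumrB; elim: n => [|n IH]; first by rewrite big_ord0 subrr.
  by rewrite big_ord_recr /= IH addrA subrK.
exists (fun x => \sum_(i < k) iter i f x) => x; last by rewrite sumE nf subr0.
have iB n : iter n f (x - f x) = iter n f x - iter n.+1 f x.
  by elim: n => // n IH; rewrite iterS IH (linear_funB lf).
rewrite (eq_bigr (fun i : 'I_k => iter i f x - iter i.+1 f x)) => [|i _]; last exact: iB.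
have : \sum_(i < k) (iter i f x - iter i.+1 f x) = x - iter k f x.
  elim: k {nf} => [|n IH]; first by rewrite big_ord0 subrr.
  by rewrite big_ord_recr /= IH addrA subrK.
by rewrite nf subr0.
Qed.

(* The endomorphism ring of a finite-dimensional indecomposable module is local. *)
Lemma bijective_summand X (I : Type) (s : seq I) (f : I -> X -> X) (g : X -> X) :
  fin_dim X -> indecomposable X -> (forall i, linear (f i)) ->
  linear g -> bijective g -> (forall x, g x = \sum_(i <- s) f i x) ->
  exists i, bijective (f i).
Proof.
move=> fX iX lf; elim: s g => [|i s IH] g lg bg gE.
  have [[x nx] _] := iX; case/eqP: nx; apply: (bij_inj bg).
  by rewrite !gE !big_nil.
have [h gK hK] := bg; pose G := linear_pack lg.
have lh : linear h := can_linear (f := G) gK hK.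
have lhf : linear (h \o f i) by move=> a x y; rewrite /= lf lh.
have [bhf|[k nk]] := fitting fX iX lhf.
  exists i; apply: (eq_bij (bij_comp bg bhf)) => x /=; exact: hK.
(* With [h] inverse to [g], the rest of the sum is [g - f i = g (1 - h f i)]; it is again bijective,
   so the induction continues with [s]. *)
have b1 := nilpotent_sub_bij lhf nk.
have e : (g \o (fun x => x - h (f i x))) =1 (fun x => \sum_(j <- s) f j x).
  move=> x; rewrite /= (linear_funB lg) /= hK.
  by rewrite gE big_cons addrC addKr.
apply: (IH (fun x => \sum_(j <- s) f j x)).
- by move=> a x y; rewrite scaler_sumr -big_split; apply: eq_bigr => j _; apply: lf.
- exact: eq_bij (bij_comp bg b1) _ e.
- by [].
Qed.

(** With [h] inverse to [g \o f], the map [f \o h \o g] is an idempotent of [Y]. It is nonzero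
    because [X] is, hence the identity, and [h \o g] inverts [f]. *)
Lemma indecomposable_summand X Y (f : {linear X -> Y}) (g : {linear Y -> X}) :
  indecomposable X -> indecomposable Y -> bijective (g \o f) -> mod_iso X Y.
Proof.
move=> [[x nx] _] iY [h hK Kh].
have lgf : linear (g \o f) by move=> a y z; rewrite /= !linearP.
have lh : linear h := can_linear (f := linear_pack lgf) hK Kh.
have le : linear (f \o h \o g) by move=> a y z; rewrite /= linearP lh linearP.
have [y|e0|e1] := indecomposable_idempotent iY le.
- by rewrite /= [g (f _)](Kh _).
- case/eqP: nx; have := e0 (f x); rewrite /= [h (g (f x))](hK x) => fx.
  by rewrite -[x]hK /= fx linear0 (linear_fun0 lh).
- by exists f; exists (h \o g) => y; [apply: hK | apply: e1].
Qed.

End KrullSchmidt.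

(** * Twisted modules and uniqueness of decompositions *)

Section TwistModules.
Variables (K : fieldType) (A : algType K) (phi : alg_aut A).
Implicit Types X Y Z T : lmodType A.

Lemma twist_scaleE X (a : A) (x : X) :
  a *: (x : twist phi X) = (aut_inv_fun phi a *: x : X) :> X.
Proof. by []. Qed.

Lemma twist_linear X Y (f : X -> Y) :
  linear f -> linear (f : twist phi X -> twist phi Y).
Proof. by move=> lf a x y; apply: lf. Qed.

Lemma untwist_linear X Y (f : X -> Y) :
  linear (f : twist phi X -> twist phi Y) -> linear f.
Proof.
move=> lf a x y; have := lf (aut_fun phi a) x y.
by rewrite !twist_scaleE aut_funK.
Qed.

Lemma fin_dim_twist X : fin_dim X -> fin_dim (twist phi X).
Proof.
move=> [n [b hb]]; exists n, b => m; have [c ->] := hb m; exists c.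
apply: eq_bigr => i _.
by rewrite twist_scaleE -[(c i)%:A in RHS]/(c i *: 1) linearZ /= rmorph1.
Qed.

Lemma indecomposable_twist X : indecomposable X -> indecomposable (twist phi X).
Proof.
move=> [[x nx] iX]; split; first by exists x.
move=> Y Z [f [g fK gK]].
pose f' (x : X) : twist (aut_inv phi) Y * twist (aut_inv phi) Z := f x.
have f'_linear : linear f'.
  move=> a y z; rewrite /f' -[a in LHS](aut_funK phi).
  exact: (linearP f (aut_fun phi a) y z).
have [|h|h] := iX (twist (aut_inv phi) Y) (twist (aut_inv phi) Z).
- by exists (linear_pack f'_linear); exists g.
- by left.
by right.
Qed.

End TwistModules.

Section Basic.
Variables (K : fieldType) (A : algType K).
Implicit Types X Y Z T : lmodType A.

Lemma fin_dim_surj X Y (f : {linear X -> Y}) :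
  fin_dim X -> (forall y, exists x, f x = y) -> fin_dim Y.
Proof.
move=> [n [b hb]] sf; exists n, (f \o b) => y.
have [x <-] := sf y; have [c ->] := hb x; exists c.
by rewrite linear_sum; apply: eq_bigr => i _; rewrite linearZ.
Qed.

(** Every twisted summand turns out to be isomorphic to some [Ts k]. Since [T] is basic the index
    map is injective, hence a permutation, and the isomorphisms of the summands add up to one of
    [T]. *)
Lemma twist_in_add_equivariant (phi : alg_aut A) T :
  fin_dim T -> basic T -> in_add T (twist phi T) -> equivariant phi T.
Proof.
move=> fT [n [Ts [[i [p [pi pi0 ip]]] iTs nTs]]] [m [Y [F [G FK GK]]]].
have fTs j : fin_dim (Ts j).
  by apply: (fin_dim_surj (f := p j) fT) => x; exists (i j x).
have lG : linear G := can_linear FK GK.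
have li j : linear (i j : twist phi (Ts j) -> twist phi T).
  exact/twist_linear/linearP.
have lp j : linear (p j : twist phi T -> twist phi (Ts j)).
  exact/twist_linear/linearP.
pose inc j (x : twist phi (Ts j)) : {ffun 'I_m -> T} := F ((i j x : twist phi T), 0).
pose prj j (t : {ffun 'I_m -> T}) : twist phi (Ts j) := p j (G t).1.
have linc j : linear (inc j).
  move=> a x y; rewrite /inc -linearP; congr (F _); congr (_, _).
    exact: li.
  by rewrite /= scaler0 addr0.
have lprj j : linear (prj j).
  by move=> a x y; rewrite /prj lG; apply: lp.
pose emb (l : 'I_m) (t : T) : {ffun 'I_m -> T} := [ffun l' => if l' == l then t else 0].
have lemb l : linear (emb l).
  move=> a x y; apply/ffunP => l'; rewrite !ffunE; case: eqP => // _.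
  by rewrite scaler0 addr0.
have ex_iso j : exists k, mod_iso (twist phi (Ts j)) (Ts k).
  (* The identity of the twisted summand is the sum over [(k, l)] of [dn \o up], passing through
     [Ts k] inside the [l]-th copy of [T]; as the endomorphism ring is local, one of these
     composites is bijective. *)
  pose up (k : 'I_n) (l : 'I_m) (x : twist phi (Ts j)) : Ts k := p k (inc j x l).
  pose dn (k : 'I_n) (l : 'I_m) (x : Ts k) : twist phi (Ts j) := prj j (emb l (i k x)).
  have lup k l : linear (up k l).
    by move=> a x y; rewrite /up linc !ffunE linearP.
  have ldn k l : linear (@dn k l).
    by move=> a x y; rewrite /dn linearP lemb lprj.
  have [||||kl bkl] := @bijective_summand _ _ (twist phi (Ts j)) _
      (enum {: 'I_n * 'I_m}) (fun kl x => dn kl.1 kl.2 (up kl.1 kl.2 x)) id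
      (fin_dim_twist _ (fTs j)) (indecomposable_twist _ (iTs j)).
  - by move=> kl a x y; rewrite lup ldn.
  - by [].
  - by exists id.
  - move=> x; rewrite big_enum /= -(pair_big_dep xpredT (fun _ _ => true)
      (fun k l => dn k l (up k l x))) exchange_big /=.
    have {1}-> : x = prj j (inc j x) by rewrite /prj /inc FK pi.
    have {1}-> : inc j x = \sum_l emb l (inc j x l).
      apply/ffunP => l; rewrite sum_ffunE (bigD1 l) //= ffunE eqxx big1 ?addr0 //.
      by move=> l' /negPf ne; rewrite ffunE eq_sym ne.
    rewrite (linear_fun_sum (lprj j)); apply: eq_bigr => l _.
    rewrite {1}[inc j x l]ip (linear_fun_sum (lemb l)) (linear_fun_sum (lprj j)).
    by [].
  exists kl.1.
  exact: (@indecomposable_summand _ _ _ _ (linear_pack (lup kl.1 kl.2))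
    (linear_pack (@ldn kl.1 kl.2)) (indecomposable_twist _ (iTs j)) (iTs kl.1)).
have [s hs] := choice ex_iso.
have s_inj : injective s.
  move=> j k e; apply: nTs.
  have hk := hs k; rewrite -e in hk.
  have [f [g fK gK]] := mod_iso_trans (hs j) (mod_iso_sym hk).
  exists (linear_pack (untwist_linear (linearP f))); by exists g.
have [r rK sK] := injF_bij s_inj.
pose f j := projT1 (cid (hs j)).
have hg j : exists g, cancel (f j) g /\ cancel g (f j).
  by have [g ? ?] := projT2 (cid (hs j)); exists g.
pose g j := projT1 (cid (hg j)).
have fK j : cancel (f j) (g j) := proj1 (projT2 (cid (hg j))).
have gK j : cancel (g j) (f j) := proj2 (projT2 (cid (hg j))).
have lg j : linear (g j) := can_linear (fK j) (gK j).
have pD j (x y : T) : p j (x + y) = p j x + p j y by rewrite linearD.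
have p_sum j (F' : forall k, Ts k) : p j (\sum_k i k (F' k)) = F' j.
  rewrite linear_sum (bigD1 j) //= pi big1 ?addr0 // => k kj; exact: pi0.
have lPhi : linear (fun t : twist phi T => \sum_j i (s j) (f j (p j t)) : T).
  move=> a x y; rewrite scaler_sumr -big_split; apply: eq_bigr => j _.
  by rewrite lp !linearP.
exists (linear_pack lPhi).
exists (fun t : T => \sum_j i j (g j (p (s j) t))) => t; rewrite /= /linear_pack_fun.
  rewrite [RHS]ip; apply: eq_bigr => j _.
  rewrite linear_sum (bigD1 j) //= pi big1 ?addr0 ?fK // => k kj.
  by apply: pi0; rewrite (inj_eq s_inj).
rewrite [RHS]ip [RHS](reindex_inj s_inj); apply: eq_bigr => j _ /=.
by rewrite [p j _](p_sum j (fun k => g k (p (s k) t))) gK.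
Qed.
End Basic.

(** * Extensions and derivations *)

(* Ext^1(X, Y) is the first Hochschild cohomology of A with values in Hom_K(X, Y). *)
Section Derivations.
Variables (K : fieldType) (A : algType K).
Implicit Types X Y : lmodType A.

Record derivation X Y (D : A -> X -> Y) : Prop := Derivation {
  derD : forall a b x, D (a + b) x = D a x + D b x;
  derZ : forall (k : K) a x, D (k *: a) x = k%:A *: D a x;
  der_klinear : forall a, klinear (D a);
  derM : forall a b x, D (a * b) x = a *: D b x + D a (b *: x) }.

Definition inner_derivation X Y (D : A -> X -> Y) : Prop :=
  exists h, klinear h /\ forall a x, D a x = a *: h x - h (a *: x).

Definition derivations_inner X Y : Prop :=
  forall D : A -> X -> Y, derivation D -> inner_derivation D.

Lemma klinear0 X Y (h : X -> Y) : klinear h -> h 0 = 0.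
Proof. by move=> [_ hZ]; have := hZ 0 0; rewrite !scale0r. Qed.

Lemma klinear_section X Y (f : {linear X -> Y}) : fin_dim Y ->
  (forall y, exists x, f x = y) -> exists s, klinear s /\ forall y, f (s y) = y.
Proof.
move=> /fin_dim_coords [n [c]] sf.
have [b hb] := choice (fun i : 'I_n => sf (cmap c (delta_mx i 0))).
exists (fun y => \sum_i (cinv c y i 0)%:A *: b i); split; first split.
- move=> x y; rewrite -big_split; apply: eq_bigr => i _.
  by rewrite (cinvD c) mxE scalarAD.
- move=> k x; rewrite scaler_sumr; apply: eq_bigr => i _.
  by rewrite (cinvZ c) mxE scalarAM.
move=> y; rewrite linear_sum -[RHS](cinvK c) [in RHS](matrix_sum_delta (cinv c y)).
under [in RHS]eq_bigr do rewrite big_ord1.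
by rewrite (cmap_sum c); apply: eq_bigr => i _; rewrite linearZ cmapZ /= hb.
Qed.

(** A K-linear section [s] of the extension fails to be A-linear by a derivation [D]. If [D] is
    inner, given by [h], then [s - i \o h] is an A-linear section. *)
Lemma Ext1_of_derivations X Y :
  fin_dim X -> derivations_inner X Y -> Ext1_eq0 X Y.
Proof.
move=> fX dXY [M i p i_inj p_surj ex].
have [s [sK ps]] := klinear_section fX p_surj.
have pi y : p (i y) = 0 by apply/ex; exists y.
have exD (ax : A * X) : exists y, i y = ax.1 *: s ax.2 - s (ax.1 *: ax.2).
  by apply/ex; rewrite linearB linearZ /= !ps subrr.
have [D' hD'] := choice exD; pose D a x := D' (a, x).
have hD a x : i (D a x) = a *: s x - s (a *: x) := hD' (a, x).
have [|h [hK hD2]] := dXY D.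
  split.
  - move=> a b x; apply: i_inj; rewrite linearD !hD !scalerDl (proj1 sK) opprD.
    by rewrite addrACA.
  - move=> k a x; apply: i_inj; rewrite linearZ /= !hD !(scalarAZ k a) (proj2 sK).
    by rewrite scalerBr.
  - move=> a; split=> [x y|k x]; apply: i_inj; rewrite ?linearD ?linearZ /= !hD.
      by rewrite scalerDr !(proj1 sK) !scalerDr opprD addrACA.
    by rewrite !scalarAC !(proj2 sK) scalarAC scalerBr.
  - move=> a b x; apply: i_inj; rewrite linearD linearZ /= !hD scalerBr !scalerA.
    by rewrite addrA subrK.
pose s' x := s x - i (h x).
have ls' : linear s'.
  move=> a x y; rewrite /s' (proj1 sK) (proj1 hK) linearD opprD addrACA; congr (_ + _).
  have -> : s (a *: x) = a *: s x - i (D a x) by rewrite hD subKr.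
  rewrite hD2 linearB linearZ /= opprB addrA scalerBr.
  by rewrite addrAC addrK.
have psx x : p (s' x) = x by rewrite linearB /= ps pi subr0.
have exr e : exists y, i y = e - s' (p e) by apply/ex; rewrite linearB /= psx subrr.
have [r hr] := choice exr.
have lr : linear r.
  move=> a x y; apply: i_inj; rewrite linearP !hr linearP ls' scalerBr opprD.
  by rewrite addrACA -!scalerBr.
have lh : linear (fun e => (r e, p e) : Y * X) by move=> a x y; rewrite lr linearP.
have ri y : r (i y) = y by apply: i_inj; rewrite hr pi (linear_fun0 ls') subr0.
exists (linear_pack lh); split=> [y|//].
by congr (_, _); [exact: ri | exact: pi].
Qed.

Section DerivationExtension.
Variables (X Y : lmodType A) (D : A -> X -> Y) (dD : derivation D).

(** The underlying group of the extension in which [a] acts on [Y * X] as an upper triangular matrix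
    with corner [D a]; the Leibniz rule is associativity of this action. *)
Definition der_ext of derivation D : Type := (Y * X)%type.
Local Notation M := (der_ext dD).
HB.instance Definition _ := GRing.Zmodule.on M.

Definition der_ext_scale (a : A) (m : M) : M := (a *: m.1 + D a m.2, a *: m.2).

Fact der_ext_scaleA a b m :
  der_ext_scale a (der_ext_scale b m) = der_ext_scale (a * b) m.
Proof.
rewrite /der_ext_scale /= (derM dD) !scalerA scalerDr scalerA.
by rewrite addrA.
Qed.
Fact der_ext_scale1 : left_id 1 der_ext_scale.
Proof.
move=> [y x]; rewrite /der_ext_scale /= !scale1r.
(* The Leibniz rule for [1 * 1] forces [D 1 = 0]. *)
have := derM dD 1 1 x; rewrite mulr1 !scale1r => /(congr1 (fun u => u - D 1 x)).
by rewrite subrr addrK => <-; rewrite addr0.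
Qed.
Fact der_ext_scaleDr : right_distributive der_ext_scale +%R.
Proof.
move=> a m n; rewrite /der_ext_scale /= (proj1 (der_klinear dD a)) !scalerDr.
by congr (_, _); rewrite addrACA.
Qed.
Fact der_ext_scaleDl m : {morph der_ext_scale^~ m : a b / a + b}.
Proof.
move=> a b; rewrite /der_ext_scale /= (derD dD) !scalerDl.
by congr (_, _); rewrite addrACA.
Qed.
HB.instance Definition _ := GRing.Zmodule_isLmodule.Build A M
  der_ext_scaleA der_ext_scale1 der_ext_scaleDr der_ext_scaleDl.

Lemma der_ext_scaleE (a : A) (m : M) : a *: m = (a *: m.1 + D a m.2, a *: m.2).
Proof. by []. Qed.

Definition der_in (y : Y) : M := (y, 0).
Fact der_in_linear : linear der_in.
Proof.
move=> a y z; rewrite der_ext_scaleE /= (klinear0 (der_klinear dD a)) addr0 scaler0.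
by congr (_, _); rewrite addr0.
Qed.
Definition der_out (m : M) : X := m.2.
Fact der_out_linear : linear der_out. Proof. by []. Qed.

Fact der_in_inj : injective (linear_pack der_in_linear). Proof. by move=> y z []. Qed.
Fact der_out_surj x : exists m, linear_pack der_out_linear m = x.
Proof. by exists (0, x). Qed.
Fact der_exact m : linear_pack der_out_linear m = 0 <->
  exists y, linear_pack der_in_linear y = m.
Proof.
split=> [|[y <-]] //; case: m => y x /= h; exists y.
by have -> : x = 0 := h.
Qed.

Definition der_extension : extension X Y :=
  @Extension K A X Y M _ _ der_in_inj der_out_surj der_exact.

(** Compatibility with both ends gives an equivalence the form [(y, x) |-> (y + g x, x)]; its
    A-linearity at [(0, x)] says that [D] is the inner derivation of [g]. *)
Lemma der_split : ext_equiv der_extension (split_extension X Y) -> inner_derivation D.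
Proof.
move=> [h [hi ho]]; pose g x := (h ((0, x) : M)).1.
have hE (y : Y) (x : X) : (h ((y, x) : M)) = (y + g x, x).
  have -> : (y, x) = ((y, 0) : M) + ((0, x) : M) :> M.
    by congr (_, _); rewrite /= ?addr0 ?add0r.
  rewrite linearD -[h (y, 0)]/(h (ext_in der_extension y)) hi /split_in.
  congr (_, _); rewrite /= add0r; exact: (ho (0, x)).
have DE a x : D a x + g (a *: x) = a *: g x.
  have := linear_funZ (linearP h) a ((0, x) : M);
    rewrite der_ext_scaleE /= scaler0 add0r hE.
  by rewrite hE add0r => -[].
have gD : {morph g : x y / x + y}.
  by move=> x y; rewrite /g -[_ + _ in RHS]/((h _ + h _).1) -linearD /=; congr (h _).1;
    congr (_, _); rewrite /= ?addr0.
exists g; split; last by move=> a x; rewrite -DE addrK.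
split=> // k x; rewrite -DE.
(* Derivations vanish on scalars, and this makes [g] homogeneous over [K]. *)
suff -> : D k%:A x = 0 by rewrite add0r.
rewrite (derZ dD); have := der_ext_scale1 ((0, x) : M).
by rewrite /der_ext_scale /= scaler0 add0r => -[-> _]; rewrite scaler0.
Qed.
End DerivationExtension.

Lemma derivations_of_Ext1 X Y : Ext1_eq0 X Y -> derivations_inner X Y.
Proof. move=> h D dD; exact: (der_split (h (der_extension dD))). Qed.
End Derivations.

Section DerivationsProduct.
Variables (K : fieldType) (A : algType K).
Implicit Types X Y : lmodType A.

Lemma derivations_inner_prodr X Y1 Y2 :
  derivations_inner X Y1 -> derivations_inner X Y2 ->
  derivations_inner X (Y1 * Y2)%type.
Proof.
move=> h1 h2 D dD.
have d1 : derivation (fun a x => (D a x).1).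
  split=> [a b x|k a x|a|a b x]; rewrite ?(derD dD) ?(derZ dD) ?(derM dD) //.
  by have [dDa dZ] := der_klinear dD a; split=> [x y|k x]; rewrite ?dDa ?dZ.
have d2 : derivation (fun a x => (D a x).2).
  split=> [a b x|k a x|a|a b x]; rewrite ?(derD dD) ?(derZ dD) ?(derM dD) //.
  by have [dDa dZ] := der_klinear dD a; split=> [x y|k x]; rewrite ?dDa ?dZ.
have [f [[fD fZ] fE]] := h1 _ d1; have [g [[gD gZ] gE]] := h2 _ d2.
exists (fun x => (f x, g x)); split; first split=> [x y|k x].
- by rewrite fD gD.
- by rewrite fZ gZ.
by move=> a x; rewrite [LHS]surjective_pairing fE gE.
Qed.

Lemma derivations_inner_prodl X1 X2 Y :
  derivations_inner X1 Y -> derivations_inner X2 Y ->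
  derivations_inner (X1 * X2)%type Y.
Proof.
move=> h1 h2 D dD.
have pairD (x1 y1 : X1) (x2 y2 : X2) : (x1 + y1, x2 + y2) = (x1, x2) + (y1, y2) by [].
have pairZ (a : A) (x1 : X1) (x2 : X2) : (a *: x1, a *: x2) = a *: (x1, x2) by [].
have d1 : derivation (fun a x => D a (x, 0 : X2)).
  split=> [a b x|k a x|a|a b x]; rewrite ?(derD dD) ?(derZ dD) ?(derM dD) //.
    have [dDa dZ] := der_klinear dD a; split=> [x y|k x].
      by rewrite -dDa -pairD addr0.
    by rewrite -dZ -pairZ scaler0.
  by rewrite -pairZ scaler0.
have d2 : derivation (fun a x => D a (0 : X1, x)).
  split=> [a b x|k a x|a|a b x]; rewrite ?(derD dD) ?(derZ dD) ?(derM dD) //.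
    have [dDa dZ] := der_klinear dD a; split=> [x y|k x].
      by rewrite -dDa -pairD addr0.
    by rewrite -dZ -pairZ scaler0.
  by rewrite -pairZ scaler0.
have [f [[fD fZ] fE]] := h1 _ d1; have [g [[gD gZ] gE]] := h2 _ d2.
exists (fun x => f x.1 + g x.2); split; first split=> [x y|k x].
- by rewrite fD gD addrACA.
- by rewrite fZ gZ scalerDr.
move=> a [x1 x2]; rewrite scalerDr opprD addrACA -fE -gE.
by rewrite -(proj1 (der_klinear dD a)) -pairD addr0 add0r.
Qed.

End DerivationsProduct.

(** * Derivations of mesh algebras *)

(** Sub-bimodules are predicates, so that derivations with values in M / N can be stated as
    congruences modulo [N] without a quotient bimodule. *)
Record sub_bimod (K : fieldType) (A : algType K) (M : bimodule A) (N : M -> Prop) :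
  Prop :=
  SubBimod {
    sub_bimod0 : N 0;
    sub_bimodB : forall x y, N x -> N y -> N (x - y);
    sub_bimodZ : forall a x, N x -> N (a *: x);
    sub_bimod_ract : forall x a, N x -> N (ract x a) }.

Section PathDerivation.
Variables (n : nat) (E : choiceType) (Q : quiver 'I_n.+1 E) (K : fieldType).
Local Notation KQ := (path_alg Q K).
Local Notation bas := (path_basis K).

Lemma path_alg_ind (P : KQ -> Prop) :
  (forall f g, P f -> P g -> P (f + g)) -> (forall k f, P f -> P (k *: f)) ->
  (forall p, P (bas p)) -> forall f, P f.
Proof.
move=> PD PZ Pb f; rewrite (path_algE f).
elim/big_ind: _ => [||p _]; last exact/PZ/Pb.
- by rewrite -[0](scale0r (bas (path0 Q ord0))); apply: PZ.
- exact: PD.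
Qed.

Lemma path_basisM p q : bas p * bas q = basis_mul K p q :> KQ.
Proof. exact: path_mulUU. Qed.

Lemma basis_mul0 p q : path_src p != path_tgt q -> bas p * bas q = 0 :> KQ.
Proof.
rewrite path_basisM /basis_mul; case: path_catP => // r -> _.
by rewrite eqxx.
Qed.

Lemma basis_mulE p q r : path_src p = path_tgt q ->
  val r = ((val p).1, (val p).2 ++ (val q).2) -> bas p * bas q = bas r :> KQ.
Proof.
move=> e er; rewrite path_basisM /basis_mul; case: path_catP => [r' _ er'|]; last first.
  by rewrite e eqxx.
by congr path_basis; apply: val_inj; rewrite er'.
Qed.

Variables (A : algType K) (pi : {lrmorphism KQ -> A}).
Local Notation e v := (pi (bas (path0 Q v))).
Local Notation ar a := (pi (bas (path1 Q a))).

Definition arrows_prod (s : seq E) : A := \prod_(a <- s) ar a.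

Lemma idem_idem v : e v * e v = e v.
Proof. by rewrite -rmorphM (@basis_mulE _ _ (path0 Q v)). Qed.

Lemma idem_orth v w : v != w -> e v * e w = 0.
Proof. by move=> vw; rewrite -rmorphM basis_mul0 ?rmorph0. Qed.

Lemma idem_arr a : e (tgt Q a) * ar a = ar a.
Proof. by rewrite -rmorphM (@basis_mulE _ _ (path1 Q a)). Qed.

Lemma arr_idem a : ar a * e (src Q a) = ar a.
Proof. by rewrite -rmorphM (@basis_mulE _ _ (path1 Q a)). Qed.

Lemma path_class p : pi (bas p) = e (path_tgt p) * arrows_prod (val p).2.
Proof.
case: p => -[v s] ps; rewrite /path_tgt /=.
elim: s v ps => [|a s IH] v ps.
  rewrite /arrows_prod big_nil mulr1; congr (pi (bas _)); exact: val_inj.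
have /andP [/eqP av ps'] : (tgt Q a == v) && is_path Q (src Q a) s := ps.
rewrite -(@basis_mulE (path1 Q a) (exist _ (src Q a, s) ps')) /=; last 2 first.
- by [].
- by rewrite av.
rewrite rmorphM [X in _ * X]IH /arrows_prod big_cons !mulrA arr_idem.
by rewrite -av idem_arr.
Qed.

Lemma arrows_prod_cons a s : arrows_prod (a :: s) = ar a * arrows_prod s.
Proof. exact: big_cons. Qed.

Lemma arrows_prod_cat s t : arrows_prod (s ++ t) = arrows_prod s * arrows_prod t.
Proof. exact: big_cat. Qed.

Variables (M : bimodule A) (m : E -> M).
Hypothesis m_tgt : forall a, e (tgt Q a) *: m a = m a.
Hypothesis m_src : forall a, ract (m a) (e (src Q a)) = m a.

Lemma ract0r (x : M) : ract x 0 = 0.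
Proof.
have := ractDr x 0 0; rewrite addr0 => h; apply: (addrI (ract x 0)).
by rewrite -h addr0.
Qed.

Lemma ract0l a : ract (0 : M) a = 0.
Proof.
have := ractDl (0 : M) 0 a; rewrite addr0 => h; apply: (addrI (ract (0 : M) a)).
by rewrite -h addr0.
Qed.

(** The Leibniz rule along a word: the sum over its letters [a] of the word with [a] replaced by
    [m a]. Idempotents are sent to 0. *)
Fixpoint der_seq (s : seq E) : M :=
  if s is a :: s' then ar a *: der_seq s' + ract (m a) (arrows_prod s') else 0.

Lemma der_seq_cat s t : der_seq (s ++ t) =
  arrows_prod s *: der_seq t + ract (der_seq s) (arrows_prod t).
Proof.
elim: s => [|a s IH] /=; first by rewrite /arrows_prod big_nil scale1r ract0l addr0.
rewrite IH arrows_prod_cat arrows_prod_cons scalerDr scalerA -!addrA.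
by rewrite ractDl ractZ ractM.
Qed.

Lemma der_seq_tgt v s : is_path Q v s -> e v *: der_seq s = der_seq s.
Proof.
case: s => [|a s] /=; first by rewrite scaler0.
case/andP => /eqP <- _.
by rewrite scalerDr scalerA idem_arr -ractZ m_tgt.
Qed.

Lemma arrows_prod_src v s : is_path Q v s -> s != [::] ->
  arrows_prod s * e (last v [seq src Q a | a <- s]) = arrows_prod s.
Proof.
elim: s v => [//|a s IH] v /= /andP [_ ps] _.
rewrite arrows_prod_cons -mulrA; case: s => [|b s] in IH ps *.
  by rewrite /arrows_prod big_nil mul1r /= arr_idem mulr1.
by congr (_ * _); apply: IH.
Qed.

Lemma der_seq_src v s : is_path Q v s ->
  ract (der_seq s) (e (last v [seq src Q a | a <- s])) = der_seq s.
Proof.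
elim: s v => [|a s IH] v /=; first by rewrite ract0l.
case/andP => _ ps; rewrite ractDl ractZ IH //; congr (_ + _).
rewrite -ractM; case: s => [|b s] in IH ps *; last by rewrite arrows_prod_src.
by rewrite /arrows_prod big_nil mul1r ract1 m_src.
Qed.

Definition path_der (f : KQ) : M :=
  \sum_(p <- msupp f) (f@_p)%:A *: der_seq (val p).2.

Lemma path_derw (d : {fset qpath Q}) (f : KQ) : (msupp f `<=` d)%fset ->
  path_der f = \sum_(p <- d) (f@_p)%:A *: der_seq (val p).2.
Proof.
move=> le; apply: big_fset_incl => // p _ /mcoeff_outdom ->.
by rewrite scale0r scale0r.
Qed.

Lemma path_derD : {morph path_der : f g / f + g}.
Proof.
move=> f g; rewrite (path_derw (msuppD_le _ _)).
rewrite (path_derw (fsubsetUl _ (msupp g))) (path_derw (fsubsetUr (msupp f) _)).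
by rewrite -big_split /=; apply: eq_bigr => p _; rewrite mcoeffD scalarAD.
Qed.

Lemma path_derZ k f : path_der (k *: f) = k%:A *: path_der f.
Proof.
rewrite (path_derw (msuppZ_le _ _)) scaler_sumr.
by apply: eq_bigr => p _; rewrite mcoeffZ scalarAM.
Qed.

Lemma path_derB : {morph path_der : f g / f - g}.
Proof.
move=> f g; rewrite path_derD; congr (_ + _).
have -> : - g = (-1) *: g by rewrite scaleN1r.
by rewrite path_derZ !scaleN1r.
Qed.

Lemma path_der_basis p : path_der (bas p) = der_seq (val p).2.
Proof.
rewrite path_basisE (path_derw msuppU_le) big_seq_fset1 mcoeffUU.
by rewrite scale1r scale1r.
Qed.

Lemma path_der0 : path_der 0 = 0.
Proof. by have := path_derZ 0 0; rewrite !scale0r. Qed.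

(** For paths that do not compose both sides vanish, since [der_seq] of a path is fixed by the
    idempotents at its two ends and distinct idempotents are orthogonal. *)
Lemma path_derM_basis p q :
  path_der (bas p * bas q) = pi (bas p) *: path_der (bas q)
    + ract (path_der (bas p)) (pi (bas q)).
Proof.
have pq : e (path_tgt q) *: path_der (bas q) = path_der (bas q).
  by rewrite path_der_basis; apply: der_seq_tgt (valP q).
have pp : ract (path_der (bas p)) (e (path_src p)) = path_der (bas p).
  by rewrite path_der_basis; apply: der_seq_src (valP p).
have [eq_st|ne] := eqVneq (path_src p) (path_tgt q); last first.
  rewrite basis_mul0 // path_der0 -pq -pp scalerA -ractM -!rmorphM.
  by rewrite !basis_mul0 // !rmorph0 scale0r ract0r addr0.
have [r _ er] : exists2 r : qpath Q, path_src p = path_tgt q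
    & val r = ((val p).1, (val p).2 ++ (val q).2).
  by case: (path_cat p q) / (path_catP p q) => [r h er|]; [exists r | rewrite eq_st eqxx].
rewrite (basis_mulE eq_st er) path_der_basis er der_seq_cat -path_der_basis.
rewrite -path_der_basis; congr (_ + _).
  rewrite path_class; case Es: (val p).2 => [|a s].
    have -> : path_tgt p = path_tgt q by rewrite -eq_st /path_src Es.
    by rewrite /arrows_prod big_nil mulr1 scale1r pq.
  have := valP p; rewrite Es /= => /andP [/eqP ea _].
  by rewrite arrows_prod_cons mulrA /path_tgt -ea idem_arr.
by rewrite (path_class q) ractM -eq_st pp.
Qed.

Lemma path_derM f g :
  path_der (f * g) = pi f *: path_der g + ract (path_der f) (pi g).
Proof.
move: f; apply: (@path_alg_ind (fun f => path_der (f * g) = pi f *: path_der g + ract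
  (path_der f) (pi g))) => [f f' IH IH'|k f IH|p].
- rewrite mulrDl (path_derD (f * g)) (path_derD f f') (rmorphD pi f f') scalerDl ractDl.
  by apply: etrans (congr2 +%R IH IH') _; rewrite addrACA.
- rewrite -(scalerAl k f g); apply: etrans (path_derZ k (f * g)) _.
  rewrite (path_derZ k f) ractZ (linearZ_LR pi k f) /=.
  apply: etrans (congr1 ( *:%R _) IH) _; rewrite scalerDr; congr (_ + _).
  by rewrite (scalarAZ k (pi f)).
move: g; apply: (@path_alg_ind (fun g => path_der (bas p * g)
    = pi (bas p) *: path_der g + ract (path_der (bas p)) (pi g))) =>
      [g g' IH IH'|k g IH|q].
- rewrite mulrDr (path_derD (bas p * g)) (path_derD g g') (rmorphD pi g) scalerDr ractDr.
  by apply: etrans (congr2 +%R IH IH') _; rewrite addrACA.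
- rewrite -(scalerAr k (bas p) g); apply: etrans (path_derZ k (bas p * g)) _.
  rewrite (path_derZ k g) (linearZ_LR pi k g) /=.
  apply: etrans (congr1 ( *:%R _) IH) _; rewrite scalarAC scalerDr; congr (_ + _).
  have -> : k *: pi g = k%:A * pi g by rewrite -scalerAl mul1r.
  by rewrite ractM ract_scalar ractZ.
exact: path_derM_basis.
Qed.

Lemma path_der_idem v : path_der (bas (path0 Q v)) = 0.
Proof. exact: path_der_basis. Qed.

Lemma path_der_arr a : path_der (bas (path1 Q a)) = m a.
Proof. by rewrite path_der_basis /= scaler0 add0r /arrows_prod big_nil ract1. Qed.
End PathDerivation.

(* A presentation by a quiver, which stands for an orbit quiver of Z Delta, and the mesh
   relations; mp_mesh c is the arrow c', mp_vtx and mp_arr are the translation. *)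
Record mesh_presentation (K : fieldType) (A : algType K) := MeshPresentation {
  mp_V : finType;
  mp_C : finType;
  mp_src : mp_C -> mp_V;
  mp_tgt : mp_C -> mp_V;
  mp_mesh : mp_C -> mp_C;
  mp_vtx : mp_V -> mp_V;
  mp_arr : mp_C -> mp_C;
  mp_idem : mp_V -> A;
  mp_gen : mp_C -> A;
  mp_tgt_mesh : forall c, mp_tgt (mp_mesh c) = mp_src c;
  mp_src_mesh : forall c, mp_src (mp_mesh c) = mp_vtx (mp_tgt c);
  mp_meshK : forall c, mp_mesh (mp_mesh c) = mp_arr c;
  mp_vtxK : involutive mp_vtx;
  mp_arrK : involutive mp_arr;
  mp_idemK : forall v, mp_idem v * mp_idem v = mp_idem v;
  mp_idem_orth : forall v w, v != w -> mp_idem v * mp_idem w = 0;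
  mp_idem_sum : \sum_v mp_idem v = 1;
  mp_idem_gen : forall c, mp_idem (mp_tgt c) * mp_gen c = mp_gen c;
  mp_gen_idem : forall c, mp_gen c * mp_idem (mp_src c) = mp_gen c;
  mp_rel : forall v, \sum_(c | mp_tgt c == v) mp_gen c * mp_gen (mp_mesh c) = 0;
  mp_ind : forall P : A -> Prop,
    (forall x y, P x -> P y -> P (x + y)) -> (forall (k : K) x, P x -> P (k *: x)) ->
    (forall v, P (mp_idem v)) -> (forall c x, P x -> P (mp_gen c * x)) ->
    forall x, P x;
  mp_der : forall (M : bimodule A) (N : M -> Prop) (m : mp_C -> M),
    sub_bimod N ->
    (forall c, mp_idem (mp_tgt c) *: m c = m c) ->
    (forall c, ract (m c) (mp_idem (mp_src c)) = m c) ->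
    (forall v, N (\sum_(c | mp_tgt c == v)
       (mp_gen c *: m (mp_mesh c) + ract (m c) (mp_gen (mp_mesh c))))) ->
    exists D : A -> M,
      [/\ forall x y, N (D (x + y) - (D x + D y)),
          forall (k : K) x, N (D (k *: x) - k%:A *: D x),
          forall x y, N (D (x * y) - (x *: D y + ract (D x) y)),
          forall v, N (D (mp_idem v))
        & forall c, N (D (mp_gen c) - m c)] }.

(** * The presentation of the mesh algebras *)

(** As [(i + 1, s z)] and [(i, z)] share an orbit, the translation acts on orbits as the inverse of
    [s]. *)
Lemma orbit_rep_succ (Z : finType) (s : {perm Z}) i z :
  orbit_rep s (i + 1, z) = (s^-1)%g (orbit_rep s (i, z)).
Proof.
rewrite /orbit_rep /= perm_expzS.
have -> : (perm_expz s i * s = s * perm_expz s i)%g.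
  by case: i => k /=; [apply/esym/commuteX | apply/esym/commuteV/commuteX].
by rewrite invMg permM.
Qed.

Section MeshAlgebraPresentation.
Variables (D : oriented_diagram) (K : fieldType).
Hypothesis sigmaK : involutive (sigma D).
Local Notation KQ := (path_alg (orbit_quiver D) K).
Local Notation A := (mesh_alg D K).
Local Notation arrow := (arr D + arr D)%type.

Definition mesh_pi : KQ -> A := @quot_pi K KQ (mesh_ideal D K).

Fact mesh_pi_linear : linear mesh_pi.
Proof.
move=> k x y; apply: etrans (quot_piD (mesh_ideal D K) (k *: x) y) _.
exact: (congr1 (fun u : A => u + mesh_pi y) (quot_piZ (mesh_ideal D K) k x)).
Qed.
Fact mesh_pi_monoid : monoid_morphism mesh_pi.
Proof.
split; first exact: (erefl (quot_one (mesh_ideal D K))).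
exact: (quot_piM (mesh_ideal D K)).
Qed.
HB.instance Definition _ := GRing.isLinear.Build K KQ A _ mesh_pi mesh_pi_linear.
HB.instance Definition _ := GRing.isMonoidMorphism.Build KQ A mesh_pi mesh_pi_monoid.

Definition mesh_idem (v : 'I_(rk D).+1) : A :=
  mesh_pi (path_basis K (path0 (orbit_quiver D) v)).
Definition mesh_gen (c : arrow) : A := mesh_pi (arr_elt K c).
Definition mesh_prime (c : arrow) : arrow := orbit_arr (mesh_arr (0, c)).

Lemma mesh_pi_eq x y : (mesh_pi x = mesh_pi y) <-> x - y \in mesh_ideal_pred (D := D)
  (K := K).
Proof. by split=> [h|h]; apply/(quot_piP (mesh_ideal D K)). Qed.

Lemma mesh_pi_repr (a : A) : mesh_pi (quot_repr a) = a.
Proof. exact: quot_reprK. Qed.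

Lemma mesh_rel_pi v :
  \sum_(c | tgt (orbit_quiver D) c == v) mesh_gen c * mesh_gen (mesh_prime c) = 0.
Proof.
transitivity (mesh_pi (mesh_rel (D := D) K v)).
  by rewrite /mesh_rel (rmorph_sum mesh_pi); apply: eq_bigr => c _;
    rewrite (rmorphM mesh_pi).
rewrite -[RHS](rmorph0 mesh_pi); apply/mesh_pi_eq; rewrite subr0;
  apply/generated_idealP => J _; apply; by exists v.
Qed.

Lemma mesh_alg_ind (P : A -> Prop) :
  (forall x y, P x -> P y -> P (x + y)) -> (forall (k : K) x, P x -> P (k *: x)) ->
  (forall v, P (mesh_idem v)) -> (forall c x, P x -> P (mesh_gen c * x)) ->
  forall x, P x.
Proof.
move=> PD PZ Pe Pg x; rewrite -(mesh_pi_repr x); move: (quot_repr x).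
apply: (@path_alg_ind _ _ _ _ (fun f => P (mesh_pi f))) => [f g Pf Pg'|k f Pf|p].
- by rewrite rmorphD; apply: PD.
- by rewrite linearZ; apply: PZ.
rewrite path_class; case: p => -[v s] /= ps; rewrite /path_tgt /=.
elim: s v ps => [|c s IH] v /=; first by move=> _; rewrite /arrows_prod big_nil mulr1;
  apply: Pe.
case/andP => /eqP <- ps; rewrite arrows_prod_cons mulrA [_ * mesh_pi _]idem_arr.
by rewrite -(arr_idem mesh_pi c) -mulrA; apply: Pg; apply: IH.
Qed.

(** Values on the arrows extend to a derivation modulo [N] as soon as the Leibniz rule sends the
    mesh relations into [N]. The case [N = 0] turns cocycles into derivations; the image of [d2] as
    [N] gives exactness of the resolution. *)
Lemma mesh_alg_der (M : bimodule A) (N : M -> Prop) (m : arrow -> M) :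
  sub_bimod N ->
  (forall c, mesh_idem (tgt (orbit_quiver D) c) *: m c = m c) ->
  (forall c, ract (m c) (mesh_idem (src (orbit_quiver D) c)) = m c) ->
  (forall v, N (\sum_(c | tgt (orbit_quiver D) c == v)
       (mesh_gen c *: m (mesh_prime c) + ract (m c) (mesh_gen (mesh_prime c))))) ->
    exists d : A -> M,
      [/\ forall x y, N (d (x + y) - (d x + d y)),
          forall (k : K) x, N (d (k *: x) - k%:A *: d x),
          forall x y, N (d (x * y) - (x *: d y + ract (d x) y)),
          forall v, N (d (mesh_idem v))
        & forall c, N (d (mesh_gen c) - m c)].
Proof.
move=> Nsub m_tgt m_src m_rel.
have [d0 [[d0M d0B d0D d0Z] d0_idem d0_arr]] : exists d0 : KQ -> M,
    [/\ [/\ forall f g, d0 (f * g) = mesh_pi f *: d0 g + ract (d0 f) (mesh_pi g),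
        {morph d0 : f g / f - g}, {morph d0 : f g / f + g}
        & forall k f, d0 (k *: f) = k%:A *: d0 f],
      forall v, d0 (path_basis K (path0 (orbit_quiver D) v)) = 0
      & forall c, d0 (arr_elt K c) = m c].
  exists (path_der mesh_pi m); split; first split.
  - exact: (path_derM m_tgt m_src).
  - exact: path_derB.
  - exact: path_derD.
  - exact: path_derZ.
  - exact: path_der_idem.
  - exact: path_der_arr.
have d00 : d0 0 = 0 by rewrite -[0](subrr 0) d0B subrr.
have NB := sub_bimodB Nsub.
have N0 x : x \in mesh_ideal_pred (D := D) (K := K) -> N (d0 x).
  (* On the kernel of [mesh_pi] one term of the Leibniz rule drops out, so the elements of this
     kernel sent into [N] form a two-sided ideal. It contains the mesh relations, hence the mesh
     ideal. *)
  move/generated_idealP/(_ (fun y => `[< mesh_pi y = 0 /\ N (d0 y) >])) => h.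
  have {h} /asboolP [] // : `[< mesh_pi x = 0 /\ N (d0 x) >].
  apply: h.
    split; first split.
    - by apply/asboolP; rewrite (rmorph0 mesh_pi) d00; split=> //; apply: sub_bimod0 Nsub.
    - move=> f g /asboolP [f0 Nf] /asboolP [g0 Ng]; apply/asboolP.
      by rewrite (rmorphB mesh_pi) /= f0 g0 subrr d0B; split=> //; apply: NB.
    - move=> a f /asboolP [f0 Nf]; apply/asboolP.
      rewrite (rmorphM mesh_pi) /= f0 mulr0 d0M f0 ract0r addr0; split=> //.
      exact: sub_bimodZ.
    - move=> a f /asboolP [f0 Nf]; apply/asboolP.
      rewrite (rmorphM mesh_pi) /= f0 mul0r d0M f0 scale0r add0r; split=> //.
      exact: sub_bimod_ract.
  move=> _ [v ->]; apply/asboolP; split.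
    rewrite -[RHS](mesh_rel_pi v) (rmorph_sum mesh_pi); apply: eq_bigr => c _.
    by rewrite (rmorphM mesh_pi).
  rewrite /mesh_rel (big_morph d0 d0D d00).
  move: (m_rel v); congr N; apply: eq_bigr => c _.
  by rewrite d0M !d0_arr.
have Neq x y : mesh_pi x = mesh_pi y -> N (d0 x - d0 y).
  by move/mesh_pi_eq/N0; rewrite d0B.
(* Another choice of representatives changes the values only by elements of [N]. *)
exists (fun a => d0 (quot_repr a)); split.
- move=> x y; rewrite -(d0D (quot_repr x)); apply: Neq.
  by rewrite (rmorphD mesh_pi) /= !mesh_pi_repr.
- move=> k x; rewrite -(d0Z k (quot_repr x)); apply: Neq.
  by rewrite (linearZ_LR mesh_pi) /= !mesh_pi_repr.
- move=> x y; have := Neq (quot_repr (x * y)) (quot_repr x * quot_repr y).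
  by rewrite d0M (rmorphM mesh_pi) /= !mesh_pi_repr; apply.
- move=> v; have := Neq (quot_repr (mesh_idem v)) (path_basis K (path0 _ v)).
  by rewrite d0_idem subr0 mesh_pi_repr; apply.
- move=> c; have := Neq (quot_repr (mesh_gen c)) (arr_elt K c).
  by rewrite d0_arr mesh_pi_repr; apply.
Qed.

Lemma mesh_prime_prime c : mesh_prime (mesh_prime c) = ((sigma_dbl D)^-1)%g c.
Proof.
rewrite /mesh_prime orbit_mesh.
have -> : mesh_arr (mesh_arr (0, c)) = (0 + 1, c) by case: c.
by rewrite /orbit_arr orbit_rep_succ orbit_rep0.
Qed.

Lemma sigma_inv_involutive : involutive (sigma D)^-1%g.
Proof. by move=> v; apply: (@perm_inj _ (sigma D));
  rewrite permKV -{1}[v]sigmaK permK. Qed.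

Lemma sigma_dbl_inv_involutive : involutive (sigma_dbl D)^-1%g.
Proof.
have sK : involutive (sigma_dbl D).
  have aK : involutive (@sigma_arr D).
    move=> a; apply: val_inj; rewrite [RHS]surjective_pairing.
    by congr (_, _); apply: sigmaK.
  by move=> [a|a]; rewrite !permE /= aK.
by move=> c; apply: (@perm_inj _ (sigma_dbl D)); rewrite permKV -{1}[c]sK permK.
Qed.

Definition mesh_alg_presentation : mesh_presentation A.
Proof.
apply: (@MeshPresentation K A _ _ (src (orbit_quiver D)) (tgt (orbit_quiver D)) mesh_prime
  (sigma D)^-1%g (sigma_dbl D)^-1%g mesh_idem mesh_gen).
- by move=> c; rewrite orbit_tgt tgt_mesh_arr.
- by move=> c; rewrite orbit_src src_mesh_arr /tau /orbit_vtx orbit_rep_succ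
    -surjective_pairing.
- exact: mesh_prime_prime.
- exact: sigma_inv_involutive.
- exact: sigma_dbl_inv_involutive.
- exact: idem_idem.
- exact: idem_orth.
- by rewrite -(rmorph_sum mesh_pi) -[RHS](rmorph1 mesh_pi).
- exact: idem_arr.
- exact: arr_idem.
- exact: mesh_rel_pi.
- exact: mesh_alg_ind.
- exact: mesh_alg_der.
Defined.
End MeshAlgebraPresentation.

(** The three families enter here: the translation of the orbit quiver has square 1. *)
Lemma BCF_sigma_involutive D : BCF_diagram D -> involutive (sigma D).
Proof.
by case=> [k _|n hn|] v; rewrite !permE; apply: val_inj;
  [apply: sigmaBK | apply: sigmaCK | apply: sigmaFK].
Qed.

(** * Duality of cocycles *)

Section LinearDuality.
Variable K : fieldType.

(** The factor [k] is [l] composed with a pseudo-inverse of [N]: the error of the pseudo-inverse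
    lies in the kernel of [N], where [l] vanishes. *)
Lemma linear_form_factor (U W : vectType K) (N : {linear U -> W}) (l :
  {linear U -> K^o}) :
  (forall u, N u = 0 -> l u = 0) -> exists k : {linear W -> K^o}, forall u, l u = k (N u).
Proof.
move=> lN; pose f := linfun N.
exists (l \o (f^-1)%VF : {linear W -> K^o}) => u /=; apply/eqP.
rewrite -subr_eq0 -linearB /=; apply/eqP/lN; rewrite linearB /=.
have -> : N ((f^-1)%VF (N u)) = N u; last exact: subrr.
have := limg_lfunVK (memv_img f (memvf u)); by rewrite !lfunE.
Qed.

(** Nondegeneracy of the trace pairing, tested on matrix units. *)
Lemma mxtrace_eq n m (M M' : 'M[K]_(n, m)) :
  (forall X : 'M_(m, n), \tr (X *m M) = \tr (X *m M')) -> M = M'.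
Proof.
move=> h; apply/matrixP => i j; have := h (delta_mx j i).
have trE (Z : 'M[K]_(n, m)) : \tr (delta_mx j i *m Z) = Z i j.
  rewrite /mxtrace (bigD1 j) //= big1 ?addr0 => [|k kj];
    rewrite mxE (bigD1 i) //= big1 ?addr0 => [|l li].
  - by rewrite mxE !eqxx mul1r.
  - by rewrite mxE (negPf li) andbF mul0r.
  - by rewrite mxE (negPf kj) mul0r.
  - by rewrite mxE (negPf li) andbF mul0r.
by rewrite !trE.
Qed.

Lemma linear_form_mxtrace (V : finType) n m (k :
  {linear {ffun V -> 'M[K]_(m, n)} -> K^o}) :
  exists kv : V -> 'M_(n, m), forall w, k w = \sum_v \tr (kv v *m w v).
Proof.
pose d v i j : {ffun V -> 'M[K]_(m, n)} := [ffun v' =>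
  if v' == v then delta_mx i j else 0].
exists (fun v => \matrix_(j, i) k (d v i j)) => w.
have {1}-> : w = \sum_v \sum_i \sum_j w v i j *: d v i j.
  apply/ffunP => v; rewrite sum_ffunE (bigD1 v) //= [X in _ = _ + X]big1 ?addr0 =>
    [|v' nv].
    rewrite [LHS]matrix_sum_delta sum_ffunE; apply: eq_bigr => i _.
    rewrite sum_ffunE; apply: eq_bigr => j _.
    by rewrite !ffunE eqxx.
  rewrite sum_ffunE big1 // => i _; rewrite sum_ffunE big1 // => j _.
  by rewrite !ffunE eq_sym (negPf nv) scaler0.
rewrite linear_sum; apply: eq_bigr => v _; rewrite mxtrace_mulC /mxtrace linear_sum.
apply: eq_bigr => i _; rewrite linear_sum mxE; apply: eq_bigr => j _.
by rewrite linearZ /= mxE.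
Qed.
End LinearDuality.

Section CocycleDuality.
Variables (K : fieldType) (A : algType K) (P : mesh_presentation A).
Local Notation e := (@mp_idem K A P).
Local Notation g := (@mp_gen K A P).
Local Notation "c ^'" := (mp_mesh c).
Local Notation src := (@mp_src K A P).
Local Notation tgt := (@mp_tgt K A P).
Local Notation tau := (@mp_vtx K A P).
Local Notation tauA := (@mp_arr K A P).

Record mx_rep (n : nat) (r : A -> 'M[K]_n) : Prop := MxRep {
  mx_repD : {morph r : a b / a + b};
  mx_repZ : forall k a, r (k *: a) = k *: r a;
  mx_repM : forall a b, r (a * b) = r a *m r b;
  mx_rep1 : r 1 = 1%:M }.

Lemma mp_src_arr c : src (tauA c) = tau (src c).
Proof. by rewrite -mp_meshK mp_src_mesh mp_tgt_mesh. Qed.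

Lemma mp_tgt_arr c : tgt (tauA c) = tau (tgt c).
Proof. by rewrite -mp_meshK mp_tgt_mesh mp_src_mesh. Qed.

(** The square of [c |-> c'] is the involution [tauA], so its inverse is its cube
    [c |-> tauA (c')]. *)
Lemma mp_mesh_arr c : (tauA (c^'))^' = c.
Proof. by rewrite -mp_meshK mp_meshK mp_meshK mp_arrK. Qed.

Lemma mp_mesh_inj : injective (@mp_mesh K A P).
Proof. by move=> c d h; rewrite -(mp_mesh_arr c) h mp_mesh_arr. Qed.

Lemma mp_vtx_inj : injective tau. Proof. exact: inv_inj (@mp_vtxK K A P). Qed.

Lemma sum_tgt (R : nmodType) (F : mp_C P -> R) :
  \sum_v \sum_(c | tgt c == v) F c = \sum_c F c.
Proof. by rewrite [RHS](partition_big tgt xpredT). Qed.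

Section Cocycles.
Variables (n m : nat) (r : A -> 'M[K]_n) (s : A -> 'M[K]_m).
Implicit Types th : mp_C P -> 'M[K]_(m, n).

(** The first clause places [th c] in Hom(X_(src c), Y_(tgt c)); the second is the Leibniz rule
    applied to the mesh relation at [v]. *)
Definition cocycle th : Prop :=
  (forall c, s (e (tgt c)) *m th c *m r (e (src c)) = th c) /\
  forall v, \sum_(c | tgt c == v)
    (th c *m r (g (c^')) + s (g c) *m th (c^')) = 0.

(** Commuting with the idempotents makes [H] block diagonal, that is, a family of maps X_v ->
    Y_v. *)
Definition coboundary th : Prop :=
  exists H : 'M[K]_(m, n), (forall v, H *m r (e v) = s (e v) *m H) /\
    forall c, th c = s (g c) *m H - H *m r (g c).

End Cocycles.

(* The functionals t |-> sum_c tr (t c' * th c) identify cocycles th of (s, r') with forms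
   vanishing on coboundaries, i.e. on cocycles, of (r, s). *)
Lemma cocycle_duality n m (r r' : A -> 'M[K]_n) (s : A -> 'M[K]_m) :
  mx_rep r -> mx_rep s ->
  (forall v, r' (e v) = r (e (tau v))) -> (forall c, r' (g c) = - r (g (tauA c))) ->
  (forall th, cocycle r s th -> coboundary r s th) ->
  forall th, cocycle s r' th -> coboundary s r' th.
Proof.
move=> rr rs r'e r'g cob th [th_e th_rel].
have rM := mx_repM rr; have sM := mx_repM rs.
(* Truncation by the idempotents lets [N] and [l] be defined on all families of matrices. *)
pose pr (t : {ffun mp_C P -> 'M[K]_(m, n)}) c := s (e (tgt c)) *m t c *m r (e (src c)).
pose N (t : {ffun mp_C P -> 'M[K]_(m, n)}) : {ffun mp_V P -> 'M[K]_(m, n)} :=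
  [ffun v => \sum_(c | tgt c == v) (pr t c *m r (g (c^')) + s (g c) *m pr t (c^'))].
(* [t (c')] goes from X at [tau (tgt c)] to Y at [src c]. This is opposite to [th c], because X' at
   [tgt c] is X at [tau (tgt c)]. *)
pose l (t : {ffun mp_C P -> 'M[K]_(m, n)}) : K^o := \sum_c \tr (t (c^') *m th c).
have pr_lin c : linear (pr^~ c).
  by move=> k t t'; rewrite /pr !ffunE mulmxDr mulmxDl -scalemxAr -scalemxAl.
have N_lin : linear N.
  move=> k t t'; apply/ffunP => v; rewrite !ffunE scaler_sumr -big_split.
  apply: eq_bigr => c _; rewrite !pr_lin !mulmxDl !mulmxDr -!scalemxAl -!scalemxAr.
  by rewrite scalerDr addrACA.
have l_lin : linear l.
  move=> k t t'; rewrite scaler_sumr -big_split; apply: eq_bigr => c _.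
  by rewrite !ffunE mulmxDl mxtraceD -scalemxAl mxtraceZ.
have l_pr t : l t = \sum_c \tr (pr t (c^') *m th c).
  apply: eq_bigr => c _; rewrite -{1}(th_e c) r'e /pr mp_tgt_mesh mp_src_mesh.
  by rewrite !mulmxA mxtrace_mulC !mulmxA.
(* If [N t = 0] then [pr t] is the coboundary of some [H], and [l t] is the trace of [H] against the
   sum of all the relations satisfied by [th]. Reindexing by [c |-> tauA (c')] matches the two
   halves, and the sign in [r'] makes them cancel. *)
have lN t : N t = 0 -> l t = 0.
  move=> Nt; have [|H [He Hth]] := cob (pr t).
    split=> [c|v]; last by have /ffunP/(_ v) := Nt; rewrite !ffunE.
    rewrite /pr !mulmxA -!sM mp_idemK -!mulmxA -rM mp_idemK.
    by [].
  rewrite l_pr.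
  have tE c : \tr (pr t (c^') *m th c)
      = \tr (H *m (th c *m s (g (c^')))) - \tr (H *m (r (g (c^')) *m th c)).
    by rewrite Hth mulmxBl raddfB /= -mulmxA mxtrace_mulC -!mulmxA.
  rewrite (eq_bigr _ (fun c _ => tE c)) sumrB -!(raddf_sum (@mxtrace K m)) /=
    -!mulmx_sumr.
  apply/eqP; rewrite subr_eq0; apply/eqP; congr (\tr (_ *m _)).
  have : \sum_v \sum_(c | tgt c == v)
      (th c *m s (g (c^')) + r' (g c) *m th (c^')) = 0 by apply: big1 => v _;
        apply: th_rel.
  rewrite sum_tgt big_split /=.
  rewrite [X in _ + X](reindex_inj (h := fun c => tauA (c^'))) /=; last first.
    by move=> c d /(congr1 (@mp_mesh _ _ P)); rewrite !mp_mesh_arr.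
  move/eqP; rewrite addr_eq0 => /eqP ->; rewrite -sumrN; apply: eq_bigr => c _.
  by rewrite r'g mp_arrK mp_mesh_arr mulNmx opprK.
have [k kE] := @linear_form_factor K _ _ (linear_pack N_lin) (linear_pack l_lin) lN.
have [kv kvE] := linear_form_mxtrace k.
(* The adjoint of [N], up to truncation, applied to the coefficients [kv] of [k]. *)
pose Z c := r (g (tauA c)) *m kv (src c) + kv (tgt c) *m s (g c).
have lE t : l t = \sum_c \tr (pr t (c^') *m Z c).
  rewrite [l t]kE kvE.
  transitivity (\sum_v \sum_(c | tgt c == v)
     \tr (kv (tgt c) *m (pr t c *m r (g (c^')) + s (g c) *m pr t (c^')))).
    apply: eq_bigr => v _; rewrite ffunE mulmx_sumr raddf_sum.
    by apply: eq_bigr => c /eqP ->.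
  rewrite sum_tgt.
  under eq_bigr do rewrite mulmxDr raddfD /=.
  under [RHS]eq_bigr do rewrite mulmxDr raddfD /=.
  rewrite !big_split /=; congr (_ + _); last first.
    by apply: eq_bigr => c _; rewrite mulmxA mxtrace_mulC.
  rewrite (reindex_inj mp_mesh_inj) /=; apply: eq_bigr => c _.
  by rewrite mp_tgt_mesh mp_meshK mxtrace_mulC mulmxA.
have thE c : th c = r (e (tau (tgt c))) *m Z c *m s (e (src c)).
  apply: mxtrace_eq => X.
  have := lE [ffun d => if d == c^' then X else 0].
  rewrite /l (bigD1 c) //= big1 => [|d dc]; last first.
    by rewrite ffunE (inj_eq mp_mesh_inj) (negPf dc) mul0mx mxtrace0.
  rewrite ffunE eqxx addr0 => ->.
  rewrite (bigD1 c) //= big1 => [|d dc]; last first.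
    by rewrite /pr ffunE (inj_eq mp_mesh_inj) (negPf dc) mulmx0 !mul0mx mxtrace0.
  rewrite addr0 /pr ffunE eqxx mp_src_mesh mp_tgt_mesh.
  by rewrite -!mulmxA mxtrace_mulC !mulmxA.
(* Since [r'] of an arrow carries a minus sign, both terms of the coboundary of [H] are negative,
   which the sign of [H] compensates. *)
pose H := - \sum_v r (e (tau v)) *m kv v *m s (e v).
have sorth v w : v != w -> s (e v) *m s (e w) = 0.
  by move=> vw; rewrite -sM mp_idem_orth // -[0](scale0r 0) (mx_repZ rs) scale0r.
have rorth v w : v != w -> r (e v) *m r (e w) = 0.
  by move=> vw; rewrite -rM mp_idem_orth // -[0](scale0r 0) (mx_repZ rr) scale0r.
have Hs v : H *m s (e v) = - (r (e (tau v)) *m kv v *m s (e v)).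
  rewrite mulNmx mulmx_suml (bigD1 v) //= big1 ?addr0 => [|w wv].
    by congr (- _); rewrite -[LHS]mulmxA -sM mp_idemK.
  by rewrite -[LHS]mulmxA sorth // mulmx0.
have Hr v : r (e (tau v)) *m H = - (r (e (tau v)) *m kv v *m s (e v)).
  rewrite mulmxN mulmx_sumr (bigD1 v) //= big1 ?addr0 => [|w wv].
    by rewrite !mulmxA -rM mp_idemK.
  by rewrite !mulmxA rorth ?mul0mx // (inj_eq mp_vtx_inj) eq_sym.
exists H; split=> [v|c]; first by rewrite r'e Hs Hr.
have rH : r (g (tauA c)) *m H = - (r (g (tauA c)) *m kv (src c) *m s (e (src c))).
  rewrite -[in LHS](mp_gen_idem (tauA c)) rM mp_src_arr -mulmxA Hr mulmxN !mulmxA.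
  by rewrite -rM -mp_src_arr mp_gen_idem.
have Hsg : H *m s (g c) = - (r (e (tau (tgt c))) *m kv (tgt c) *m s (g c)).
  rewrite -[in LHS](mp_idem_gen c) sM mulmxA Hs mulNmx; congr (- _).
  by rewrite -[LHS]mulmxA -sM mp_idem_gen.
rewrite thE r'g mulNmx rH Hsg !opprK /Z mulmxDr mulmxDl; congr (_ + _).
  by rewrite !mulmxA -rM -mp_tgt_arr mp_idem_gen.
by rewrite mulmxA -[LHS]mulmxA -sM mp_gen_idem.
Qed.

End CocycleDuality.

(** * Cocycles as derivations into Hom_K(X, Y) *)

Section HomBimodule.
Variables (K : fieldType) (A : algType K) (n m : nat).
Variables (r : A -> 'M[K]_n) (s : A -> 'M[K]_m) (rr : mx_rep r) (rs : mx_rep s).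

Definition hom_mx of mx_rep r & mx_rep s : Type := 'M[K]_(m, n).
Local Notation M := (hom_mx rr rs).
HB.instance Definition _ := GRing.Zmodule.on M.

Definition hom_mx_scale (a : A) (t : M) : M := s a *m t.
Fact hom_mx_scaleA a b t : hom_mx_scale a (hom_mx_scale b t) = hom_mx_scale (a * b) t.
Proof. by rewrite /hom_mx_scale (mx_repM rs) mulmxA. Qed.
Fact hom_mx_scale1 : left_id 1 hom_mx_scale.
Proof. by move=> t; rewrite /hom_mx_scale (mx_rep1 rs) mul1mx. Qed.
Fact hom_mx_scaleDr : right_distributive hom_mx_scale +%R.
Proof. by move=> a t u; apply: mulmxDr. Qed.
Fact hom_mx_scaleDl t : {morph hom_mx_scale^~ t : a b / a + b}.
Proof. by move=> a b; rewrite /hom_mx_scale (mx_repD rs); apply: mulmxDl. Qed.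
HB.instance Definition _ := GRing.Zmodule_isLmodule.Build A M
  hom_mx_scaleA hom_mx_scale1 hom_mx_scaleDr hom_mx_scaleDl.

Lemma mx_rep_scalar k (l : nat) (u : A -> 'M[K]_l) : mx_rep u -> u k%:A = k%:M.
Proof. by move=> hu; rewrite (mx_repZ hu) (mx_rep1 hu) scalemx1. Qed.

Definition hom_bimod : bimodule A.
Proof.
refine (@Bimodule K A M (fun (t : M) a => (t *m r a : M)) _ _ _ _ _ _).
- by move=> t u a; apply: mulmxDl.
- by move=> t a b; rewrite (mx_repD rr); apply: mulmxDr.
- by move=> t; rewrite (mx_rep1 rr) mulmx1.
- by move=> t a b; rewrite (mx_repM rr) mulmxA.
- by move=> a t b; rewrite -[LHS]/(s a *m t *m r b) -mulmxA.
- move=> t k; rewrite -[RHS]/(s k%:A *m t) !mx_rep_scalar //.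
  by rewrite mul_mx_scalar mul_scalar_mx.
Defined.
End HomBimodule.

Section CocyclesDerivations.
Variables (K : fieldType) (A : algType K) (P : mesh_presentation A).
Local Notation e := (@mp_idem K A P).
Local Notation g := (@mp_gen K A P).
Local Notation "c ^'" := (mp_mesh c).
Local Notation src := (@mp_src K A P).
Local Notation tgt := (@mp_tgt K A P).

Lemma crep_mx_rep (X : lmodType A) n (cX : coords X n) : mx_rep (crep cX).
Proof. by split; [exact: crepD | exact: crepZ | exact: crepM | exact: crep1]. Qed.

Record mx_der n m (r : A -> 'M[K]_n) (s : A -> 'M[K]_m) (d : A -> 'M[K]_(m, n)) : Prop :=
  MxDer {
    mx_derD : {morph d : a b / a + b};
    mx_derZ : forall k a, d (k *: a) = k *: d a;
    mx_derM : forall a b, d (a * b) = s a *m d b + d a *m r b }.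

Definition mx_inner n m (r : A -> 'M[K]_n) (s : A -> 'M[K]_m) (H : 'M[K]_(m, n)) a :=
  s a *m H - H *m r a.

Section MatrixDerivations.
Variables (n m : nat) (r : A -> 'M[K]_n) (s : A -> 'M[K]_m).
Hypotheses (rr : mx_rep r) (rs : mx_rep s).

Lemma mx_der_sub_inner d H : mx_der r s d -> mx_der r s (fun a => d a - mx_inner r s H a).
Proof.
move=> [dD dZ dM]; rewrite /mx_inner; split=> [a b|k a|a b].
- rewrite dD (mx_repD rr) (mx_repD rs) mulmxDl mulmxDr [RHS]addrACA -opprD.
  by congr (_ - _); rewrite opprD addrACA.
- rewrite dZ (mx_repZ rr) (mx_repZ rs) -scalemxAl -scalemxAr -!scalerBr.
  by [].
- rewrite dM (mx_repM rr) (mx_repM rs) !mulmxBr !mulmxBl !mulmxA !opprB.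
  rewrite [RHS]addrACA; congr (_ + _).
  by rewrite addrC addrA subrK.
Qed.

Lemma cocycle_of_der d : mx_der r s d -> (forall v, d (e v) = 0) ->
  cocycle r s (fun c : mp_C P => d (g c)).
Proof.
move=> [dD dZ dM] de; split=> [c|v].
  rewrite -{2}(mp_gen_idem c) -{2}(mp_idem_gen c) -mulrA !dM !de mul0mx mulmx0 add0r
    addr0.
  by rewrite mulmxA.
have d0 : d 0 = 0 by rewrite -[0](scale0r 0) dZ scale0r.
rewrite -[RHS]d0 -(mp_rel v) (big_morph d dD d0).
by apply: eq_bigr => c _; rewrite dM addrC.
Qed.

(** This is [mp_der] for the bimodule of matrices and [N = 0]; its compatibility condition on the
    mesh relations is the cocycle condition. *)
Lemma der_of_cocycle th : cocycle r s th ->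
  exists d, [/\ mx_der r s d, forall v, d (e v) = 0 & forall c : mp_C P, d (g c) = th c].
Proof.
move=> [th_e th_rel].
have [||||d [dD dZ dM de dg]] := @mp_der K A P (hom_bimod rr rs) (fun t => t = 0) th.
- split=> [//|x y -> ->|a x ->|x a ->]; rewrite ?subrr ?scaler0 //.
  exact: mul0mx.
- move=> c; rewrite -[LHS]/(s _ *m _) -[in LHS]th_e !mulmxA -(mx_repM rs) mp_idemK.
  exact: th_e.
- move=> c; rewrite -[LHS]/(_ *m r _) -[in LHS]th_e -!mulmxA -(mx_repM rr) mp_idemK.
  by rewrite mulmxA th_e.
- move=> v; rewrite -[RHS](th_rel v); apply: eq_bigr => c _; exact: addrC.
exists d; split.
- split=> [a b|k a|a b].
  + exact: subr0_eq (dD a b).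
  + by move/subr0_eq: (dZ k a) => ->; rewrite -[LHS]/(s _ *m _) (mx_rep_scalar _ rs)
    mul_scalar_mx.
  + exact: subr0_eq (dM a b).
- exact: de.
- by move=> c; apply: subr0_eq.
Qed.

(** An inner correction makes [d] vanish on the idempotents, so that its values on the arrows form a
    cocycle. A second correction kills the arrows, and then the derivation is zero because
    idempotents and arrows generate [A]. *)
Lemma mx_der_inner d : (forall th, cocycle r s th -> @coboundary K A P n m r s th) ->
  mx_der r s d -> exists H, forall a, d a = mx_inner r s H a.
Proof.
(* The Leibniz rule for [e v * e w] shows that the inner derivation of [H0] agrees with [d] on every
   idempotent. *)
move=> cob dd; pose H0 := - \sum_w d (e w) *m r (e w).
pose d1 a := d a - mx_inner r s H0 a.
have d1d : mx_der r s d1 by apply: mx_der_sub_inner.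
have d0 : d 0 = 0 by rewrite -[0](scale0r 0) (mx_derZ dd) scale0r.
have d1e v : d1 (e v) = 0.
  have rM := mx_repM rr; have dM := mx_derM dd.
  have dr w : s (e v) *m (d (e w) *m r (e w)) =
      (if v == w then d (e v) *m r (e v) else 0) - d (e v) *m r (e w).
    rewrite mulmxA -[s _ *m _](addrK (d (e v) *m r (e w))) -dM mulmxBl.
    rewrite -mulmxA -rM mp_idemK; congr (_ - _); case: eqVneq => [->|vw].
      by rewrite mp_idemK.
    by rewrite mp_idem_orth // d0 mul0mx.
  have H0r : H0 *m r (e v) = - (d (e v) *m r (e v)).
    rewrite mulNmx mulmx_suml (bigD1 v) //= -mulmxA -rM mp_idemK big1 ?addr0 // => w wv.
    by rewrite -mulmxA -rM mp_idem_orth // -[0 :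
      A](scale0r 0) (mx_repZ rr) scale0r mulmx0.
  have sH0 : s (e v) *m H0 = d (e v) - d (e v) *m r (e v).
    rewrite mulmxN mulmx_sumr (eq_bigr _ (fun w _ => dr w)) sumrB opprB.
    rewrite -mulmx_sumr -(big_morph r (mx_repD rr) (_ : r 0 = 0)); last first.
      by rewrite -[0 : A](scale0r 0) (mx_repZ rr) scale0r.
    rewrite mp_idem_sum (mx_rep1 rr) mulmx1; congr (_ - _).
    by rewrite -big_mkcond (big_pred1 v) // => w; rewrite /= eq_sym.
  by rewrite /d1 /mx_inner sH0 H0r opprK subrK subrr.
have [H1 [H1e H1g]] := cob _ (cocycle_of_der d1d d1e).
exists (H0 + H1) => a.
suff /eqP : d1 a - mx_inner r s H1 a = 0.
  rewrite subr_eq0 subr_eq => /eqP ->.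
  by rewrite addrC /mx_inner mulmxDr mulmxDl opprD addrACA.
have d2d := mx_der_sub_inner H1 d1d.
elim/(@mp_ind K A P): a => [x y hx hy|k x hx|v|c x hx].
- by have := mx_derD d2d x y => ->; rewrite hx hy addr0.
- by have := mx_derZ d2d k x => ->; rewrite hx scaler0.
- by rewrite d1e /mx_inner H1e subrr subr0.
- have := mx_derM d2d (g c) x => ->; rewrite hx mulmx0 add0r.
  by rewrite H1g /mx_inner subrr mul0mx.
Qed.
End MatrixDerivations.

Definition cocycles_bound n m (r : A -> 'M[K]_n) (s : A -> 'M[K]_m) : Prop :=
  forall th, @cocycle K A P n m r s th -> coboundary r s th.

Section Coordinates.
Variables (X Y : lmodType A) (n m : nat) (cX : coords X n) (cY : coords Y m).

Lemma cocycles_of_derivations :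
  derivations_inner X Y -> cocycles_bound (crep cX) (crep cY).
Proof.
move=> dXY th /(der_of_cocycle (crep_mx_rep cX) (crep_mx_rep cY)) [d [dd de dg]].
pose D a x := cmap cY (d a *m cinv cX x).
have [|h [hK hE]] := dXY D.
  split=> [a b x|k a x|a|a b x]; rewrite /D.
  - by rewrite (mx_derD dd) mulmxDl cmapD.
  - by rewrite (mx_derZ dd) -scalemxAl cmapZ.
  - split=> [x y|k x]; first by rewrite cinvD mulmxDr cmapD.
    by rewrite cinvZ -scalemxAr cmapZ.
  - rewrite (mx_derM dd) mulmxDl cmapD -mulmxA -crepE -mulmxA;
      congr (_ + cmap _ (_ *m _)).
    by rewrite -{2}(cinvK cX x) crepE cmapK.
have dE a : d a = mx_inner (crep cX) (crep cY) (mat_of cX cY h) a.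
  apply: (mat_eqP (cY := cY)) => u.
  have := hE a (cmap cX u); rewrite /D cmapK => ->.
  by rewrite mulmxBl -!mulmxA cmapB -crepE -!(mat_ofP cX cY hK) -crepE.
exists (mat_of cX cY h); split=> [v|c]; last by rewrite -dg dE.
by apply/esym/eqP; rewrite -subr_eq0 -[_ - _]/(mx_inner _ _ _ _) -dE de.
Qed.

Lemma derivations_of_cocycles :
  cocycles_bound (crep cX) (crep cY) -> derivations_inner X Y.
Proof.
move=> cb D dD; pose d a := mat_of cX cY (D a).
have dE a u : D a (cmap cX u) = cmap cY (d a *m u) by apply/mat_ofP/(der_klinear dD).
have [|H dH] := mx_der_inner (crep_mx_rep cX) (crep_mx_rep cY) cb (d := d).
  split=> [a b|k a|a b]; apply: (mat_eqP (cY := cY)) => u; rewrite -dE.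
  - by rewrite (derD dD) mulmxDl cmapD -!dE.
  - by rewrite (derZ dD) -scalemxAl cmapZ -!dE.
  - by rewrite (derM dD) mulmxDl cmapD -!mulmxA -crepE -!dE -crepE.
exists (fun x => cmap cY (H *m cinv cX x)); split; first split=> [x y|k x].
- by rewrite cinvD mulmxDr cmapD.
- by rewrite cinvZ -scalemxAr cmapZ.
move=> a x; rewrite -[x](cinvK cX); set u := cinv cX x.
rewrite dE dH /mx_inner mulmxBl !(crepE, cmapK) -!mulmxA.
by rewrite cmapB.
Qed.
End Coordinates.
End CocyclesDerivations.

(** * Rigidity of the sum of a module and its twist *)

Lemma fin_dim_prod (K : fieldType) (A : algType K) (X Y : lmodType A) :
  fin_dim X -> fin_dim Y -> fin_dim (X * Y)%type.
Proof.
move=> [n [b hb]] [m [c hc]]; exists (n + m)%N.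
exists (fun i => match fintype.split i with inl j => (b j, 0) | inr j => (0, c j) end).
move=> [x y]; have [u ->] := hb x; have [v ->] := hc y.
exists (fun i => match fintype.split i with inl j => u j | inr j => v j end).
have pairl (I : finType) (F : I -> X) : \sum_i (F i, 0 : Y) = (\sum_i F i, 0).
  by rewrite (big_morph (fun x : X => (x, 0 : Y)) (id1 := 0) (op1 := +%R)) // => x1 x2;
    congr (_, _); rewrite addr0.
have pairr (I : finType) (F : I -> Y) : \sum_i (0 : X, F i) = (0, \sum_i F i).
  by rewrite (big_morph (fun x : Y => (0 : X, x)) (id1 := 0) (op1 := +%R)) // => x1 x2;
    congr (_, _); rewrite addr0.
have sl k z : k *: (z, 0) = (k *: z, 0) :> X * Y by congr (_, _); rewrite /= scaler0.
have sr k z : k *: (0, z) = (0, k *: z) :> X * Y by congr (_, _); rewrite /= scaler0.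
rewrite [RHS]big_split_ord /=.
transitivity ((\sum_i (u i)%:A *: b i, 0 : Y) + (0 : X, \sum_i (v i)%:A *: c i)).
  by congr (_, _); rewrite /= ?addr0 ?add0r.
rewrite -pairl -pairr; congr (_ + _); apply: eq_bigr => i _.
  by rewrite [fintype.split _](unsplitK (inl i)) -sl.
by rewrite [fintype.split _](unsplitK (inr i)) -sr.
Qed.

Section TwistRigid.
Variables (K : fieldType) (A : algType K) (P : mesh_presentation A).
Local Notation e := (@mp_idem K A P).
Local Notation g := (@mp_gen K A P).
Local Notation tau := (@mp_vtx K A P).
Local Notation tauA := (@mp_arr K A P).

Variables (phi : alg_aut A) (q q' : A).
Hypotheses (qq' : q * q' = 1) (q'q : q' * q = 1).
Hypothesis phi_e : forall v, q * aut_inv_fun phi (e v) = e (tau v) * q.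
Hypothesis phi_g : forall c, q * aut_inv_fun phi (g c) = - (g (tauA c) * q).

(** The factor [q'] absorbs the inner automorphism: in these coordinates the twist acts by exactly
    the matrices [r'] demanded by [cocycle_duality]. *)
Definition twist_coords (X : lmodType A) n (c : coords X n) : coords (twist phi X) n.
Proof.
apply: (@Coords K A (twist phi X) n (fun u => q' *: cmap c u : X) (fun x =>
  cinv c (q *: (x : X)))).
- by move=> u v; rewrite cmapD scalerDr.
- move=> k u; rewrite cmapZ scalarAC twist_scaleE.
  by rewrite -[k%:A]/(k *: 1) linearZ /= rmorph1.
- by move=> u; rewrite scalerA qq' scale1r cmapK.
- by move=> x; rewrite cinvK scalerA q'q scale1r.
Defined.

Lemma crep_twist (X : lmodType A) n (c : coords X n) a b :
  q * aut_inv_fun phi a = b * q -> crep (twist_coords c) a = crep c b.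
Proof.
move=> h; have e : aut_inv_fun phi a * q' = q' * b.
  by rewrite -[LHS]mul1r -q'q -!mulrA; congr (_ * _); rewrite !mulrA h -mulrA qq' mulr1.
apply: (mat_eqP (cY := twist_coords c)) => u.
by rewrite -crepE twist_scaleE /= -crepE !scalerA e.
Qed.

(** Duality carries vanishing from (X, Y) to (Y, X'). Starting at (T, T) it yields (T, T'), then
    (T', T'), and then (T', T) because T'' has the matrices of T. *)
Lemma twist_rigid (T : lmodType A) : fin_dim T -> rigid T -> rigid (twist phi T * T)%type.
Proof.
move=> fT rT; have [n [c]] := fin_dim_coords fT.
pose c' := twist_coords c.
have r'e v : crep c' (e v) = crep c (e (tau v)) by apply: crep_twist.
have r'g d : crep c' (g d) = - crep c (g (tauA d)).
  by rewrite -scaleN1r -crepZ; apply: crep_twist; rewrite phi_g scaleN1r mulNr.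
have re v : crep c (e v) = crep c' (e (tau v)) by rewrite r'e mp_vtxK.
have rg d : crep c (g d) = - crep c' (g (tauA d)) by rewrite r'g mp_arrK opprK.
have rr := crep_mx_rep c; have rr' := crep_mx_rep c'.
have b1 : cocycles_bound P (crep c) (crep c).
  exact: cocycles_of_derivations (derivations_of_Ext1 rT).
have b2 : cocycles_bound P (crep c) (crep c') := cocycle_duality rr rr r'e r'g b1.
have b3 : cocycles_bound P (crep c') (crep c') := cocycle_duality rr rr' r'e r'g b2.
have b4 : cocycles_bound P (crep c') (crep c) := cocycle_duality rr' rr' re rg b3.
apply: Ext1_of_derivations; first by apply: fin_dim_prod => //; apply: fin_dim_twist.
apply: derivations_inner_prodl; apply: derivations_inner_prodr.
- exact: derivations_of_cocycles b3.
- exact: derivations_of_cocycles b4.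
- exact: derivations_of_cocycles b2.
- exact: derivations_of_cocycles b1.
Qed.

Lemma maximal_rigid_equivariant (T : lmodType A) :
  fin_dim T -> basic T -> maximal_rigid T -> equivariant phi T.
Proof.
move=> fT bT [rT mT]; apply: twist_in_add_equivariant => //.
by apply: mT; [apply: fin_dim_twist | apply: twist_rigid].
Qed.
End TwistRigid.

(** * Syzygies of bimodules *)

Section Bimodules.
Variables (K : fieldType) (A : algType K).
Implicit Types M N L P : bimodule A.

Definition bimod_pack M N (f : M -> N) (lf : linear f)
    (rf : forall m a, f (ract m a) = ract (f m) a) : bimod_hom M N :=
  @BimodHom K A M N (linear_pack lf) rf.

Definition bimod_comp M N L (f : bimod_hom N L) (g : bimod_hom M N) : bimod_hom M L.
Proof.
apply: (bimod_pack (f := fun x => f (g x))).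
- by move=> a x y; rewrite !linearP.
- by move=> m a; rewrite !bimod_fun_ract.
Defined.

Lemma bimod_compE M N L (f : bimod_hom N L) (g : bimod_hom M N) x :
  bimod_comp f g x = f (g x).
Proof. by []. Qed.

Definition bimod_inverse M N (f : bimod_hom M N) g :
  cancel f g -> cancel g f -> bimod_hom N M.
Proof.
move=> fK gK; apply: (bimod_pack (f := g)); first exact: can_linear fK gK.
by move=> m a; rewrite -{1}[m]gK -bimod_fun_ract fK.
Defined.

Section Kernel.
Variables (M N : bimodule A) (f : bimod_hom M N).

Fact ker_ract_subproof (x : ker_mod f) a : ract (val x) a \in ker_pred f.
Proof. by apply: ker_mod_sub; rewrite bimod_fun_ract ker_modP ract0l. Qed.

Definition ker_bimod : bimodule A.
Proof.
refine (@Bimodule K A (ker_mod f)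
  (fun (x : ker_mod f) a => Sub (ract (val x) a) (ker_ract_subproof x a)) _ _ _ _ _ _).
- by move=> x y a; apply: val_inj; apply: ractDl.
- by move=> x a b; apply: val_inj; apply: ractDr.
- by move=> x; apply: val_inj; apply: ract1.
- by move=> x a b; apply: val_inj; apply: ractM.
- by move=> a x b; apply: val_inj; apply: ractZ.
- by move=> x k; apply: val_inj; apply: ract_scalar.
Defined.

Definition ker_lift L (g : bimod_hom L M) (fg : forall x, f (g x) = 0) :
  bimod_hom L ker_bimod.
Proof.
apply: (bimod_pack (f := fun x => (Sub (g x) (ker_mod_sub (fg x)) : ker_mod f) :
  ker_bimod)).
- by move=> a x y; apply: val_inj; apply: (linearP g).
- by move=> m a; apply: val_inj; apply: (bimod_fun_ract g).
Defined.

Definition ker_incl : bimod_hom ker_bimod M.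
Proof. by apply: (@bimod_pack ker_bimod M (fun x : ker_mod f => val x)). Defined.
End Kernel.

Definition split_mono M N : Prop :=
  exists (j : bimod_hom M N) (r : bimod_hom N M), forall x, r (j x) = x.

(* The comparison of resolutions of Schanuel's lemma, for a not necessarily minimal P. *)
Lemma syzygy_split_mono M M' N P (p : bimod_hom P M') :
  split_mono M M' -> projective P -> surj_fun p -> is_syzygy M N ->
  split_mono N (ker_bimod p).
Proof.
move=> [j [r rj]] projP sp [C [f [g [[projC sf ess] g_inj ex]]]].
have [s ps] := projC _ _ p (bimod_comp j f) sp.
have [h fh] := projP _ _ f (bimod_comp r p) sf.
have fhs x : f (h (s x)) = f x by rewrite fh bimod_compE ps bimod_compE rj.
have shs : surj_fun (bimod_comp h s).
  by apply: ess => m; have [x <-] := sf m; exists x; apply: fhs.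
pose idC : bimod_hom C C := @BimodHom K A C C idfun (fun _ _ => erefl).
have [t hst'] := projC _ _ (bimod_comp h s) idC shs.
have hst x : h (s (t x)) = x := hst' x.
(* [t] is a section of [h \o s]; essentiality of the cover makes it surjective, hence a two-sided
   inverse. *)
have st : surj_fun t.
  by apply: ess => m; have [x <-] := sf m; exists x; rewrite -[in RHS](hst x) fhs.
have ths x : t (h (s x)) = x by have [y <-] := st x; congr (t _); apply: (hst y).
have fth x : f (t (h x)) = f (h x) by rewrite -[in RHS](hst (h x)) fhs.
have fg y : f (g y) = 0 by apply/ex; exists y.
have psg y : bimod_comp p s (g y) = 0 by rewrite bimod_compE ps bimod_compE fg linear0.
pose j' := ker_lift (g := bimod_comp s g) psg.
(* The retraction is induced by [t \o h], which maps the kernel of [p] into that of [f]. *)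
have exk (x : ker_bimod p) : exists y, g y = t (h (val x)).
  by apply/ex; rewrite fth fh bimod_compE ker_modP linear0.
have [r' r'E] := choice exk.
have lr' : linear r'.
  move=> a x y; apply: g_inj; rewrite [RHS]linearP !r'E -!linearP.
  by [].
have rr' (x : ker_bimod p) a : r' (ract x a) = ract (r' x) a.
  by apply: g_inj; rewrite bimod_fun_ract !r'E -!bimod_fun_ract.
exists j', (bimod_pack lr' rr') => y; apply: g_inj.
by rewrite -[LHS]/(g (r' (j' y))) r'E /= ths.
Qed.

(* Only a split embedding of the third syzygy into ker d2 is needed, so the resolution
   P2 -> P1 -> P0 -> M need not be minimal. *)
Lemma syzygy3_embedding M N P0 P1 P2
    (d0 : bimod_hom P0 M) (d1 : bimod_hom P1 P0) (d2 : bimod_hom P2 P1) :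
  projective P0 -> projective P1 -> projective P2 -> surj_fun d0 ->
  (forall x, d0 (d1 x) = 0) -> (forall y, d0 y = 0 -> exists x, d1 x = y) ->
  (forall x, d1 (d2 x) = 0) -> (forall y, d1 y = 0 -> exists x, d2 x = y) ->
  is_nth_syzygy 3 M N ->
  exists i : bimod_hom N P2, injective i /\ forall x, d2 (i x) = 0.
Proof.
move=> p0 p1 p2 s0 d01 e01 d12 e12 [L1 sz1 [L2 sz2 [L3 sz3 [i [i' iK i'K]]]]].
pose idM : bimod_hom M M := @BimodHom K A M M idfun (fun _ _ => erefl).
have spM : split_mono M M by exists idM, idM.
have sp1 := syzygy_split_mono spM p0 s0 sz1.
pose f1 := ker_lift (f := d0) (g := d1) d01.
have s1 : surj_fun f1.
  move=> y; have [x xy] := e01 (val y) (ker_modP y); exists x; exact: val_inj.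
have sp2 := syzygy_split_mono sp1 p1 s1 sz2.
have f12 x : f1 (d2 x) = 0 by apply: val_inj; apply: d12.
pose f2 := ker_lift (f := f1) (g := d2) f12.
have s2 : surj_fun f2.
  move=> y; have [|x xy] := e12 (val y); last by exists x; apply: val_inj.
  exact: (congr1 val (ker_modP y)).
have [j [r rj]] := syzygy_split_mono sp2 p2 s2 sz3.
pose u := bimod_comp (ker_incl f2) (bimod_comp j (bimod_inverse iK i'K)).
exists u; split=> [x y|x].
  by move/val_inj/(can_inj rj)/(can_inj i'K).
exact: (congr1 val (ker_modP (j (i' x)))).
Qed.
End Bimodules.

(** * Projective bimodules over a Frobenius algebra *)

Section TensorModel.
Variables (K : fieldType) (A : algType K) (eta : alg_aut A) (f : A -> K).

Record frobenius_form : Prop := FrobeniusForm {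
  frobD : {morph f : x y / x + y};
  frobZ : forall k x, f (k *: x) = k * f x;
  frob_twist : forall x a, f (x * a) = f (aut_fun eta a * x);
  frob_nondeg : forall a, (forall x, f (a * x) = 0) -> a = 0 }.

Hypothesis ff : frobenius_form.

Lemma frob_aut_inv x a : f (a * x) = f (x * aut_inv_fun eta a).
Proof. by rewrite [RHS](frob_twist ff) aut_inv_funK. Qed.

(** A tensor whose operator vanishes is killed by every balanced map [B]. If the [y i] are
    dependent, one of them is eliminated and the induction applies; otherwise every [f (x i * u)] is
    0, and nondegeneracy gives [x i = 0]. *)
Lemma fin_tensor_eq0_ord (V : zmodType) (B : A -> A -> V) :
  (forall x x' y, B (x + x') y = B x y + B x' y) ->
  (forall x y y', B x (y + y') = B x y + B x y') ->
  (forall (k : K) x y, B (k *: x) y = B x (k *: y)) ->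
  forall n (x y : 'I_n -> A), (forall u, \sum_i f (x i * u) *: y i = 0) ->
  \sum_i B (x i) (y i) = 0.
Proof.
move=> Bl Br Bk.
have Br0 x : B x 0 = 0 by apply: (addrI (B x 0)); rewrite -Br !addr0.
have Bl0 y : B 0 y = 0 by apply: (addrI (B 0 y)); rewrite -Bl !addr0.
elim=> [|n IH] x y h; first by rewrite big_ord0.
have [dep|indep] := pselect (exists c : 'I_n.+1 -> K, (exists j, c j != 0) /\ \sum_i c
  i *: y i = 0).
  have [c [[j cj] cy]] := dep; pose d i := - (c (lift j i) / c j).
  have yj : y j = \sum_i d i *: y (lift j i).
    apply: (@scalerI _ _ (c j)) => //; rewrite scaler_sumr.
    move: cy; rewrite (bigD1_ord j) //= => /eqP; rewrite addr_eq0 => /eqP ->.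
    rewrite -sumrN; apply: eq_bigr => i _.
    by rewrite scalerA mulrN mulrCA mulfV // mulr1 scaleNr.
  have xd : \sum_i B (x (lift j i) + d i *: x j) (y (lift j i)) = 0.
    apply: (IH (fun i => x (lift j i) + d i *: x j) (fun i => y (lift j i))) => u.
    rewrite -[RHS](h u) (bigD1_ord j) //= yj scaler_sumr -big_split.
    apply: eq_bigr => i _; rewrite mulrDl (frobD ff) scalerDl addrC; congr (_ + _).
    by rewrite -scalerAl (frobZ ff) scalerA mulrC.
  rewrite -[RHS]xd (bigD1_ord j) //= yj.
  rewrite (big_morph (B (x j)) (Br (x j)) (Br0 (x j))) -big_split.
  by apply: eq_bigr => i _; rewrite Bl Bk addrC.
apply: big1 => i _; suff -> : x i = 0 by [].
apply: (frob_nondeg ff) => u; apply/eqP/negPn/negP => xi.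
by apply: indep; exists (fun i => f (x i * u)); split; [exists i | apply: h].
Qed.

Lemma fin_tensor_eq0 (V : zmodType) (B : A -> A -> V) :
  (forall x x' y, B (x + x') y = B x y + B x' y) ->
  (forall x y y', B x (y + y') = B x y + B x y') ->
  (forall (k : K) x y, B (k *: x) y = B x (k *: y)) ->
  forall s : seq (A * A), (forall u, \sum_(p <- s) f (p.1 * u) *: p.2 = 0) ->
  \sum_(p <- s) B p.1 p.2 = 0.
Proof.
move=> Bl Br Bk s h; rewrite (big_nth (0, 0)) big_mkord.
apply: (fin_tensor_eq0_ord Bl Br Bk (x := fun i => (nth (0, 0) s i).1)
  (y := fun i => (nth (0, 0) s i).2)) => u.
by rewrite -[RHS](h u) (big_nth (0, 0)) big_mkord.
Qed.

Section ProjectiveBimodule.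
Variables (I : finType) (al be : I -> A).
Hypothesis alK : forall i, al i * al i = al i.
Hypothesis beK : forall i, be i * be i = be i.

(* The tensor x al_i (x) be_i y in (+)_i A al_i (x) be_i A is encoded as the finite rank
   operator (j, u) |-> f (x al_j u) be_j y, supported on j = i. *)
Definition tens_fun (t : I * A * A) (i : I) (u : A) : A :=
  if t.1.1 == i then f (t.1.2 * al i * u) *: (be i * t.2) else 0.

Definition tens_pred : {pred I -> A -> A} :=
  fun w => `[< exists s : seq (I * A * A), forall i u, w i u = \sum_(t <- s) tens_fun t
    i u >].

Lemma tens_fun_pred t : tens_fun t \in tens_pred.
Proof. by apply/asboolP; exists [:: t] => i u; rewrite big_seq1. Qed.

Fact tens_zmod_closed : zmod_closed tens_pred.
Proof.
split=> [|w w' /asboolP [s hs] /asboolP [s' hs']]; apply/asboolP.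
  by exists [::] => i u; rewrite big_nil.
exists (s ++ [seq (t.1.1, - t.1.2, t.2) | t <- s']) => i u.
rewrite big_cat big_map -hs /= -[LHS]/(w i u - w' i u) hs' -sumrN.
congr (_ + _); apply: eq_bigr => t _; rewrite /tens_fun /=.
case: ifP => _; last by rewrite oppr0.
by rewrite -scaleNr !mulNr -[- (_ * _)]scaleN1r (frobZ ff) mulN1r.
Qed.
HB.instance Definition _ :=
  GRing.isZmodClosed.Build (I -> A -> A) tens_pred tens_zmod_closed.

Definition tens_of of frobenius_form : Type := {w : I -> A -> A | w \in tens_pred}.
Local Notation tens := (tens_of ff).
HB.instance Definition _ := SubChoice.on tens.
HB.instance Definition _ := [SubChoice_isSubZmodule of tens by <:].
Implicit Types w : tens.

Definition elt (i : I) (x y : A) : tens := Sub (tens_fun (i, x, y)) (tens_fun_pred _).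

Lemma tens_eqP w w' : (forall i u, val w i u = val w' i u) -> w = w'.
Proof. by move=> h; apply/val_inj/funext => i; apply/funext => u. Qed.

Lemma tensD w w' i u : val (w + w') i u = val w i u + val w' i u.
Proof. by []. Qed.

Lemma eltE i x y j u :
  val (elt i x y) j u = if i == j then f (x * al j * u) *: (be j * y) else 0.
Proof. by []. Qed.

Lemma val_sum_elt (s : seq (I * A * A)) i u :
  val (\sum_(t <- s) elt t.1.1 t.1.2 t.2) i u = \sum_(t <- s) tens_fun t i u.
Proof.
elim: s => [|[[j x] y] s IH]; first by rewrite !big_nil.
by rewrite !big_cons tensD IH.
Qed.

Lemma tens_rep w : exists s : seq (I * A * A), w = \sum_(t <- s) elt t.1.1 t.1.2 t.2.
Proof.
have /asboolP [s hs] := valP w; exists s; by apply: tens_eqP => i u;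
  rewrite hs val_sum_elt.
Qed.

Lemma tens_ind (Q : tens -> Prop) : Q 0 -> (forall w w', Q w -> Q w' -> Q (w + w')) ->
  (forall i x y, Q (elt i x y)) -> forall w, Q w.
Proof. by move=> Q0 QD Qe w; have [s ->] := tens_rep w; apply: big_ind. Qed.

Lemma tens_additive_eq (V : zmodType) (F G : tens -> V) :
  {morph F : w w' / w + w'} -> {morph G : w w' / w + w'} ->
  (forall i x y, F (elt i x y) = G (elt i x y)) -> F =1 G.
Proof.
move=> FD GD FG; apply: tens_ind => [|w w' hw hw'|]; last exact: FG.
  have F0 : F 0 = 0 by apply: (addrI (F 0)); rewrite -FD !addr0.
  by rewrite F0; apply/esym/(addrI (G 0)); rewrite -GD !addr0.
by rewrite FD GD hw hw'.
Qed.

Section Extension.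
Variables (V : zmodType) (B : I -> A -> A -> V).
Hypothesis Bl : forall i x x' y, B i (x + x') y = B i x y + B i x' y.
Hypothesis Br : forall i x y y', B i x (y + y') = B i x y + B i x y'.
Hypothesis Bk : forall i (k : K) x y, B i (k *: x) y = B i x (k *: y).
Hypothesis Bal : forall i x y, B i (x * al i) y = B i x y.
Hypothesis Bbe : forall i x y, B i x (be i * y) = B i x y.

Lemma tens_sum_eq0 (s : seq (I * A * A)) :
  \sum_(t <- s) elt t.1.1 t.1.2 t.2 = 0 -> \sum_(t <- s) B t.1.1 t.1.2 t.2 = 0.
Proof.
move=> s0; have {}s0 i u : \sum_(t <- s) tens_fun t i u = 0.
  by rewrite -val_sum_elt s0.
rewrite (partition_big (fun t : I * A * A => t.1.1) xpredT) //=; apply: big1 => i _.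
pose s' := [seq (t.1.2 * al i, be i * t.2) | t <- s & t.1.1 == i].
have := @fin_tensor_eq0 V (B i) (Bl i) (Br i) (Bk i) s'.
rewrite !big_map !big_filter => h; rewrite -[RHS]h => [|u].
  by apply: eq_bigr => t /eqP <-; rewrite /= Bal Bbe.
by rewrite big_map big_filter big_mkcond; apply: s0.
Qed.

(** The map out of the tensor product induced by a balanced [B], computed on a chosen expression of
    [w]; [tens_sum_eq0] makes the choice immaterial. *)
Definition tens_ext w : V :=
  \sum_(t <- projT1 (cid (tens_rep w))) B t.1.1 t.1.2 t.2.

Lemma tens_ext_sum (s : seq (I * A * A)) :
  tens_ext (\sum_(t <- s) elt t.1.1 t.1.2 t.2) = \sum_(t <- s) B t.1.1 t.1.2 t.2.
Proof.
rewrite /tens_ext; case: cid => s' /= e.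
have BN i x y : B i (- x) y = - B i x y.
  have B0 : B i 0 y = 0 by apply: (addrI (B i 0 y)); rewrite -Bl !addr0.
  by apply/eqP; rewrite -addr_eq0 -Bl addNr B0.
have eN i x y : elt i (- x) y = - elt i x y.
  apply: tens_eqP => j u; rewrite eltE -[RHS]/(- val (elt i x y) j u) eltE.
  case: ifP => _; last by rewrite oppr0.
  by rewrite !mulNr -[- (_ * _)]scaleN1r (frobZ ff) mulN1r scaleNr.
apply/eqP; rewrite eq_sym -subr_eq0 -sumrN; apply/eqP.
have := @tens_sum_eq0 (s ++ [seq (t.1.1, - t.1.2, t.2) | t <- s']).
rewrite !big_cat !big_map /= (eq_bigr _ (fun t _ => eN t.1.1 t.1.2 t.2)).
rewrite sumrN -e subrr (eq_bigr _ (fun t _ => BN t.1.1 t.1.2 t.2)).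
by apply.
Qed.

Lemma tens_extD : {morph tens_ext : w w' / w + w'}.
Proof.
move=> w w'; have [s ->] := tens_rep w; have [s' ->] := tens_rep w'.
by rewrite -big_cat !tens_ext_sum big_cat.
Qed.

Lemma tens_ext_elt i x y : tens_ext (elt i x y) = B i x y.
Proof. by have := tens_ext_sum [:: (i, x, y)]; rewrite !big_seq1. Qed.
End Extension.

Lemma tens_fun_additive w i : {morph val w i : u v / u + v}.
Proof.
elim/tens_ind: w => [|w w' hw hw'|j x y] u v; first by rewrite /= addr0.
  by rewrite !tensD hw hw' addrACA.
by rewrite !eltE; case: ifP => _; rewrite ?addr0 // mulrDr (frobD ff) scalerDl.
Qed.

Lemma tens_funZ w i k u : val w i (k *: u) = k *: val w i u.
Proof.
elim/tens_ind: w => [|w w' hw hw'|j x y]; first by rewrite /= scaler0.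
  by rewrite !tensD hw hw' scalerDr.
by rewrite !eltE; case: ifP => _; rewrite ?scaler0 // -scalerAr (frobZ ff) scalerA.
Qed.

Lemma tens_fun_al w i u : val w i (al i * u) = val w i u.
Proof.
elim/tens_ind: w => [//|w w' hw hw'|j x y]; first by rewrite !tensD hw hw'.
by rewrite !eltE; case: ifP => // _; rewrite mulrA -(mulrA x) alK.
Qed.

Lemma tens_fun_be w i u : be i * val w i u = val w i u.
Proof.
elim/tens_ind: w => [|w w' hw hw'|j x y]; first by rewrite /= mulr0.
  by rewrite !tensD mulrDr hw hw'.
by rewrite !eltE; case: ifP => _; rewrite ?mulr0 // -scalerAr mulrA beK.
Qed.

(** The action sends x (x) y to a x (x) y: [frob_aut_inv] moves [a] from the front of the argument
    of [f] to its end. *)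
Fact tens_scale_pred a w : (fun i u => val w i (u * aut_inv_fun eta a)) \in tens_pred.
Proof.
have /asboolP [s hs] := valP w; apply/asboolP.
exists [seq (t.1.1, a * t.1.2, t.2) | t <- s] => i u.
rewrite big_map hs; apply: eq_bigr => t _; rewrite /tens_fun /=.
by case: ifP => // _; rewrite !mulrA -frob_aut_inv !mulrA.
Qed.
Definition tens_scale a w : tens := exist (fun h : I -> A -> A =>
  h \in tens_pred) _ (tens_scale_pred a w).

Fact tens_scaleA a b w : tens_scale a (tens_scale b w) = tens_scale (a * b) w.
Proof. by apply: tens_eqP => i u; rewrite /= rmorphM mulrA. Qed.
Fact tens_scale1 : left_id 1 tens_scale.
Proof. by move=> w; apply: tens_eqP => i u; rewrite /= rmorph1 mulr1. Qed.
Fact tens_scaleDr : right_distributive tens_scale +%R.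
Proof. by move=> a w w'; apply: tens_eqP. Qed.
Fact tens_scaleDl w : {morph tens_scale^~ w : a b / a + b}.
Proof.
by move=> a b; apply: tens_eqP => i u; rewrite tensD /= rmorphD mulrDr tens_fun_additive.
Qed.
HB.instance Definition _ := GRing.Zmodule_isLmodule.Build A tens
  tens_scaleA tens_scale1 tens_scaleDr tens_scaleDl.

Fact tens_ract_pred w a : (fun i u => val w i u * a) \in tens_pred.
Proof.
have /asboolP [s hs] := valP w; apply/asboolP.
exists [seq (t.1.1, t.1.2, t.2 * a) | t <- s] => i u.
rewrite big_map hs mulr_suml; apply: eq_bigr => t _; rewrite /tens_fun /=.
by case: ifP => _; rewrite ?mul0r // -scalerAl mulrA.
Qed.
Definition tens_ract w a : tens := exist (fun h : I -> A -> A =>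
  h \in tens_pred) _ (tens_ract_pred w a).

Definition tens_bimod : bimodule A.
Proof.
refine (@Bimodule K A tens tens_ract _ _ _ _ _ _).
- by move=> w w' a; apply: tens_eqP => i u; exact: mulrDl.
- by move=> w a b; apply: tens_eqP => i u; exact: mulrDr.
- by move=> w; apply: tens_eqP => i u; rewrite /= mulr1.
- by move=> w a b; apply: tens_eqP => i u; rewrite /= mulrA.
- by move=> a w b; apply: tens_eqP.
- move=> w k; apply: tens_eqP => i u /=.
  have -> : aut_inv_fun eta k%:A = k%:A by rewrite linearZ /= rmorph1.
  by rewrite -!scalerAr !mulr1 tens_funZ.
Defined.

Definition tens_gen i : tens_bimod := elt i 1 1.

Lemma tens_scale_elt a i x y : a *: (elt i x y : tens_bimod) = elt i (a * x) y.
Proof.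
apply: tens_eqP => j u; rewrite -[LHS]/(val (elt i x y) j (u * aut_inv_fun eta a)) !eltE.
by case: ifP => // _; rewrite !mulrA -frob_aut_inv !mulrA.
Qed.

Lemma tens_ract_elt a i x y : ract (elt i x y : tens_bimod) a = elt i x (y * a).
Proof.
apply: tens_eqP => j u; rewrite -[LHS]/(val (elt i x y) j u * a) !eltE.
by case: ifP => _; rewrite ?mul0r // -scalerAl mulrA.
Qed.

Lemma elt_al i x y : elt i (x * al i) y = elt i x y.
Proof.
by apply: tens_eqP => j u; rewrite !eltE; case: ifP => // /eqP <-; rewrite -(mulrA x) alK.
Qed.

Lemma elt_be i x y : elt i x (be i * y) = elt i x y.
Proof.
by apply: tens_eqP => j u; rewrite !eltE; case: ifP => // /eqP <-;
  rewrite (mulrA (be i)) beK.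
Qed.

Lemma elt_gen i x y : elt i x y = ract (x *: tens_gen i) y.
Proof. by rewrite /tens_gen tens_scale_elt tens_ract_elt mulr1 mul1r. Qed.

Lemma tens_gen_al i : al i *: tens_gen i = tens_gen i.
Proof. by rewrite /tens_gen tens_scale_elt mulr1 -[al i]mul1r elt_al. Qed.

Lemma tens_gen_be i : ract (tens_gen i) (be i) = tens_gen i.
Proof. by rewrite /tens_gen tens_ract_elt mul1r -[be i]mulr1 elt_be. Qed.

Section Hom.
Variables (M : bimodule A) (m : I -> M).
Hypothesis m_al : forall i, al i *: m i = m i.
Hypothesis m_be : forall i, ract (m i) (be i) = m i.

Let B i x y := ract (x *: m i) y.
Let F := tens_ext B.
Let Bl i x x' y : B i (x + x') y = B i x y + B i x' y.
Proof. by rewrite /B scalerDl ractDl. Qed.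
Let Br i x y y' : B i x (y + y') = B i x y + B i x y'.
Proof. by rewrite /B ractDr. Qed.
Let Bk i (k : K) x y : B i (k *: x) y = B i x (k *: y).
Proof.
have -> : k *: y = k%:A * y by rewrite -scalerAl mul1r.
by rewrite /B ractM ract_scalar scalerA -scalerAl mul1r.
Qed.
Let Bal i x y : B i (x * al i) y = B i x y.
Proof. by rewrite /B -scalerA m_al. Qed.
Let Bbe i x y : B i x (be i * y) = B i x y.
Proof. by rewrite /B ractM ractZ m_be. Qed.
Let FD : {morph F : w w' / w + w'} := tens_extD Bl Br Bk Bal Bbe.
Let Felt i x y : F (elt i x y) = B i x y := tens_ext_elt Bl Br Bk Bal Bbe i x y.

Fact tens_hom_linear : linear (F : tens_bimod -> M).
Proof.
move=> a x y; rewrite FD; congr (_ + _); move: x.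
apply: tens_additive_eq => [w w'|w w'|i x z].
- by rewrite scalerDr FD.
- by rewrite FD scalerDr.
by rewrite tens_scale_elt !Felt /B -ractZ scalerA.
Qed.

Fact tens_hom_ract (w : tens_bimod) a : F (ract w a) = ract (F w) a.
Proof.
move: w; apply: tens_additive_eq => [w w'|w w'|i x z].
- by rewrite ractDl FD.
- by rewrite FD ractDl.
by rewrite tens_ract_elt !Felt /B ractM.
Qed.

Definition tens_hom : bimod_hom tens_bimod M := bimod_pack tens_hom_linear tens_hom_ract.

Lemma tens_hom_elt i x y : tens_hom (elt i x y) = ract (x *: m i) y.
Proof. exact: Felt. Qed.
End Hom.

(** Lifts of the generators are cut down by [al i] and [be i], after which they define a map on the
    whole bimodule. *)
Lemma tens_projective : projective tens_bimod.
Proof.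
move=> M N p h sp.
have [m0 hm0] := choice (fun i => sp (h (tens_gen i))).
pose m i := ract (al i *: m0 i) (be i).
have m_al i : al i *: m i = m i by rewrite /m -ractZ scalerA alK.
have m_be i : ract (m i) (be i) = m i by rewrite /m -ractM beK.
have pm i : p (m i) = h (tens_gen i).
  rewrite /m bimod_fun_ract linearZ /= hm0 -[in RHS](tens_gen_be i).
  by rewrite -[in RHS](tens_gen_al i) bimod_fun_ract linearZ.
exists (tens_hom m_al m_be).
apply: tens_additive_eq => [w w'|w w'|i x y]; rewrite ?linearD //.
by rewrite tens_hom_elt elt_gen !bimod_fun_ract !linearZ /= pm.
Qed.
End ProjectiveBimodule.
End TensorModel.

(** * The resolution of a mesh algebra *)

Section ImageQuotient.
Local Open Scope quotient_scope.
Variables (K : fieldType) (A : algType K) (M N : bimodule A) (h : bimod_hom M N).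

Definition im_pred : {pred N} := fun x => `[< exists w, h w = x >].

Lemma im_predP x : reflect (exists w, h w = x) (x \in im_pred).
Proof. exact: asboolP. Qed.

Fact im_zmod_closed : zmod_closed im_pred.
Proof.
split=> [|x y /im_predP [v <-] /im_predP [w <-]]; apply/im_predP.
  by exists 0; rewrite linear0.
by exists (v - w); rewrite linearB.
Qed.
HB.instance Definition _ := GRing.isZmodClosed.Build N im_pred im_zmod_closed.

(** Only the additive group is formed, as it serves as target of merely additive maps in the proof
    of exactness. *)
Definition coker : zmodType := Quotient.quot im_pred.
Definition coker_pi (x : N) : coker := \pi_(Quotient.quot im_pred) x.

Lemma coker_piD : {morph coker_pi : x y / x + y}.
Proof. by move=> x y; rewrite /coker_pi raddfD. Qed.

Lemma coker_pi_eq x y : x - y \in im_pred -> coker_pi x = coker_pi y.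
Proof. by move=> xy; apply/eqP; rewrite -Quotient.idealrBE. Qed.

Lemma coker_pi_eq0 x : coker_pi x = 0 -> x \in im_pred.
Proof.
have -> : 0 = coker_pi 0 by rewrite /coker_pi raddf0.
by move/eqP; rewrite -Quotient.idealrBE subr0.
Qed.

Lemma im_sub_bimod : sub_bimod (fun x => x \in im_pred).
Proof.
split=> [|x y hx hy|a x /im_predP [w <-]|x a /im_predP [w <-]].
- exact: rpred0.
- exact: rpredB.
- by apply/im_predP; exists (a *: w); rewrite linearZ.
- by apply/im_predP; exists (ract w a); rewrite bimod_fun_ract.
Qed.
End ImageQuotient.

Section RactTheory.
Variables (K : fieldType) (A : algType K) (M : bimodule A).

Lemma ractN (x : M) a : ract (- x) a = - ract x a.
Proof. by apply/eqP; rewrite -addr_eq0 -ractDl addNr ract0l. Qed.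

Lemma ractB (x y : M) a : ract (x - y) a = ract x a - ract y a.
Proof. by rewrite ractDl ractN. Qed.

Lemma ractZr (x : M) (k : K) a : ract x (k *: a) = k%:A *: ract x a.
Proof.
have -> : k *: a = k%:A * a by rewrite -scalerAl mul1r.
by rewrite ractM ract_scalar ractZ.
Qed.

Lemma ract_sum (J : Type) (s : seq J) (Q : pred J) (F : J -> M) a :
  ract (\sum_(i <- s | Q i) F i) a = \sum_(i <- s | Q i) ract (F i) a.
Proof. exact: (big_morph (fun x : M => ract x a) (fun x y =>
  ractDl x y a) (ract0l M a)). Qed.
Variables (N : bimodule A) (h : bimod_hom M N).

Lemma bimod_homZ a x : h (a *: x) = a *: h x. Proof. exact: linear_funZ (linearP h) a
  x. Qed.
Lemma bimod_homD x y : h (x + y) = h x + h y. Proof. exact: linearD. Qed.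
Lemma bimod_hom_sum (J : Type) (s : seq J) (Q : pred J) (F : J -> M) :
  h (\sum_(i <- s | Q i) F i) = \sum_(i <- s | Q i) h (F i).
Proof. exact: linear_sum. Qed.
End RactTheory.

Section MeshResolution.
Variables (K : fieldType) (A : algType K) (P : mesh_presentation A).
Local Notation e := (@mp_idem K A P).
Local Notation g := (@mp_gen K A P).
Local Notation "c ^'" := (mp_mesh c).
Local Notation src := (@mp_src K A P).
Local Notation tgt := (@mp_tgt K A P).
Local Notation tau := (@mp_vtx K A P).
Local Notation tauA := (@mp_arr K A P).
Variables (eta : alg_aut A) (f : A -> K) (ff : frobenius_form eta f).

Let eK := @mp_idemK K A P.

Definition res0 := tens_bimod ff e e.
Definition res1 := tens_bimod ff (e \o tgt) (e \o src).
Definition res2 := tens_bimod ff e (e \o tau).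
Definition gen0 v : res0 := tens_gen ff e e v.
Definition gen1 c : res1 := tens_gen ff (e \o tgt) (e \o src) c.

Lemma gen0_l v : e v *: gen0 v = gen0 v. Proof. exact: (tens_gen_al ff e eK v). Qed.
Lemma gen0_r v : ract (gen0 v) (e v) = gen0 v.
Proof. exact: (tens_gen_be ff e eK v). Qed.
Lemma gen1_l c : e (tgt c) *: gen1 c = gen1 c.
Proof. exact: (tens_gen_al ff (al := e \o tgt) (e \o src) (fun c => eK (tgt c)) c). Qed.
Lemma gen1_r c : ract (gen1 c) (e (src c)) = gen1 c.
Proof. exact: (tens_gen_be ff (e \o tgt) (be := e \o src) (fun c => eK (src c)) c). Qed.

Definition res_d0 : bimod_hom res0 (regular_bimod A) :=
  tens_hom ff (m := e : _ -> regular_bimod A) eK eK.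

Definition rel1 c : res0 := g c *: gen0 (src c) - ract (gen0 (tgt c)) (g c).

Lemma rel1_l c : e (tgt c) *: rel1 c = rel1 c.
Proof. by rewrite /rel1 scalerBr scalerA mp_idem_gen -ractZ gen0_l. Qed.
Lemma rel1_r c : ract (rel1 c) (e (src c)) = rel1 c.
Proof. by rewrite /rel1 ractB -ractM mp_gen_idem ractZ gen0_r. Qed.

Definition res_d1 : bimod_hom res1 res0 :=
  tens_hom ff (al := e \o tgt) (be := e \o src) (m := rel1) rel1_l rel1_r.

(** The mesh relation at [v], differentiated by the Leibniz rule with [gen1 c] as derivative of
    [c]. *)
Definition rel2 v : res1 :=
  \sum_(c | tgt c == v) (g c *: gen1 (c^') + ract (gen1 c) (g (c^'))).

Lemma rel2_l v : e v *: rel2 v = rel2 v.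
Proof.
rewrite scaler_sumr; apply: eq_bigr => c /eqP <-.
by rewrite scalerDr scalerA mp_idem_gen -ractZ gen1_l.
Qed.
Lemma rel2_r v : ract (rel2 v) (e (tau v)) = rel2 v.
Proof.
rewrite ract_sum; apply: eq_bigr => c /eqP <-.
by rewrite ractDl ractZ -ractM -(mp_src_mesh c) mp_gen_idem gen1_r.
Qed.

Definition res_d2 : bimod_hom res2 res1 :=
  tens_hom ff (al := e) (be := e \o tau) (m := rel2) rel2_l rel2_r.

Local Notation elt0 := (elt ff e e).
Local Notation elt1 := (elt ff (e \o tgt) (e \o src)).
Local Notation elt2 := (elt ff e (e \o tau)).

Lemma res_d0_elt v x y : res_d0 (elt0 v x y) = x * e v * y.
Proof. exact: (tens_hom_elt ff (m := e : _ -> regular_bimod A) eK eK v x y). Qed.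

Lemma res_d1_elt c x y : res_d1 (elt1 c x y) = ract (x *: rel1 c) y.
Proof. exact: tens_hom_elt. Qed.

Lemma res_d2_elt v x y : res_d2 (elt2 v x y) = ract (x *: rel2 v) y.
Proof. exact: tens_hom_elt. Qed.

Lemma elt0E v x y : elt0 v x y = ract (x *: gen0 v) y. Proof. exact: elt_gen. Qed.
Lemma elt1E c x y : elt1 c x y = ract (x *: gen1 c) y. Proof. exact: elt_gen. Qed.

Lemma rel1_elt c x y : ract (x *: rel1 c) y
  = elt0 (src c) (x * g c) y - elt0 (tgt c) x (g c * y) :> res0.
Proof. by rewrite /rel1 scalerBr ractB scalerA -ractZ -ractM -!elt0E. Qed.

Lemma rel2_elt v x y : ract (x *: rel2 v) y
  = \sum_(c | tgt c == v) (elt1 (c^') (x * g c) y + elt1 c x (g (c^') * y)) :> res1.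
Proof.
rewrite /rel2 scaler_sumr ract_sum; apply: eq_bigr => c _.
by rewrite scalerDr ractDl scalerA -ractZ -ractM -!elt1E.
Qed.

Lemma res_d0_surj : surj_fun res_d0.
Proof.
move=> a; exists (\sum_v elt0 v a 1); rewrite linear_sum.
rewrite (eq_bigr (fun v => a * e v)) => [|v _]; last by rewrite res_d0_elt mulr1.
by rewrite -mulr_sumr mp_idem_sum mulr1.
Qed.

Lemma res_d01 x : res_d0 (res_d1 x) = 0.
Proof.
move: x; apply: tens_additive_eq => [w w'|w w'|c x y]; rewrite ?linearD ?addr0 //.
rewrite res_d1_elt rel1_elt linearB /= !res_d0_elt.
by rewrite !mulrA -(mulrA x (g c)) mp_gen_idem -(mulrA x (e _)) mp_idem_gen subrr.
Qed.

Lemma res_d12 x : res_d1 (res_d2 x) = 0.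
Proof.
move: x; apply: tens_additive_eq => [w w'|w w'|v x y]; rewrite ?linearD ?addr0 //.
rewrite res_d2_elt bimod_fun_ract bimod_homZ bimod_hom_sum.
have gen1E c : gen1 c = elt1 c 1 1 by [].
have d1g c : res_d1 (gen1 c) = rel1 c by rewrite gen1E res_d1_elt scale1r ract1.
rewrite (eq_bigr (fun c => ((g c * g (c^')) *: gen0 (tau v) - ract (gen0 v) (g c * g
  (c^'))))).
  rewrite sumrB -scaler_suml mp_rel scale0r sub0r.
  rewrite -(big_morph _ (ractDr (gen0 v)) (ract0r (gen0 v))) mp_rel ract0r oppr0.
  by rewrite scaler0 ract0l.
move=> c /eqP <-; rewrite bimod_homD bimod_homZ bimod_fun_ract !d1g /rel1.
rewrite mp_src_mesh mp_tgt_mesh scalerBr ractB -ractZ ractM scalerA ractZ.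
by rewrite addrA subrK.
Qed.

(** Modulo the image of [d1] the element [one] is central, so every [w] is congruent to
    [ract one (d0 w)]. *)
Lemma res_exact0 y : res_d0 y = 0 -> exists x, res_d1 x = y.
Proof.
move=> y0; apply/im_predP; have S := im_sub_bimod res_d1.
pose one := \sum_v gen0 v.
have eg v w : v != w -> e v *: gen0 w = 0.
  by move=> vw; rewrite -(gen0_l w) scalerA mp_idem_orth // scale0r.
have ge v w : v != w -> ract (gen0 v) (e w) = 0.
  by move=> vw; rewrite -(gen0_r v) -ractM mp_idem_orth // ract0r.
have e1 v : e v *: one = gen0 v.
  rewrite scaler_sumr (bigD1 v) //= gen0_l big1 ?addr0 // => w wv.
  by rewrite eg // eq_sym.
have oneE v : ract one (e v) = gen0 v.
  rewrite ract_sum (bigD1 v) // gen0_r big1 => [|w wv]; first exact: addr0.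
  by rewrite ge.
have comm a : a *: one - ract one a \in im_pred res_d1.
  elim/(@mp_ind K A P): a => [a b ha hb|k a ha|v|c a ha].
  - rewrite scalerDl ractDr opprD addrACA; exact: rpredD.
  - rewrite ractZr scalarAZ -scalerBr; exact: (sub_bimodZ S).
  - by rewrite e1 oneE subrr rpred0.
  - have -> : (g c * a) *: one - ract one (g c * a)
        = g c *: (a *: one - ract one a) + ract (g c *: one - ract one (g c)) a.
      by rewrite ractB scalerBr scalerA ractM ractZ addrA subrK.
    apply: rpredD; first exact: (sub_bimodZ S).
    apply: (sub_bimod_ract S); apply/im_predP; exists (gen1 c).
    rewrite -[gen1 c]/(elt1 c 1 1) res_d1_elt scale1r ract1 /rel1.
    congr (_ - _); first by rewrite -[in RHS](mp_gen_idem c) -scalerA e1.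
    by rewrite -[in RHS](mp_idem_gen c) ractM oneE.
have all w : w - ract one (res_d0 w) \in im_pred res_d1.
  elim/tens_ind: w => [|w w' hw hw'|v x z].
  - by rewrite linear0 ract0r subr0 rpred0.
  - rewrite linearD ractDr opprD addrACA; exact: rpredD.
  - rewrite res_d0_elt elt0E -{1}e1 scalerA ractM -ractB.
    exact: (sub_bimod_ract S).
by have := all y; rewrite y0 ract0r subr0.
Qed.

(* Modulo the image of d2 there is a derivation D with D c = gen1 c.  Hence x (x) y |-> D(x) y
   defines an additive map on res0 whose composite with d1 is the projection of res1
     modulo
   the image of d2. *)
Lemma res_exact1 y : res_d1 y = 0 -> exists x, res_d2 x = y.
Proof.
move=> y0; apply/im_predP; have S := im_sub_bimod res_d2.
have rel2_im v : rel2 v \in im_pred res_d2.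
  by apply/im_predP; exists (elt2 v 1 1); rewrite res_d2_elt scale1r ract1.
have [D [DD DZ DM De Dg]] := mp_der S gen1_l gen1_r rel2_im.
pose p := coker_pi res_d2.
have pE := @coker_pi_eq _ _ _ _ res_d2.
have pD : {morph p : u v / u + v} := coker_piD res_d2.
have DDr a b z : p (ract (D (a + b)) z) = p (ract (D a) z + ract (D b) z).
  by apply: pE; rewrite -ractDl -ractB; apply: (sub_bimod_ract S).
have DMr a b z : p (ract (D (a * b)) z) = p (ract (a *: D b + ract (D a) b) z).
  by apply: pE; rewrite -ractB; apply: (sub_bimod_ract S).
have Der v a z : p (ract (a *: D (e v)) z) = 0.
  rewrite -[0](_ : p 0 = 0); last by apply: (addrI (p 0)); rewrite -pD !addr0.
  apply: pE; rewrite subr0; apply: (sub_bimod_ract S); exact: (sub_bimodZ S).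
pose B v x z := p (ract (D x) (e v * z)).
have Bl v x x' z : B v (x + x') z = B v x z + B v x' z by rewrite /B DDr pD.
have Br v x z z' : B v x (z + z') = B v x z + B v x z' by rewrite /B mulrDr ractDr pD.
have Bk v (k : K) x z : B v (k *: x) z = B v x (k *: z).
  rewrite /B -scalerAr ractZr -ractZ; apply: pE; rewrite -ractB.
  exact: (sub_bimod_ract S).
have Bal v x z : B v (x * e v) z = B v x z.
  by rewrite /B DMr ractDl pD Der add0r -ractM mulrA eK.
have Bbe v x z : B v x (e v * z) = B v x z by rewrite /B mulrA eK.
pose E : res0 -> _ := tens_ext (ff := ff) (al := e) (be := e) B.
have ED : {morph E : u v / u + v} := tens_extD Bl Br Bk Bal Bbe.
have EB : {morph E : u v / u - v}.
  move=> u v; apply: (addIr (E v)); rewrite subrK -ED subrK.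
  by [].
have Eelt v x z : E (elt0 v x z) = B v x z := tens_ext_elt ff Bl Br Bk Bal Bbe v x z.
(* On the generator at [c] the map gives [D (x c) z - D x (c z)], which the Leibniz rule reduces to
   [x * D c * z]. *)
have Ed1 : (fun w => E (res_d1 w)) =1 p.
  apply: tens_additive_eq => [u v|u v|c x z]; rewrite ?linearD ?ED ?pD //.
  rewrite res_d1_elt rel1_elt EB !Eelt /B DMr ractDl pD -ractM mulrA mp_gen_idem.
  rewrite [e (tgt c) * _]mulrA mp_idem_gen addrK.
  rewrite -[in RHS](elt_be _ _ (fun c => eK (src c))) elt1E; apply: pE.
  rewrite -ractB -scalerBr; apply: (sub_bimod_ract S); exact: (sub_bimodZ S).
apply: coker_pi_eq0; rewrite -/p -Ed1 y0.
by apply: (addrI (E 0)); rewrite -ED !addr0.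
Qed.

End MeshResolution.

(** * The unit comparing gamma with the signed translation *)

(** The form is the preimage [F] of 1: the twisted left action on 1 gives [a F = F (eta a)], and
    freeness of the right module generated by [F] is nondegeneracy. *)
Lemma nakayama_frobenius (K : fieldType) (A : algType K) (eta : alg_aut A) :
  is_nakayama eta -> exists f, frobenius_form eta f.
Proof.
move=> [h [h' hK h'K]]; pose F : dual A := h' 1.
have hF : h F = 1 by apply: h'K.
have Fa a : dual_lact a F = dual_ract F (aut_fun eta a).
  apply: (can_inj hK).
  have -> : h (dual_lact a F) = (aut_fun eta a * (h F : A) :
    A) by apply: (linear_funZ (linearP h)).
  have -> : h (dual_ract F (aut_fun eta a)) = ((h F : A) * aut_fun eta a :
    A) by apply: (bimod_fun_ract h).
  by rewrite hF mulr1 mul1r.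
exists (val F); split=> [x y|k x|x a|a h0].
- exact: dualD.
- exact: dualZ.
- exact: (congr1 (fun G : dual A => val G x) (Fa a)).
have F0 : dual_ract F a = 0 by apply: dual_eqP => x; apply: h0.
have e1 : h (dual_ract F a) = ((h F : A) * a : A) by apply: (bimod_fun_ract h).
by rewrite F0 hF mul1r in e1; rewrite -e1; apply: (linear0 h).
Qed.

(* If q^1, .., q^(n+1) are linearly dependent, the lowest term of a relation inverts q. *)
Lemma left_regular_invertible (K : fieldType) (A : algType K) (q : A) (n : nat) (y :
  'I_n -> A) :
  (forall a, q * a = 0 -> a = 0) ->
  (forall a, exists c : 'I_n -> K, q * a = \sum_i c i *: y i) ->
  exists q', q * q' = 1 /\ q' * q = 1.
Proof.
move=> qreg span.
have [c cE] := choice (fun k : 'I_n.+1 => span (q ^+ k)).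
pose M : 'M[K]_(n.+1, n) := \matrix_(k, i) c k i.
have : kermx M != 0.
  rewrite -mxrank_eq0 mxrank_ker subn_eq0 -ltnNge.
  exact: leq_ltn_trans (rank_leq_col M) _.
move/rowV0Pn => [v /sub_kermxP vM v0].
pose p := \poly_(k < n.+1) v 0 (inord k).
have p0 : p != 0.
  apply: contraNneq v0 => p0; apply/eqP/rowP => k; rewrite mxE.
  by have := congr1 (fun r : {poly K} => r`_k) p0;
    rewrite coef0 coef_poly ltn_ord inord_val.
have hp : horner_alg q p = 0.
  apply: qreg; rewrite /p poly_def linear_sum mulr_sumr.
  transitivity (\sum_(k < n.+1) \sum_i (v 0 k * c k i) *: y i).
    apply: eq_bigr => k _; rewrite linearZ /= rmorphXn /= horner_algX inord_val.
    by rewrite -scalerAl mul1r -scalerAr cE scaler_sumr; apply: eq_bigr => i _;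
      rewrite scalerA.
  rewrite exchange_big big1 // => i _; rewrite -scaler_suml.
  have /rowP/(_ i) := vM; rewrite !mxE => vMi.
  rewrite (_ : \sum_k _ = 0) ?scale0r // -[RHS]vMi.
  by apply: eq_bigr => k _; rewrite mxE.
have qX k a : q ^+ k * a = 0 -> a = 0.
  by elim: k a => [|k IH] a; [rewrite mul1r | rewrite exprSr -mulrA => /IH/qreg].
(* Regularity removes the factor ['X^k]; the remaining [p1] has nonzero constant term, so
   [p1 (q) = 0] exhibits the inverse of [q] as a polynomial in [q]. *)
have [k [p1 /implyP/(_ p0) np1 def]] := multiplicity_XsubC p 0.
rewrite subr0 mulrC in def.
have hp1 : horner_alg q p1 = 0.
  by apply: (qX k); rewrite -hp def rmorphM rmorphXn /= horner_algX.
have [p2 p12] : exists p2, p1 - (p1.[0])%:P = p2 * ('X - 0%:P).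
  by apply/factor_theorem; rewrite rootE !hornerE subrr.
have c0 : p1.[0] != 0 by rewrite -rootE.
rewrite subr0 in p12.
have e1 : horner_alg q p2 * q = - (p1.[0])%:A.
  have := congr1 (horner_alg q) p12.
  by rewrite rmorphM /= horner_algX rmorphB /= hp1 horner_algC sub0r.
have comm : q * horner_alg q p2 = horner_alg q p2 * q.
  have := congr1 (horner_alg q) (mulrC 'X p2).
  by rewrite !rmorphM /= horner_algX.
exists (- (p1.[0])^-1 *: horner_alg q p2).
rewrite -scalerAr -scalerAl comm e1 scaleNr scalerN opprK scalerA mulVf //.
by rewrite scale1r.
Qed.

Section ThirdSyzygy.
Variables (K : fieldType) (A : algType K) (P : mesh_presentation A).
Local Notation e := (@mp_idem K A P).
Local Notation g := (@mp_gen K A P).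
Local Notation "c ^'" := (mp_mesh c).
Local Notation src := (@mp_src K A P).
Local Notation tgt := (@mp_tgt K A P).
Local Notation tau := (@mp_vtx K A P).
Local Notation tauA := (@mp_arr K A P).
Variables (eta mu : alg_aut A).

(** Two terms of the differentiated relations reach the generator at [b']: the one of [c = b] with
    [gen1 (c')], and the one of [c = b'] with [gen1 c]. *)
Lemma res_d2_val f (ff : frobenius_form eta f) (w : res2 P ff) b u :
  val (res_d2 P ff w) (b^') u = val w (tgt b) (g b * u) + g ((b^')^') * val w (src b) u.
Proof.
pose F (w : res2 P ff) := val (res_d2 P ff w) (b^') u.
pose G (w : res2 P ff) := val w (tgt b) (g b * u) + g ((b^')^') * val w (src b) u.
move: w; apply: (@tens_additive_eq _ _ _ _ _ _ _ _ _ F G) => [w w'|w w'|v x y].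
- by rewrite /F linearD.
- by rewrite /G !tensD mulrDr addrACA.
rewrite /F /G res_d2_elt rel2_elt.
have -> (J : finType) (Q : pred J) (H : J -> res1 P ff) c z :
    val (\sum_(i | Q i) H i) c z = \sum_(i | Q i) val (H i) c z.
  by apply: (big_morph (fun w : res1 P ff => val w c z)).
under eq_bigr do rewrite tensD.
rewrite big_split !eltE; congr (_ + _).
  under eq_bigr do rewrite eltE (inj_eq (@mp_mesh_inj _ _ P)).
  rewrite -big_mkcondr /=; case: eqP => [->|/eqP nv].
    rewrite (big_pred1 b) => [|c]; last by rewrite /= andb_idl // => /eqP ->.
    by rewrite mp_tgt_mesh mp_src_mesh -!mulrA (mulrA (g b)) mp_gen_idem
      (mulrA (e _) (g b)) mp_idem_gen.
  by rewrite big1 // => c /andP [/eqP tc /eqP cb]; rewrite -tc cb eqxx in nv.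
under eq_bigr do rewrite eltE.
rewrite -big_mkcondr /=; case: eqP => [vs|/eqP nv].
  rewrite (big_pred1 (b^')) => [|c]; last first.
    by rewrite /= andb_idl // => /eqP ->; rewrite mp_tgt_mesh vs.
  rewrite mp_tgt_mesh -scalerAr !mulrA; congr (_ *: (_ * _)).
  by rewrite -[in LHS]mp_tgt_mesh mp_idem_gen mp_meshK -mp_src_arr mp_gen_idem.
rewrite mulr0 big1 // => c /andP [/eqP tc /eqP cb].
by rewrite -tc cb mp_tgt_mesh eqxx in nv.
Qed.

(* A generator z of the third syzygy is an operator with z (g b u) = - g (tauA b) z u and
   z (u * eta^-1 a) = z u * mu^-1 a; the element q is its value at 1. *)
Lemma third_syzygy_unit : is_nakayama eta ->
  is_nth_syzygy 3 (regular_bimod A) (twist_bimod mu (regular_bimod A)) ->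
  exists q q', [/\ q * q' = 1, q' * q = 1,
    forall v, q * aut_inv_fun (aut_comp (aut_inv eta) mu) (e v) = e (tau v) * q
  & forall c, q * aut_inv_fun (aut_comp (aut_inv eta) mu) (g c) = - (g (tauA c) * q)].
Proof.
move=> /nakayama_frobenius [f ff] hmu.
have eK := @mp_idemK K A P.
have [||||||||i [i_inj i0]] := syzygy3_embedding (d0 := res_d0 P ff) (d1 := res_d1 P ff)
  (d2 := res_d2 P ff) _ _ _ _ _ _ _ _ hmu.
- exact: tens_projective.
- by apply: tens_projective => c; apply: eK.
- by apply: tens_projective => c; apply: eK.
- exact: res_d0_surj.
- exact: res_d01.
- exact: res_exact0.
- exact: res_d12.
- exact: res_exact1.
pose z : res2 P ff := i (1 : A).
(* In the twisted regular bimodule [a] acts on 1 from the left as [mu^-1 a] does from the right. *)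
have zl a v u : val z v (u * aut_inv_fun eta a) = val z v u * aut_inv_fun mu a.
  have h1 : a *: z = i (aut_inv_fun mu a * 1 : A).
    by rewrite -bimod_homZ.
  have h2 : ract z (aut_inv_fun mu a) = i (1 * aut_inv_fun mu a : A).
    by rewrite -bimod_fun_ract.
  rewrite mulr1 in h1; rewrite mul1r -h1 in h2.
  exact: esym (congr1 (fun w : res2 P ff => val w v u) h2).
have zr a : (forall v u, val z v u * a = 0) -> a = 0.
  move=> za; have : i (1 * a : A) = 0.
    by rewrite (bimod_fun_ract i 1 a); apply: tens_eqP => v u; apply: za.
  by rewrite mul1r -[in RHS](linear0 i) => /i_inj.
(* The components of [z] are supported on orthogonal idempotents on both sides, so their sum [L]
   still determines each of them. *)
pose L u := \sum_v val z v u.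
have z_idem v u : val z v (e v * u) = val z v u by apply: tens_fun_al.
have z_orth v w u : v != w -> val z v (e w * u) = 0.
  move=> vw; rewrite -z_idem mulrA mp_idem_orth // mul0r.
  by have := tens_funZ z v 0 0; rewrite !scale0r.
have z_tau v u : e (tau v) * val z v u = val z v u.
  exact: (tens_fun_be (be := e \o tau) (fun v => eK (tau v))).
have Le v u : L (e v * u) = val z v u.
  rewrite /L (bigD1 v) //= z_idem big1 ?addr0 // => w wv.
  by rewrite z_orth.
have eL v u : e (tau v) * L u = val z v u.
  rewrite /L mulr_sumr (bigD1 v) //= z_tau big1 ?addr0 // => w wv.
  rewrite -z_tau mulrA mp_idem_orth ?mul0r //.
  by rewrite (inj_eq (@mp_vtx_inj _ _ P)) eq_sym.
have Lg b u : L (g b * u) = - (g (tauA b) * L u).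
  have := congr1 (fun w : res1 P ff => val w (b^') u) (i0 (1 : A)).
  rewrite /= -/z res_d2_val => /eqP; rewrite addr_eq0 => /eqP h.
  rewrite -[in LHS](mp_idem_gen b) -mulrA Le h; congr (- _).
  by rewrite mp_meshK -eL mulrA -mp_src_arr mp_gen_idem.
have L1 a : L (aut_inv_fun eta a) = L 1 * aut_inv_fun mu a.
  rewrite /L mulr_suml; apply: eq_bigr => v _.
  by rewrite -zl mul1r.
pose q := L 1.
have gam a : q * aut_inv_fun (aut_comp (aut_inv eta) mu) a = L a.
  by rewrite -[X in _ = L X](aut_funK eta) L1.
(* If [q * a = 0] then induction along paths with [Lg] gives [L u * a = 0] for all [u], so [z] is
   killed by [a]; the embedding [i] being injective, [a = 0]. *)
have qreg a : q * a = 0 -> a = 0.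
  move=> qa; apply: zr.
  have LD : {morph L : u v / u + v}.
    move=> u v; rewrite -big_split; apply: eq_bigr => w _; exact: tens_fun_additive.
  have LZ k u : L (k *: u) = k *: L u.
    by rewrite scaler_sumr; apply: eq_bigr => w _; apply: tens_funZ.
  suff La u : L u * a = 0 by move=> v u; rewrite -Le.
  elim/(@mp_ind K A P): u => [x y hx hy|k x hx|v|c x hx].
  - by rewrite LD mulrDl hx hy addr0.
  - by rewrite LZ -scalerAl hx scaler0.
  - by rewrite -[e v]mulr1 Le -eL -mulrA qa mulr0.
  - by rewrite Lg mulNr -mulrA hx mulr0 oppr0.
(* Every [q * a] is a value of [L], as [mu] and [eta] are bijective, and the values of [L] lie in
   the span of the right-hand factors of an expression of [z]. *)
have [s zs] := tens_rep z.
have [||q' [qq' q'q]] := @left_regular_invertible K A q (size s)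
    (fun j => e (tau (tnth (in_tuple s) j).1.1) * (tnth (in_tuple s) j).2).
- exact: qreg.
- move=> a; exists (fun j => let t := tnth (in_tuple s) j in
    f (t.1.2 * e t.1.1 * aut_inv_fun eta (aut_fun mu a))).
  rewrite -{1}[a](aut_funK mu) -L1 /L zs.
  under eq_bigr do rewrite val_sum_elt big_tnth.
  rewrite exchange_big; apply: eq_bigr => j _.
  rewrite (bigD1 (tnth (in_tuple s) j).1.1) //= /tens_fun eqxx big1 ?addr0 // => v nv.
  by rewrite eq_sym (negPf nv).
exists q, q'; split=> //.
- by move=> v; rewrite gam -[e v]mulr1 Le -eL.
- by move=> c; rewrite gam -[g c]mulr1 Lg.
Qed.
End ThirdSyzygy.

Theorem theorem5p3 (K : closedFieldType) (D : oriented_diagram)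
    (hD : BCF_diagram D)
    (eta mu : alg_aut (mesh_alg D K))
    (heta : is_nakayama eta)
    (hmu : is_nth_syzygy 3 (regular_bimod (mesh_alg D K))
             (twist_bimod mu (regular_bimod (mesh_alg D K))))
    (T : lmodType (mesh_alg D K))
    (hfin : fin_dim T) (hbasic : basic T) (hmax : maximal_rigid T) :
  equivariant (aut_comp (aut_inv eta) mu) T.
Proof.
have sigmaK := BCF_sigma_involutive hD.
have [q [q' [qq' q'q qe qg]]] :=
  third_syzygy_unit (mesh_alg_presentation K sigmaK) heta hmu.
exact: (maximal_rigid_equivariant qq' q'q qe qg hfin hbasic hmax).
Qed.
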